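(* Let $\mathsf M$ be a loopless matroid on $E=[n]$, and let $\mathcal L$ be a nef line bundle on the permutohedral variety $X_E$. Then $$\frac{1}{1+u}\,\chi\left(X_E,\ \lambda_u(\mathcal S_{\mathsf M}^{\vee})\,\lambda_{-1}(\mathcal Q_{\mathsf M}^{\vee})\,\mathcal L\right)\in\mathbb Z_{\ge 0}[u].$$ That is, the polynomial $\chi(X_E,\lambda_u(\mathcal S_{\mathsf M}^{\vee})\lambda_{-1}(\mathcal Q_{\mathsf M}^{\vee})\mathcal L)\in\mathbb Z[u]$ is divisible by $1+u$ and the quotient has nonnegative integer coefficients.
   Context: Fix a field $\Bbbk$ and $E=[n]=\{1,\dots,n\}$. Permutohedral variety. Let $N=\mathbb Z^E/\mathbb Z(1,\dots,1)$, $N_{\mathbb R}=N\otimes\mathbb R$; let $\bar e_S\in N$ be the image of $\sum_{i\in S}e_i$. The braid fan $\Sigma_E$ in $N_{\mathbb R}$ has cones $\sigma_{\mathcal F}=\mathrm{cone}(\bar e_{F_1},\dots,\bar e_{F_\ell})$ indexed by flags $\mathcal F:\varnothing\subsetneq F_1\subsetneq\cdots\subsetneq F_\ell\subsetneq E$. $X_E$ is the smooth projective toric variety over $\Bbbk$ of $\Sigma_E$ (dimension $n-1$), $K(X_E)$ is its Grothendieck ring of vector bundles, and $\chi(X_E,-):K(X_E)\to\mathbb Z$ is the Euler characteristic (extended linearly to polynomials in $u$). Initial matroids. For a matroid $\mathsf M$ on $E$ and $v\in N_{\mathbb R}$, $\mathrm{in}_v\mathsf M$ is the matroid whose bases are the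 bases $B$ of $\mathsf M$ maximizing $\sum_{i\in B}v_i$ (independent of the lift of $v$ to $\mathbb R^E$); it depends only on the cone $\sigma_{\mathcal F}$ whose relative interior contains $v$, and is then written $\mathrm{in}_{\mathcal F}\mathsf M$. If $\mathcal F$ is a maximal flag, $\mathrm{in}_{\mathcal F}\mathsf M$ has a unique basis $B_{\mathcal F}(\mathsf M)$. Tautological classes (Berget–Eur–Spink–Tseng). Let $H=\mathbb G_m^E$ with coordinate characters $t_i$ act on $X_E$ through the dense torus $H/\mathbb G_m$ (cocharacter lattice $N$). For a maximal flag $\mathcal F$ with $F_a=\{i_1,\dots,i_a\}$, the tangent space at the corresponding fixed point $p_{\mathcal F}$ has characters $t_{i_a}/t_{i_{a+1}}$, $1\le a\le n-1$. There are unique classes $\mathcal S_{\mathsf M},\mathcal Q_{\mathsf M}\in K_H(X_E)$ whose duals restrict at each $p_{\mathcal F}$ to $\mathcal S_{\mathsf M}^\vee|_{p_{\mathcal F}}=\sum_{i\in B_{\mathcal F}(\mathsf M)}t_i$ and $\mathcal Q_{\mathsf M}^\vee|_{p_{\mathcal F}}=\sum_{i\notin B_{\mathcal F}(\mathsf M)}t_i$. The same symbols denote their images in $K(X_E)$ after forgetting the $H$-action. Exterior powers. For a vector bundle $\mathcal E$, $\lambda_u(\mathcal E)=\sum_i[\wedge^i\mathcal E]u^i$; this is extended to virtual classes by $\lambda_u(\alpha+\beta)=\lambda_u(\alpha)\lambda_u(\beta)$. For the tautological classes and their duals, $\lambda_u$ is a polynomial in $u$ (of degree at most the rank). *)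

(* Defs.v *)
From Stdlib Require Import ClassicalEpsilon.
From HB Require Import structures.
From mathcomp Require Import all_boot all_order all_algebra.
From mathcomp Require Import fraction.
From mathcomp Require Import mpoly.
Set Implicit Arguments.
Unset Strict Implicit.
Unset Printing Implicit Defensive.
Import Order.TTheory GRing.Theory Num.Theory.
Local Open Scope ring_scope.

Record matroid (n : nat) := Matroid {
  bases :> {set {set 'I_n}};
  bases_neq0 : bases != set0;
  bases_exchange : forall B C : {set 'I_n}, B \in bases -> C \in bases ->
    forall x, x \in B :\: C ->
    exists2 y, y \in C :\: B & y |: (B :\ x) \in bases }.

Definition loopless n (M : matroid n) : Prop :=
  forall i : 'I_n, exists2 B : {set 'I_n}, B \in bases M & i \in B.

Definition mrank n (M : matroid n) : nat := \max_(B in bases M) #|B|.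

Definition initial_bases n (M : matroid n) (R : realDomainType)
    (v : 'I_n -> R) : {set {set 'I_n}} :=
  [set B in bases M |
    [forall C in bases M, \sum_(i in C) v i <= \sum_(i in B) v i]].

(* Faces of the braid fan: a flag is the set of its members F_1, ..., F_l. *)
Definition is_flag n (F : {set {set 'I_n}}) : bool :=
  [forall S in F, (S != set0) && (S != setT)] &&
  [forall S in F, forall T in F, (S \subset T) || (T \subset S)].

(* sum_{S in F} e_S lies in the relative interior of sigma_F. *)
Definition flag_initial_bases n (M : matroid n) (F : {set {set 'I_n}}) :
    {set {set 'I_n}} :=
  initial_bases M (fun i : 'I_n => \sum_(S in F) (i \in S)%:R : int).

(* Maximal flags; they index the torus-fixed points p_F of X_E and the maximal
   affine charts U_F.  Since sigma_F \cap sigma_G = sigma_{F :&: G}, one has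
   U_F \cap U_G = U_{F :&: G} for the intersection of flags as sets. *)
Definition chart n := {F : {set {set 'I_n}} | maxset (@is_flag n) F}.

(* The character lattice Z^E of H = Gm^E. *)
Definition lattice n := {ffun 'I_n -> int}.

Definition tchar n (i : 'I_n) : lattice n := [ffun j => (j == i)%:R].

Definition pairing n (m : lattice n) (S : {set 'I_n}) : int := \sum_(i in S) m i.

(* sigma_F^\vee \cap M, where M = {m in Z^E | sum_i m_i = 0} is dual to
   N = Z^E / Z(1,...,1). *)
Definition dual_cone n (F : {set {set 'I_n}}) (m : lattice n) : bool :=
  (pairing m setT == 0) && [forall S in F, 0 <= pairing m S].

(* The function field k(x_1, ..., x_n) of H; the function field of X_E is the
   subfield generated by the monomials of total degree 0. *)
Definition ratfun (k : fieldType) (n : nat) := {fraction {mpoly k[n]}}.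

Definition rconst (k : fieldType) n (c : k) : ratfun k n :=
  FracField.tofrac (mpolyC n c).

Definition rmonom (k : fieldType) n (m : lattice n) : ratfun k n :=
  \prod_(i < n) FracField.tofrac (mpolyX k (mnm1 i)) ^ m i.

(* Regular functions on U_F = Spec k[sigma_F^\vee \cap M]. *)
Definition regular (k : fieldType) n (F : {set {set 'I_n}}) (a : ratfun k n) :
    Prop :=
  exists s : seq (lattice n * k),
    all (fun p => dual_cone F p.1) s /\
    a = \sum_(p <- s) rconst n p.2 * rmonom k p.1.

(* Vector bundles on X_E, given by transition functions between frames (e^F_i)_i
   on the charts U_F: if a section is sum_i s^F_i e^F_i on U_F, then
   s^F_i = sum_j (trans F G i j) s^G_j.  As U_F is an affine space, every vector
   bundle is trivial on U_F (Quillen-Suslin), so nothing is lost. *)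
Record bundle (k : fieldType) (n : nat) := Bundle {
  idx : finType;
  trans : chart n -> chart n -> idx -> idx -> ratfun k n }.

Definition is_bundle (k : fieldType) n (E : bundle k n) : Prop :=
  [/\ forall F G i j, regular (val F :&: val G) (@trans k n E F G i j),
      forall F i j, @trans k n E F F i j = (i == j)%:R
    & forall F G P i l,
        \sum_j @trans k n E F G i j * @trans k n E G P j l =
        @trans k n E F P i l].

Definition dual (k : fieldType) n (E : bundle k n) : bundle k n :=
  @Bundle k n (idx E) (fun F G i j => trans G F j i).

Definition tensor (k : fieldType) n (D E : bundle k n) : bundle k n :=
  @Bundle k n (idx D * idx E)%type
    (fun F G i j => trans F G i.1 j.1 * trans F G i.2 j.2).

Definition ksubset (I : finType) (p : nat) := {S : {set I} | #|S| == p}.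

Definition kelt (I : finType) p (S : ksubset I p) (a : 'I_p) : I :=
  enum_val (cast_ord (esym (eqP (valP S))) a).

Definition exterior (k : fieldType) n (E : bundle k n) (p : nat) : bundle k n :=
  @Bundle k n (ksubset (idx E) p)
    (fun F G S T => \det (\matrix_(a < p, b < p) trans F G (kelt S a) (kelt T b))).

Definition trivial_line (k : fieldType) n : bundle k n :=
  @Bundle k n unit (fun _ _ _ _ => 1).

(* An H-equivariant bundle: H acts on the fibre at p_F with the character
   wt F i on e^F_i, the frames being homogeneous (graded projective modules over
   k[sigma_F^\vee \cap M], F maximal, are graded free).  As the coordinate
   function x^m is an eigenvector of character -m for (t.f)(x) = f(t^-1 x), the
   transition function must be a scalar multiple of x^(wt F i - wt G j).  With
   this convention the tangent characters at p_F are t_{i_a}/t_{i_{a+1}}, these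
   being the exponents of the coordinate functions on U_F. *)
Record ebundle (k : fieldType) (n : nat) := EBundle {
  forget :> bundle k n;
  wt : chart n -> idx forget -> lattice n }.

Definition is_ebundle (k : fieldType) n (E : ebundle k n) : Prop :=
  is_bundle E /\
  forall F G i j, exists c : k,
    @trans k n E F G i j = rconst n c * rmonom k (@wt k n E F i - @wt k n E G j).

Definition edual (k : fieldType) n (E : ebundle k n) : ebundle k n :=
  @EBundle k n (dual E) (fun F i => - @wt k n E F i).

(* Every element of K_H(X_E) is a difference [A] - [B] of classes of
   H-equivariant bundles; it is represented by the pair (A, B). *)
Definition eclass (k : fieldType) n := (ebundle k n * ebundle k n)%type.

Definition is_eclass (k : fieldType) n (x : eclass k n) : Prop :=
  is_ebundle x.1 /\ is_ebundle x.2.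

Definition eclass_dual (k : fieldType) n (x : eclass k n) : eclass k n :=
  (edual x.1, edual x.2).

(* Restriction to K_H(p_F) = Z[Z^E]; an element of the group ring is given by
   its coefficient function. *)
Definition localize (k : fieldType) n (x : eclass k n) (F : chart n)
    (m : lattice n) : int :=
  #|[set i | wt (e := x.1) F i == m]|%:Z - #|[set i | wt (e := x.2) F i == m]|%:Z.

Definition char_sum n (A : {set 'I_n}) (m : lattice n) : int :=
  \sum_(i in A) (m == tchar i)%:R.

(* x represents S_M, resp. Q_M. *)
Definition is_taut_sub (k : fieldType) n (M : matroid n) (x : eclass k n) : Prop :=
  is_eclass x /\
  forall (F : chart n) (B : {set 'I_n}), B \in flag_initial_bases M (val F) ->
  forall m, localize (eclass_dual x) F m = char_sum B m.

Definition is_taut_quot (k : fieldType) n (M : matroid n) (x : eclass k n) : Prop :=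
  is_eclass x /\
  forall (F : chart n) (B : {set 'I_n}), B \in flag_initial_bases M (val F) ->
  forall m, localize (eclass_dual x) F m = char_sum (~: B) m.

(* Elements of K(X_E), represented by formal sums sum_a c_a [E_a]. *)
Definition kclass (k : fieldType) n := seq (int * bundle k n).

Definition kone (k : fieldType) n : kclass k n := [:: (1, trivial_line k n)].

Definition kscale (k : fieldType) n (c : int) (x : kclass k n) : kclass k n :=
  [seq (c * p.1, p.2) | p <- x].

Definition kmul (k : fieldType) n (x y : kclass k n) : kclass k n :=
  [seq (p.1 * q.1, tensor p.2 q.2) | p <- x, q <- y].

Definition ksum (k : fieldType) n (m : nat) (f : nat -> kclass k n) : kclass k n :=
  flatten [seq f i | i <- iota 0 m].

(* Power series in u with coefficients in K(X_E). *)
Definition kseries (k : fieldType) n := nat -> kclass k n.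

Definition series_mul (k : fieldType) n (f g : kseries k n) : kseries k n :=
  fun i => ksum i.+1 (fun j => kmul (f j) (g (i - j)%N)).

Definition series_one (k : fieldType) n : kseries k n :=
  fun i => if i == 0%N then kone k n else [::].

(* 1/f = sum_j (-1)^j (f - 1)^j for f with constant term 1; only j <= i
   contributes to the coefficient of u^i. *)
Definition series_inv (k : fieldType) n (f : kseries k n) : kseries k n :=
  let f1 : kseries k n := fun i => if i == 0%N then [::] else f i in
  fun i => ksum i.+1 (fun j =>
    kscale ((-1) ^+ j) (iter j (series_mul f1) (@series_one k n) i)).

Definition lambda_bundle (k : fieldType) n (E : bundle k n) : kseries k n :=
  fun i => [:: (1, exterior E i)].

(* lambda_u([A] - [B]) = lambda_u(A) / lambda_u(B), after forgetting the action
   of H. *)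
Definition lambda (k : fieldType) n (x : eclass k n) : kseries k n :=
  series_mul (lambda_bundle x.1) (series_inv (lambda_bundle x.2)).

(* lambda_{-1}(x), where lambda_u(x) is a polynomial of degree at most r. *)
Definition lambda_minus1 (k : fieldType) n (r : nat) (x : eclass k n) : kclass k n :=
  ksum r.+1 (fun i => kscale ((-1) ^+ i) (lambda x i)).

(* Z / B has dimension d over k, for subspaces B <= Z of a k-vector space V with
   scalar multiplication sc. *)
Definition has_dim (k : fieldType) (V : zmodType) (sc : k -> V -> V)
    (Z B : V -> Prop) (d : nat) : Prop :=
  exists b : 'I_d -> V, (forall i, Z (b i)) /\
  forall z, Z z -> exists! c : {ffun 'I_d -> k}, B (z - \sum_i sc (c i) (b i)).

Definition dim (k : fieldType) (V : zmodType) (sc : k -> V -> V)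
    (Z B : V -> Prop) : nat :=
  epsilon (inhabits 0%N) (has_dim sc Z B).

(* The Cech complex of E for the affine cover (U_F)_F, F a maximal flag.
   A cochain c assigns to each set W of charts a section over the intersection
   U_W of its members; c (W, F, i) is its i-th coordinate in the frame of U_F. *)
Definition cech (k : fieldType) n (E : bundle k n) :=
  {ffun {set chart n} * chart n * idx E -> ratfun k n}.

Definition common n (W : {set chart n}) : {set {set 'I_n}} :=
  \bigcap_(F in W) val F.

Definition cech_scale (k : fieldType) n (E : bundle k n) (a : k) (c : cech E) :
    cech E := [ffun x => rconst n a * c x].

Definition is_cochain (k : fieldType) n (E : bundle k n) (p : nat) (c : cech E) :
    Prop :=
  forall W : {set chart n},
    if #|W| == p.+1 then
      (forall F G i, c (W, F, i) = \sum_j trans F G i j * c (W, G, j)) /\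
      (forall F i, F \in W -> regular (common W) (c (W, F, i)))
    else forall F i, c (W, F, i) = 0.

Definition cech_diff (k : fieldType) n (E : bundle k n) (c : cech E) : cech E :=
  [ffun x : {set chart n} * chart n * idx E =>
     \sum_(P in x.1.1)
       (-1) ^+ index P (enum x.1.1) * c (x.1.1 :\ P, x.1.2, x.2)].

Definition is_cocycle (k : fieldType) n (E : bundle k n) p (c : cech E) : Prop :=
  is_cochain p c /\ cech_diff c = 0.

Definition is_coboundary (k : fieldType) n (E : bundle k n) p (c : cech E) : Prop :=
  if p is q.+1 then exists2 b : cech E, is_cochain q b & c = cech_diff b
  else c = 0.

(* dim_k H^p(X_E, E) *)
Definition cohom_dim (k : fieldType) n (E : bundle k n) (p : nat) : nat :=
  dim (@cech_scale k n E) (@is_cocycle k n E p) (@is_coboundary k n E p).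

Definition euler_char (k : fieldType) n (E : bundle k n) : int :=
  \sum_(p < #|{: chart n}|) (-1) ^+ p * (cohom_dim E p)%:Z.

Definition chi (k : fieldType) n (x : kclass k n) : int :=
  \sum_(p <- x) p.1 * euler_char p.2.

Definition line (k : fieldType) n := chart n -> chart n -> ratfun k n.

Definition line_bundle (k : fieldType) n (L : line k n) : bundle k n :=
  @Bundle k n unit (fun F G _ _ => L F G).

(* K is a function field in one variable over k, i.e. the function field of a
   regular projective curve C over k. *)
Definition is_curve_field (k K : fieldType) (f : {rmorphism k -> K}) : Prop :=
  exists (x : K) (b : seq K),
    (forall p : {poly k}, (map_poly f p).[x] = 0 -> p = 0) /\
    forall y : K, exists (q : {poly k}) (p : nat -> {poly k}),
      (map_poly f q).[x] != 0 /\
      (map_poly f q).[x] * y = \sum_(i < size b) (map_poly f (p i)).[x] * b`_i.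

(* Normalized discrete valuations of K trivial on k, i.e. closed points of C;
   the value at 0 is a convention. *)
Definition is_place (k K : fieldType) (f : {rmorphism k -> K}) (v : K -> int) :
    Prop :=
  [/\ v 0 = 0,
      forall c : k, v (f c) = 0,
      forall a b, a != 0 -> b != 0 -> v (a * b) = v a + v b,
      forall a b, a != 0 -> b != 0 -> a + b != 0 ->
        Num.min (v a) (v b) <= v (a + b)
    & exists a, v a = 1].

Definition val_ring (K : fieldType) (v : K -> int) (a : K) : Prop :=
  a = 0 \/ 0 <= v a.

Definition val_ideal (K : fieldType) (v : K -> int) (a : K) : Prop :=
  a = 0 \/ 0 < v a.

Definition place_degree (k K : fieldType) (f : {rmorphism k -> K}) (v : K -> int)
    (d : nat) : Prop :=
  has_dim (fun (c : k) (y : K) => f c * y) (val_ring v) (val_ideal v) d.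

(* phi is a k-algebra morphism on the regular functions of U_F whose associated
   point Spec K -> U_F lies in the torus orbit of F.  A maximal chart U_G
   contains this point iff F \subset G.  By the valuative criterion, the pairs
   (F, phi) are the morphisms from C to X_E. *)
Definition is_orbit_point (k K : fieldType) (f : {rmorphism k -> K}) n
    (F : {set {set 'I_n}}) (phi : ratfun k n -> K) : Prop :=
  [/\ is_flag F,
      forall c : k, phi (rconst n c) = f c,
      forall a b, regular F a -> regular F b -> phi (a + b) = phi a + phi b,
      forall a b, regular F a -> regular F b -> phi (a * b) = phi a * phi b
    & forall m, dual_cone F m ->
        (phi (rmonom k m) != 0) = [forall S in F, pairing m S == 0]].

(* The order at v of the frame of L on the chart U_P, viewed as a rational section
   of the pullback of L to C: the centre of v lies in some U_G, and
   e^P = (L G P) e^G there. *)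
Definition line_order (k K : fieldType) n (L : line k n) (F : {set {set 'I_n}})
    (phi : ratfun k n -> K) (P : chart n) (v : K -> int) (z : int) : Prop :=
  exists G : chart n,
    [/\ F \subset val G,
        forall a, regular (val G) a -> val_ring v (phi a)
      & z = v (phi (L G P))].

(* The pullback of L to C has degree d. *)
Definition pullback_degree (k K : fieldType) (f : {rmorphism k -> K}) n
    (L : line k n) (F : {set {set 'I_n}}) (phi : ratfun k n -> K) (d : int) : Prop :=
  exists P : chart n, F \subset val P /\
  exists (N : nat) (vs : 'I_N -> K -> int) (e : 'I_N -> nat) (z : 'I_N -> int),
    [/\ forall i j, i != j -> ~ (vs i =1 vs j),
        forall i, [/\ is_place f (vs i), place_degree f (vs i) (e i)
                    & line_order L F phi P (vs i) (z i)],
        forall v, is_place f v -> (forall i, ~ (v =1 vs i)) ->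
          line_order L F phi P v 0
      & d = \sum_i (e i)%:Z * z i].

(* Nonnegative degree on every curve. *)
Definition nef (k : fieldType) n (L : line k n) : Prop :=
  forall (K : fieldType) (f : {rmorphism k -> K})
    (F : {set {set 'I_n}}) (phi : ratfun k n -> K) (d : int),
    is_curve_field f -> is_orbit_point f F phi ->
    pullback_degree f L F phi d -> 0 <= d.

(* chi(X_E, lambda_u(S^\vee) lambda_{-1}(Q^\vee) L) in Z[u]; the classes S^\vee and
   Q^\vee have ranks rk M and n - rk M, which bound the degrees in u. *)
Definition chi_poly (k : fieldType) n (M : matroid n) (S Q : eclass k n)
    (L : line k n) : {poly int} :=
  \poly_(i < (mrank M).+1)
    chi (kmul (kmul (lambda (eclass_dual S) i)
                    (lambda_minus1 (n - mrank M) (eclass_dual Q)))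
              [:: (1, line_bundle L)]).

(* Main.v *)
(* Localization on the permutohedral variety turns the Euler characteristic into
   a sum over maximal flags, i.e. over orderings x_1, ..., x_n of E:
     sum \prod_j 1 / (1 - t_(x_j) / t_(x_(j-1)))
         * \prod_j (1 + u t_(x_j) or 1 - t_(x_j)) t_(x_j)^(a(F_j) - a(F_(j-1))),
   where the factor 1 - t occurs when x_j lies in the closure of F_(j-1), and a is
   the height function of the line bundle, which is submodular as L is nef.
   Such sums make sense between any two sets D and U.  Fix i in U \ D.  If
   a(X + i) - a(X) is constant, summing over the position of i expresses the sum by
   the same sums for the contraction and the deletion of i, with coefficients in
   {1, u} at t = 1.  Otherwise a is lowered by 1 on one set S after the other until
   the difference is constant, and each time the sum changes by the product of the
   sums from D to S and from S to U.  By induction on |U \ D| all sums are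
   (1 + u) q at t = 1 with q >= 0.

   The localization formula is proved for the alternating sum of Cech cohomology
   itself.  The Cech complex is graded by characters, and in almost all degrees it
   is exact, by a shelling of the charts.  Multiplying the generating function of
   the graded Euler characteristics by \prod_(i <> j) (1 - t_j / t_i) kills the
   cones containing a line, i.e. all intersections of two or more charts, and
   leaves the contributions of the single charts. *)
From Stdlib Require Import ClassicalEpsilon.
Require Import Defs.
From HB Require Import structures.
From mathcomp Require Import all_boot all_order all_algebra perm.
From mathcomp Require Import fraction mpoly.
From mathcomp Require Import ring lra zify.
Set Implicit Arguments.
Unset Strict Implicit.
Unset Printing Implicit Defensive.
Import Order.TTheory GRing.Theory Num.Theory.
Local Open Scope ring_scope.

(** * Sums over flags *)

(** The lowering step shapes the induction. The sum from D to S that it splits off has heights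
    lowered on all tight sets properly inside S but not on S: a submodular function with 1 added at
    the top, in general no longer submodular. So the claim is proved for [a] and for [raise a U]
    together, and the insertion of i is computed for both; with raised heights and a constant factor
    of i, the telescoping sum over its positions ends in 0 instead of 1. A weight m can fail to be
    exact only if some frame element is negative exactly on the descents of its chart, taken for a
    functional [xi] that defines the shelling. If this happens for [xi] and for [- xi], then m is
    bounded; hence finitely many weights matter. Localization is evaluated in the fractions of
    Z[u][s] with t_i = s^i: the powers are distinct and nonzero, so every link is defined, while the
    total, unlike its terms, has a value at s = 1. The line bundle comes without an action of H; one
    is produced from the fact that units among Laurent polynomials are monomials. Nefness is tested
    on the torus-invariant curves of two adjacent charts, where the degree is one defect of
    submodularity. *)

Section FlagSums.
Variables (K : fieldType) (n : nat) (t : 'I_n -> K) (u : K).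
Hypothesis t_neq0 : forall i, t i != 0.
Hypothesis t_inj : injective t.
Variable cl : {set 'I_n} -> 'I_n -> bool.
Hypothesis cl_sub : forall (X Y : {set 'I_n}) i, X \subset Y -> cl X i -> cl Y i.
Hypothesis cl_exch : forall (X : {set 'I_n}) i j, i \notin X -> j \notin X -> i != j ->
  (~~ cl X i + ~~ cl (i |: X) j = ~~ cl X j + ~~ cl (j |: X) i)%N.

Implicit Types (X Y D U S : {set 'I_n}) (a : {set 'I_n} -> int) (p : option 'I_n).

(* The inverse of 1 - t_x / t_q; None stands for the start of the ordering. *)
Definition link p (x : 'I_n) : K := if p is Some q then t q / (t q - t x) else 1.

Definition step a X x : K :=
  (if cl X x then 1 - t x else 1 + u * t x) * t x ^ (a (x |: X) - a X).

Fixpoint flag_sum_rec (m : nat) a p X U : K :=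
  if m is m'.+1 then
    \sum_(x in U :\: X) link p x * step a X x * flag_sum_rec m' a (Some x) (x |: X) U
  else 1.

(* The sum over the orderings x_1, ..., x_r of U \ X of the product of the
   link x_(j-1) x_j * step (X + x_1 + ... + x_(j-1)) x_j, where x_0 = p. *)
Definition flag_sum a p X U := flag_sum_rec #|U :\: X| a p X U.

Lemma flag_sum_end a p X U : U \subset X -> flag_sum a p X U = 1.
Proof. by rewrite -setD_eq0 /flag_sum => /eqP ->; rewrite cards0. Qed.

Lemma setDU1 U X x : U :\: (x |: X) = (U :\: X) :\ x.
Proof. by apply/setP => y; rewrite !inE negb_or; case: (y == x); rewrite ?andbF. Qed.

Lemma card_setDU1 U X x : x \in U :\: X -> #|U :\: X| = #|U :\: (x |: X)|.+1.
Proof. by move=> hx; rewrite setDU1 (cardsD1 x) hx. Qed.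

Lemma flag_sumE a p X U : ~~ (U \subset X) ->
  flag_sum a p X U =
  \sum_(x in U :\: X) link p x * step a X x * flag_sum a (Some x) (x |: X) U.
Proof.
rewrite -setD_eq0 => /set0Pn [y hy].
rewrite {1}/flag_sum (card_setDU1 hy) /=; apply: eq_bigr => x hx.
by rewrite /flag_sum; congr (_ * flag_sum_rec _ _ _ _ _); move: (card_setDU1 hy); rewrite (card_setDU1 hx) => -[].
Qed.

Lemma flag_sum_ind (P : {set 'I_n} -> Prop) U :
  (forall X, (forall x, x \in U :\: X -> P (x |: X)) -> P X) -> forall X, P X.
Proof.
move=> h X; have [m hm] := ubnP #|U :\: X|; elim: m X hm => // m IH X hm.
by apply: h => x hx; apply: IH; rewrite (card_setDU1 hx) in hm.
Qed.

Lemma eq_flag_sum a b p X U : X \subset U ->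
  (forall Y, X \subset Y -> Y \subset U -> a Y = b Y) ->
  flag_sum a p X U = flag_sum b p X U.
Proof.
move: X p; apply: (flag_sum_ind (U := U)) => X IH p sXU ab.
have [sUX|nUX] := boolP (U \subset X); first by rewrite !flag_sum_end.
rewrite !flag_sumE //; apply: eq_bigr => x hx; move: (hx); rewrite inE => /andP[xX xU].
have sx : x |: X \subset U by rewrite subUset sub1set xU.
rewrite (IH _ hx) //; last by move=> Y hY; apply: ab; apply: subset_trans hY; apply: subsetUr.
by congr (_ * _ * _); rewrite /step !ab ?subsetUr.
Qed.

Definition raise a U : {set 'I_n} -> int := fun X => a X + (X == U)%:R.

Lemma link_ratio x y : x != y -> link (Some x) y * (1 - t y / t x) = 1.
Proof.
move=> xy; have := t_neq0 x; rewrite /link => tx.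
have : t x - t y != 0 by rewrite subr_eq0 (inj_eq t_inj).
by move=> h; field; rewrite h tx.
Qed.

(** Only orderings through S change. If x completes S and y comes next, lowering S divides the step
    of x by t_x and multiplies the step of y by t_y, so the difference acquires the factor 1 - t_y /
    t_x, which cancels the link from x to y. Nothing ties the two halves together any more, hence a
    product whose second factor starts from [None]. *)
Lemma flag_sum_face a p X S U : X \proper S -> S \proper U ->
  flag_sum a p X U - flag_sum (fun Y => a Y - (Y == S)%:R) p X U =
  flag_sum a p X S * flag_sum a None S U.
Proof.
move=> + sSU; set b := fun Y => _.
have b_out Y : ~~ (Y \subset S) -> forall q, flag_sum b q Y U = flag_sum a q Y U.
  move: Y; apply: (flag_sum_ind (U := U)) => Y IH nYS q.
  have [sUY|nUY] := boolP (U \subset Y); first by rewrite !flag_sum_end.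
  rewrite !flag_sumE //; apply: eq_bigr => x hx.
  have nx : ~~ (x |: Y \subset S) by apply: contra nYS; apply: subset_trans; apply: subsetUr.
  rewrite IH //; congr (_ * _ * _); rewrite /step /b.
  have ne (Z : {set 'I_n}) : ~~ (Z \subset S) -> (Z == S) = false by apply: contraNF => /eqP ->.
  by rewrite !ne // !subr0.
move: X p; apply: (flag_sum_ind (U := U)) => X IH p sXS.
have nUX (Z : {set 'I_n}) : Z \proper U -> ~~ (U \subset Z) by move=> /properP[_ [x ? ?]]; apply/subsetPn; exists x.
have nX := nUX _ (proper_trans sXS sSU).
have nSX : ~~ (S \subset X) by case/properP: sXS => _ [x ? ?]; apply/subsetPn; exists x.
have sSU' := proper_sub sSU.
rewrite !(flag_sumE _ _ nX) (flag_sumE _ _ nSX) -sumrB mulr_suml.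
rewrite (bigID (mem S)) /= [X in _ + X]big1 ?addr0; last first.
  move=> x /andP[hx xS]; apply/eqP; rewrite subr_eq0; apply/eqP.
  have nx : ~~ (x |: X \subset S) by apply/subsetPn; exists x; rewrite ?setU11.
  rewrite b_out //; congr (_ * _ * _); rewrite /step /b.
  have -> : (x |: X == S) = false by apply: contraNF nx => /eqP ->.
  have -> : (X == S) = false by apply/eqP => E; rewrite E properxx in sXS.
  by rewrite !subr0.
have eqI : (fun x => (x \in U :\: X) && (x \in S)) =1 (fun x => x \in S :\: X).
  move=> x; rewrite !inE; case xS: (x \in S); rewrite ?andbF ?andbT //.
  by rewrite (subsetP sSU' _ xS) ?andbT ?andbF.
rewrite (eq_bigl _ _ eqI); apply: eq_bigr => x hx.
move: (hx); rewrite inE => /andP[xX xS].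
have xU : x \in U :\: X by rewrite inE xX (subsetP sSU').
have sxS : x |: X \subset S by rewrite subUset sub1set xS proper_sub.
have bX : b X = a X.
  by rewrite /b; have -> : (X == S) = false by [apply/eqP => E; rewrite E properxx in sXS]; rewrite subr0.
have [ex|nex] := eqVneq (x |: X) S; last first.
  have bx : b (x |: X) = a (x |: X) by rewrite /b (negbTE nex) subr0.
  have px : x |: X \proper S by rewrite properEneq nex.
  have -> : step b X x = step a X x by rewrite /step bX bx.
  by rewrite -mulrBr IH // mulrA.
have -> : step b X x = step a X x / t x.
  rewrite /step bX -mulrA; congr (_ * _); rewrite /b ex eqxx.
  by rewrite (_ : _ - 1 - _ = (a S - a X) + -1) ?expfzDr //; lra.
rewrite ex (flag_sum_end a _ (subxx S)) mulr1.
rewrite -!mulrA -!mulrBr; congr (_ * (_ * (_ * _))).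
rewrite !(flag_sumE _ _ (nUX _ sSU)) mulr_sumr -sumrB.
apply: eq_bigr => y; rewrite inE => /andP[yS yU].
have ny : ~~ (y |: S \subset S) by apply/subsetPn; exists y; rewrite ?setU11.
have xy : x != y by apply: contraNneq yS => <-.
have -> : step b S y = step a S y * t y.
  rewrite /step /b eqxx (_ : (y |: S == S) = false); last by apply: contraNF ny => /eqP ->.
  by rewrite subr0 (_ : _ - (_ - 1) = (a (y |: S) - a S) + 1) ?expfzDr // ?mulrA //; lra.
rewrite b_out //= mul1r -[RHS]mul1r -(link_ratio xy).
by rewrite /link; ring.
Qed.

(** * The position of one element in a flag sum *)

Section Insertion.
Variables (U : {set 'I_n}) (i : 'I_n) (iU : i \in U).

(** One minus the link from q to [i], and 0 at the start of the ordering: the potential in which the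
    sum over the positions of [i] telescopes. *)
Definition kappa p : K := if p is Some q then t i / (t i - t q) else 0.

Definition okp p X := if p is Some q then q \in X else true.

Arguments link : simpl never.
Arguments kappa : simpl never.

Lemma okp_U1 X x : okp (Some x) (x |: X). Proof. exact: setU11. Qed.

Definition unit_step (b : bool) : K := if b then 1 - t i else 1 + u * t i.

Lemma t_subr_neq0 (x y : 'I_n) : x != y -> t x - t y != 0.
Proof. by rewrite subr_eq0 (inj_eq t_inj). Qed.

(** Partial fractions: inserting [i] between [p] and [x] multiplies the link by a difference of
    potentials. *)
Lemma link_insert p X x : okp p X -> i \notin X -> x \notin X -> x != i ->
  link p i * link (Some i) x = link p x * (kappa (Some x) - kappa p).
Proof.
move=> + iX xX xi; have h1 := t_subr_neq0 xi.
case: p => [q|] /= hq; rewrite /link /kappa.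
  have h2 : t q - t i != 0 by apply: t_subr_neq0; apply: contraNneq iX => <-.
  have h3 : t q - t x != 0 by apply: t_subr_neq0; apply: contraNneq xX => <-.
  have h4 : t i - t q != 0 by rewrite -opprB oppr_eq0.
  have h5 : t i - t x != 0 by rewrite -opprB oppr_eq0.
  by field; rewrite ?h2 ?h3 ?h4 ?h5.
by rewrite !mul1r subr0.
Qed.

Lemma link_kappa p X : okp p X -> i \notin X -> link p i = 1 - kappa p.
Proof.
case: p => [q|] /= hq iX; rewrite /link /kappa ?subr0 //.
have h2 : t q - t i != 0 by apply: t_subr_neq0; apply: contraNneq iX => <-.
have h4 : t i - t q != 0 by rewrite -opprB oppr_eq0.
by field; rewrite h2 h4.
Qed.

Lemma setD1D X : (U :\ i) :\: X = (U :\: X) :\ i.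
Proof. by apply/setP => y; rewrite !inE; case: (y == i); rewrite ?andbF. Qed.

Lemma flag_sum_split a p X : i \notin X ->
  flag_sum a p X U = link p i * step a X i * flag_sum a (Some i) (i |: X) U
    + \sum_(x in (U :\: X) :\ i) link p x * step a X x * flag_sum a (Some x) (x |: X) U.
Proof.
move=> iX; rewrite flag_sumE; last by apply/subsetPn; exists i.
by rewrite (big_setD1 i) // inE iX.
Qed.

Lemma flag_sumE_del a p X : ~~ (U :\ i \subset X) ->
  flag_sum a p X (U :\ i) =
    \sum_(x in (U :\: X) :\ i) link p x * step a X x * flag_sum a (Some x) (x |: X) (U :\ i).
Proof. by move=> h; rewrite flag_sumE // setD1D. Qed.

Lemma flag_sumE_con a p X : i \notin X -> ~~ (U :\ i \subset X) ->
  flag_sum a p (i |: X) U =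
    \sum_(x in (U :\: X) :\ i)
      link p x * step a (i |: X) x * flag_sum a (Some x) (i |: (x |: X)) U.
Proof.
move=> iX h; rewrite flag_sumE ?setDU1; last by rewrite -subDset.
by apply: eq_bigr => x _; rewrite setUCA.
Qed.

Lemma in_setDD1 X x : i \notin X -> X \subset U :\ i -> x \in (U :\: X) :\ i ->
  [/\ x != i, x \notin X, x \in U :\: X, i \notin x |: X & x |: X \subset U :\ i].
Proof.
move=> iX sX; rewrite !inE => /and3P[xi xX xU]; split=> //.
- by rewrite xX.
- by rewrite negb_or eq_sym xi.
- by rewrite subUset sub1set !inE xi xU.
Qed.

(** Under this condition the power of t_x in the step of any other element x does not depend on
    whether [i] has come before. *)
Definition detached a (c : int) (X : {set 'I_n}) :=
  forall Y, X \subset Y -> Y \subset U :\ i -> a (i |: Y) = a Y + c.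

Lemma detached_sub a c X x : detached a c X -> detached a c (x |: X).
Proof. by move=> h Y hY; apply: h; apply: subset_trans hY; apply: subsetUr. Qed.

Lemma step_detached a c X : X \subset U :\ i -> detached a c X ->
  step a X i = unit_step (cl X i) * t i ^ c.
Proof. by move=> sX h; rewrite /step h // addrAC subrr add0r. Qed.

Lemma step_con a c X x : x |: X \subset U :\ i -> detached a c X ->
  step a (i |: X) x =
  (if cl (i |: X) x then 1 - t x else 1 + u * t x) * t x ^ (a (x |: X) - a X).
Proof.
move=> sxX h; have sX : X \subset U :\ i by apply: subset_trans sxX; apply: subsetUr.
rewrite /step setUCA !h ?subsetUr //; congr (_ * t x ^ _); lra.
Qed.

Lemma cl_same X x : i \notin X -> x \notin X -> x != i -> cl (x |: X) i = cl X i ->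
  cl (i |: X) x = cl X x.
Proof.
move=> iX xX xi E; have := cl_exch xX iX xi; rewrite E.
by case: (cl X i); case: (cl X x); case: (cl _ x).
Qed.

(** The factor of [i] is the same at every position and the other factors do not notice [i], so only
    links have to be summed. The sum telescopes from [kappa p] to 1, its value after the last
    element. *)
Lemma insert_pure a c b p X : okp p X -> i \notin X -> X \subset U :\ i ->
  detached a c X -> (forall Y, X \subset Y -> Y \subset U :\ i -> cl Y i = b) ->
  flag_sum a p X U = unit_step b * t i ^ c *
    (flag_sum a p X (U :\ i) - kappa p * flag_sum a p (i |: X) U).
Proof.
move: X p; apply: (flag_sum_ind (U := U)) => X IH p hp iX sX fr cb.
rewrite flag_sum_split //.
have [sUX|nUX] := boolP (U :\ i \subset X).
  have EX : X = U :\ i by apply/eqP; rewrite eqEsubset sX sUX.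
  have E1 : (U :\: X) :\ i = set0 by rewrite -setD1D; apply/eqP; rewrite setD_eq0.
  have E2 : U \subset i |: X by rewrite -subDset.
  rewrite E1 big_set0 !(flag_sum_end _ _ E2) (flag_sum_end _ _ sUX).
  by rewrite (step_detached sX fr) cb // (link_kappa hp iX); ring.
rewrite flag_sumE_con // flag_sumE_del // flag_sumE_con //.
rewrite !mulr_sumr -sumrB mulr_sumr -big_split /=.
apply: eq_bigr => x hx; have [xi xX xUX ix sxX] := in_setDD1 iX sX hx.
rewrite (step_detached sX fr) cb // (IH x xUX _ (okp_U1 _ _)) //; last 2 first.
- exact: detached_sub.
- by move=> Y hY; apply: cb; apply: subset_trans hY; apply: subsetUr.
rewrite (step_con sxX fr) cl_same ?cb ?subsetUr // -/(step a X x).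
transitivity (link p i * link (Some i) x * (unit_step b * t i ^ c) * step a X x
    * flag_sum a (Some x) (i |: (x |: X)) U
  + link p x * step a X x * (unit_step b * t i ^ c *
      (flag_sum a (Some x) (x |: X) (U :\ i)
       - kappa (Some x) * flag_sum a (Some x) (i |: (x |: X)) U))).
  by ring.
by rewrite (link_insert hp iX xX xi); ring.
Qed.

(** Once [i] lies in the closure, exchange shows that it does not change the closure status of any
    other element, so contraction and deletion of [i] have the same steps. *)
Lemma flag_sum_loop a c p X : i \notin X -> X \subset U :\ i -> detached a c X ->
  cl X i -> flag_sum a p (i |: X) U = flag_sum a p X (U :\ i).
Proof.
move: X p; apply: (flag_sum_ind (U := U)) => X IH p iX sX fr cX.
have [sUX|nUX] := boolP (U :\ i \subset X).
  by rewrite !flag_sum_end // -subDset.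
rewrite flag_sumE_con // flag_sumE_del //.
apply: eq_bigr => x hx; have [xi xX xUX ix sxX] := in_setDD1 iX sX hx.
have cx : cl (x |: X) i by apply: cl_sub cX; apply: subsetUr.
rewrite IH //; last exact: detached_sub.
by rewrite (step_con sxX fr) cl_same ?cx ?cX.
Qed.

(** The factor of [i] changes once, at the element x that brings [i] into the closure. By exchange x
    lies in the closure of [i |: X] but not of [X], so the factor of x also depends on which of the
    two comes first. For [p = None] the right side is t_i^c times the deletion plus u t_i times the
    contraction. *)
Lemma insert_mixed a c p X : okp p X -> i \notin X -> X \subset U :\ i ->
  detached a c X -> ~~ cl X i -> cl (U :\ i) i ->
  flag_sum a p X U = t i ^ c *
    (flag_sum a p X (U :\ i) + u * t i * flag_sum a p (i |: X) U
     - kappa p * (1 + u * t i) * flag_sum a p (i |: X) U).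
Proof.
move: X p; apply: (flag_sum_ind (U := U)) => X IH p hp iX sX fr cX cU.
rewrite flag_sum_split //.
have nUX : ~~ (U :\ i \subset X).
  apply: contra cX => sUX.
  by have -> : X = U :\ i by apply/eqP; rewrite eqEsubset sX sUX.
rewrite flag_sumE_con // flag_sumE_del // flag_sumE_con //.
rewrite !mulr_sumr -!big_split /= -sumrB mulr_sumr.
apply: eq_bigr => x hx; have [xi xX xUX ix sxX] := in_setDD1 iX sX hx.
rewrite (step_detached sX fr) (negbTE cX).
have frx := detached_sub (x := x) fr.
(* If [i] stays outside the closure after x, induction applies; otherwise [i] behaves as a loop from
   there on and [insert_pure] takes over. *)
have [cx|ncx] := boolP (cl (x |: X) i); last first.
  rewrite (IH x xUX _ (okp_U1 _ _)) //.
  rewrite (step_con sxX fr) cl_same ?(negbTE cX) ?(negbTE ncx) // -/(step a X x).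
  transitivity (link p i * link (Some i) x * ((1 + u * t i) * t i ^ c) * step a X x
      * flag_sum a (Some x) (i |: (x |: X)) U
    + link p x * step a X x * (t i ^ c *
        (flag_sum a (Some x) (x |: X) (U :\ i)
         + u * t i * flag_sum a (Some x) (i |: (x |: X)) U
         - kappa (Some x) * (1 + u * t i) * flag_sum a (Some x) (i |: (x |: X)) U))).
    by rewrite /unit_step; ring.
  by rewrite (link_insert hp iX xX xi); ring.
have pure Y : x |: X \subset Y -> Y \subset U :\ i -> cl Y i = true.
  by move=> hY _; apply: cl_sub hY cx.
rewrite (insert_pure (okp_U1 _ _) ix sxX frx pure) // !(flag_sum_loop _ _ _ frx) //.
have [c1 c2] : cl (i |: X) x /\ ~~ cl X x.
  have := cl_exch xX iX xi; rewrite cx (negbTE cX).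
  by case: (cl X x); case: (cl _ x).
rewrite (step_con sxX fr) c1 /step (negbTE c2).
set A := flag_sum _ _ _ _; set T := t x ^ _; set C := t i ^ c.
transitivity (link p i * link (Some i) x * ((1 + u * t i) * C) * (1 - t x) * T * A
  + link p x * (1 + u * t x) * T * ((1 - t i) * C * (1 - kappa (Some x)) * A)).
  by rewrite /unit_step; ring.
rewrite (link_insert hp iX xX xi).
(* The two sides differ by a multiple of kx (t_i - t_x) - t_i, which vanishes. *)
have : kappa (Some x) * (t i - t x) = t i.
  by rewrite /kappa mulfVK // t_subr_neq0 // eq_sym.
move: (kappa (Some x)) => kx Ekx.
apply/eqP; rewrite -subr_eq0; apply/eqP.
transitivity (link p x * C * T * A * (1 + u) * (kx * (t i - t x) - t i)); first by ring.
by rewrite Ekx subrr mulr0.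
Qed.

Lemma raise_con a c X Y : detached a c X -> X \subset Y -> Y \subset U :\ i ->
  raise a U (i |: Y) = raise a (U :\ i) Y + c.
Proof.
move=> fr XY YU; rewrite /raise fr // addrAC; congr (_ + _ + _).
have iY : i \notin Y by apply/negP => /(subsetP YU); rewrite !inE eqxx.
have -> // : (i |: Y == U) = (Y == U :\ i).
apply/eqP/eqP => [<-|->]; last exact: setD1K.
by rewrite setU1K.
Qed.

Lemma raise_out a Y : Y \subset U :\ i -> raise a U Y = a Y.
Proof.
move=> YU; rewrite /raise (_ : (Y == U) = false) ?addr0 //.
by apply/eqP => E; move: (subsetP YU i); rewrite E iU !inE eqxx => /(_ isT).
Qed.

Lemma step_raise_con a c X x : x |: X \subset U :\ i -> detached a c X ->
  step (raise a U) (i |: X) x = (if cl (i |: X) x then 1 - t x else 1 + u * t x) *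
    t x ^ (raise a (U :\ i) (x |: X) - raise a (U :\ i) X).
Proof.
move=> sxX h; have sX : X \subset U :\ i by apply: subset_trans sxX; apply: subsetUr.
rewrite /step setUCA !(raise_con h) ?subsetUr //; congr (_ * t x ^ _); lra.
Qed.

Lemma step_raise_ins a c X : ~~ (U :\ i \subset X) -> X \subset U :\ i -> detached a c X ->
  step (raise a U) X i = unit_step (cl X i) * t i ^ c.
Proof.
move=> nUX sX h; rewrite /step (raise_con h) // raise_out // /raise.
rewrite (_ : (X == U :\ i) = false); last by apply: contraNF nUX => /eqP ->.
by rewrite addr0 addrAC subrr add0r.
Qed.

(** Here x is the last element apart from [i]. The 1 added at [U] is charged to [i] when [i] comes
    last, and to x when [i] comes earlier. As the link from x to [i] times t_i equals - kappa x
    times t_x, passing from one to the other replaces the end value 1 - kappa x by - kappa x. *)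
Lemma insert_raise_last a c b X x : i \notin X -> x \notin X -> x != i ->
  X \subset U :\ i -> x |: X = U :\ i -> detached a c X -> cl (U :\ i) i = b ->
  step (raise a U) X x * flag_sum (raise a U) (Some x) (x |: X) U =
  step (raise a (U :\ i)) X x * (- kappa (Some x) * unit_step b * t i ^ c
    * flag_sum (raise a U) (Some x) (i |: (x |: X)) U).
Proof.
move=> iX xX xi sX ex fr cb.
have ix : i \notin x |: X by rewrite ex !inE eqxx.
rewrite (flag_sum_end _ _ (X := i |: (x |: X))); last by rewrite ex setD1K.
rewrite flag_sum_split // ex -setD1D setDv big_set0 addr0.
have -> : flag_sum (raise a U) (Some i) (i |: (U :\ i)) U = 1.
  by rewrite flag_sum_end // setD1K.
rewrite !mulr1 {2}/step.
rewrite cb -/(unit_step b) (raise_con (detached_sub (x := x) fr)) ?ex // raise_out //.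
have -> : raise a (U :\ i) (U :\ i) + c - a (U :\ i) = c + 1 by rewrite /raise eqxx /=; lra.
have -> : step (raise a (U :\ i)) X x = step (raise a U) X x * t x.
  rewrite /step ex !raise_out // -mulrA; congr (_ * _).
  rewrite -[in X in _ * X](expr1z (t x)) -expfzDr //; congr (_ ^ _).
  rewrite /raise eqxx (_ : (X == U :\ i) = false) /=; first by lra.
  by apply: contraNF xX => /eqP ->; rewrite -ex setU11.
have h1 := t_subr_neq0 xi; have h2 : t i - t x != 0 by rewrite -opprB oppr_eq0.
by rewrite expfzDr // expr1z /link /kappa; field; rewrite h1 h2.
Qed.

(** The telescoping sum ends in 0, so only the term of [p] survives; for [p = None] the whole sum
    vanishes. *)
Lemma insert_raise_pure a c b p X : okp p X -> i \notin X -> X \subset U :\ i ->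
  ~~ (U :\ i \subset X) ->
  detached a c X -> (forall Y, X \subset Y -> Y \subset U :\ i -> cl Y i = b) ->
  flag_sum (raise a U) p X U = - kappa p * unit_step b * t i ^ c *
     flag_sum (raise a U) p (i |: X) U.
Proof.
move: X p; apply: (flag_sum_ind (U := U)) => X IH p hp iX sX nUX fr cb.
rewrite flag_sum_split // !flag_sumE_con //.
rewrite !mulr_sumr -big_split /=.
apply: eq_bigr => x hx; have [xi xX xUX ix sxX] := in_setDD1 iX sX hx.
rewrite (step_raise_ins nUX sX fr) cb // (step_raise_con sxX fr).
rewrite cl_same ?cb ?subsetUr // -/(step (raise a (U :\ i)) X x).
rewrite -[link p x * _ * _]mulrA.
have -> : step (raise a U) X x * flag_sum (raise a U) (Some x) (x |: X) U =
  step (raise a (U :\ i)) X x * (- kappa (Some x) * unit_step b * t i ^ c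
    * flag_sum (raise a U) (Some x) (i |: (x |: X)) U).
  have [ex|nex] := eqVneq (x |: X) (U :\ i).
    by rewrite (insert_raise_last _ _ _ _ ex fr (b := b)) ?cb.
  have nx : ~~ (U :\ i \subset x |: X).
    by apply: contra nex => h; rewrite eqEsubset sxX.
  rewrite (IH x xUX _ (okp_U1 _ _)) //; last 2 first.
  - exact: detached_sub.
  - by move=> Y hY; apply: cb; apply: subset_trans hY; apply: subsetUr.
  congr (_ * _); rewrite /step !raise_out // /raise (negbTE nex).
  by rewrite (_ : (X == U :\ i) = false) ?addr0 //; apply: contraNF nUX => /eqP ->.
transitivity (link p i * link (Some i) x * (unit_step b * t i ^ c) *
     step (raise a (U :\ i)) X x * flag_sum (raise a U) (Some x) (i |: (x |: X)) U
  - link p x * kappa (Some x) * (unit_step b * t i ^ c) *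
     step (raise a (U :\ i)) X x * flag_sum (raise a U) (Some x) (i |: (x |: X)) U).
  by ring.
by rewrite (link_insert hp iX xX xi); ring.
Qed.

Lemma flag_sum_raise_loop a c p X : i \notin X -> X \subset U :\ i -> detached a c X ->
  cl X i -> flag_sum (raise a U) p (i |: X) U = flag_sum (raise a (U :\ i)) p X (U :\ i).
Proof.
move: X p; apply: (flag_sum_ind (U := U)) => X IH p iX sX fr cX.
have [sUX|nUX] := boolP (U :\ i \subset X).
  by rewrite !flag_sum_end // -subDset.
rewrite flag_sumE_con // flag_sumE_del //.
apply: eq_bigr => x hx; have [xi xX xUX ix sxX] := in_setDD1 iX sX hx.
have cx : cl (x |: X) i by apply: cl_sub cX; apply: subsetUr.
rewrite IH //; last exact: detached_sub.
by rewrite (step_raise_con sxX fr) cl_same ?cx ?cX.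
Qed.

(** The change of factor is handled as in [insert_mixed], followed by the raised form of the pure
    case. For [p = None] and t = 1 the result is again the deletion plus u times the contraction,
    both with raised heights. *)
Lemma insert_raise_mixed a c p X : okp p X -> i \notin X -> X \subset U :\ i ->
  detached a c X -> ~~ cl X i -> cl (U :\ i) i ->
  flag_sum (raise a U) p X U = t i ^ (c + 1) *
    (flag_sum (raise a (U :\ i)) p X (U :\ i) + u * flag_sum (raise a U) p (i |: X) U)
     - kappa p * (1 + u * t i) * t i ^ c * flag_sum (raise a U) p (i |: X) U.
Proof.
move: X p; apply: (flag_sum_ind (U := U)) => X IH p hp iX sX fr cX cU.
rewrite flag_sum_split //.
have nUX : ~~ (U :\ i \subset X).
  apply: contra cX => sUX.
  by have -> : X = U :\ i by apply/eqP; rewrite eqEsubset sX sUX.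
rewrite flag_sumE_con // flag_sumE_del // flag_sumE_con //.
rewrite !mulr_sumr -!big_split /= mulr_sumr -sumrB.
apply: eq_bigr => x hx; have [xi xX xUX ix sxX] := in_setDD1 iX sX hx.
rewrite (step_raise_ins nUX sX fr) (negbTE cX).
have frx := detached_sub (x := x) fr.
have ti : t i ^ (c + 1) = t i ^ c * t i by rewrite expfzDr // expr1z.
rewrite -[link p x * step (raise a U) X x * _]mulrA ti.
have [cx|ncx] := boolP (cl (x |: X) i); last first.
  have -> : step (raise a U) X x = step (raise a (U :\ i)) X x.
    rewrite /step !raise_out // /raise.
    rewrite (_ : (X == U :\ i) = false); last by apply: contraNF nUX => /eqP ->.
    rewrite (_ : (x |: X == U :\ i) = false) ?addr0 //.
    by apply: contraNF ncx => /eqP ->.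
  rewrite (IH x xUX _ (okp_U1 _ _)) // ti.
  rewrite (step_raise_con sxX fr) cl_same ?(negbTE cX) ?(negbTE ncx) //.
  rewrite -/(step (raise a (U :\ i)) X x).
  set s := step _ _ _; set A := flag_sum _ _ _ (U :\ i); set B := flag_sum _ _ (i |: _) _.
  transitivity (link p i * link (Some i) x * ((1 + u * t i) * t i ^ c) * s * B
    + link p x * s * (t i ^ c * t i * (A + u * B)
         - kappa (Some x) * (1 + u * t i) * t i ^ c * B)).
    by rewrite /unit_step; ring.
  by rewrite (link_insert hp iX xX xi); ring.
have pure Y : x |: X \subset Y -> Y \subset U :\ i -> cl Y i = true.
  by move=> hY _; apply: cl_sub hY cx.
have -> : step (raise a U) X x * flag_sum (raise a U) (Some x) (x |: X) U =
  step (raise a (U :\ i)) X x * (- kappa (Some x) * unit_step true * t i ^ c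
    * flag_sum (raise a U) (Some x) (i |: (x |: X)) U).
  have [ex|nex] := eqVneq (x |: X) (U :\ i).
    by rewrite (insert_raise_last _ _ _ _ ex fr (b := true)).
  have nx : ~~ (U :\ i \subset x |: X).
    by apply: contra nex => h; rewrite eqEsubset sxX.
  rewrite (insert_raise_pure (okp_U1 _ _) ix sxX nx frx pure).
  congr (_ * _); rewrite /step !raise_out // /raise (negbTE nex).
  by rewrite (_ : (X == U :\ i) = false) ?addr0 //; apply: contraNF nUX => /eqP ->.
rewrite !(flag_sum_raise_loop _ _ _ frx) //.
have [c1 c2] : cl (i |: X) x /\ ~~ cl X x.
  have := cl_exch xX iX xi; rewrite cx (negbTE cX).
  by case: (cl X x); case: (cl _ x).
rewrite (step_raise_con sxX fr) c1 /step (negbTE c2).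
set A := flag_sum _ _ _ _; set T := t x ^ _; set C := t i ^ c.
transitivity (link p i * link (Some i) x * ((1 + u * t i) * C) * (1 - t x) * T * A
  - link p x * (1 + u * t x) * T * ((1 - t i) * C * kappa (Some x) * A)).
  by rewrite /unit_step; ring.
rewrite (link_insert hp iX xX xi).
have : kappa (Some x) * (t i - t x) = t i.
  by rewrite /kappa mulfVK // t_subr_neq0 // eq_sym.
move: (kappa (Some x)) => kx Ekx.
apply/eqP; rewrite -subr_eq0; apply/eqP.
transitivity (link p x * C * T * A * (1 + u) * (kx * (t i - t x) - t i)); first by ring.
by rewrite Ekx subrr mulr0.
Qed.

End Insertion.
End FlagSums.

(** * Trimming a submodular function *)

(** The d's are the shortfalls of the increment at i, relative to its maximum, over Z, Z + p, Z + q
    and Z + p + q; trimming costs 1 where the shortfall is 0. The second inequality suffices except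
    when d1 = d2 = 0 < d3: then the right side loses 2 and the left side only 1, and the inequality
    for the sets without i gives what is missing, as d3 >= 1. *)
Lemma trim_ineq (z p q pq d0 d1 d2 d3 : int) : 0 <= d0 -> d0 <= d1 -> d0 <= d2 -> d1 <= d3 -> d2 <= d3 ->
  z + pq <= p + q -> (z - d0) + (pq - d3) <= (p - d1) + (q - d2) ->
  (z - d0 - (d0 == 0)%:R) + (pq - d3 - (d3 == 0)%:R)
   <= (p - d1 - (d1 == 0)%:R) + (q - d2 - (d2 == 0)%:R).
Proof.
have [->|n0] := eqVneq d0 0; have [->|n1] := eqVneq d1 0;
have [->|n2] := eqVneq d2 0; have [->|n3] := eqVneq d3 0; rewrite /=; lia.
Qed.
Lemma trim_ineq1 (z q d d' : int) : 0 <= d -> d <= d' -> 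
  z + (q  - d' - (d' == 0)%:R) <= (z - d - (d == 0)%:R) + q.
Proof.
have [->|n0] := eqVneq d 0; have [->|n1] := eqVneq d' 0; rewrite /=; lia.
Qed.

Lemma incr_arith (x y z w : int) : (y + w <= x + z) = (w - z <= x - y).
Proof. by apply/idP/idP; lia. Qed.

Lemma gap_arith (x y c d d' : int) : (y + c - d' - y <= x + c - d - x) = (d <= d').
Proof. by apply/idP/idP; lia. Qed.

Section Submodular.
Variable n : nat.
Implicit Types (X Y Z D U S : {set 'I_n}) (a : {set 'I_n} -> int).

Definition submod a D U := forall X p q, D \subset X -> p |: (q |: X) \subset U ->
  p \notin X -> q \notin X -> p != q ->
  a X + a (p |: (q |: X)) <= a (p |: X) + a (q |: X).

Lemma submod_sub a D U D' U' : D \subset D' -> U' \subset U -> submod a D U -> submod a D' U'.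
Proof.
move=> hD hU h X p q hX hpq; apply: h; first exact: subset_trans hX.
exact: subset_trans hU.
Qed.

Lemma submod_incr a D U i Y Z : submod a D U -> D \subset Y -> Y \subset Z ->
  Z \subset U :\ i -> i \in U -> a (i |: Z) - a Z <= a (i |: Y) - a Y.
Proof.
move=> h + + ZU iU; move: Y; apply: (flag_sum_ind (U := Z)) => Y IH DY YZ.
have [sZY|/subsetPn [x xZ xY]] := boolP (Z \subset Y).
  by have -> : Y = Z by apply/eqP; rewrite eqEsubset YZ sZY.
have xZY : x \in Z :\: Y by rewrite inE xY.
have sx : x |: Y \subset Z by rewrite subUset sub1set xZ.
have /andP[xi xU] : (x != i) && (x \in U) by move: (subsetP ZU _ xZ); rewrite !inE.
have iY : i \notin Y.
  by apply/negP => /(subsetP YZ) /(subsetP ZU); rewrite !inE eqxx.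
have hs : i |: (x |: Y) \subset U.
  rewrite subUset sub1set iU (subset_trans sx) //.
  by apply: subset_trans ZU _; apply: subsetDl.
have := h Y i x DY hs iY xY; rewrite eq_sym => /(_ xi); rewrite incr_arith.
by apply: le_trans; apply: IH x xZY (subset_trans DY (subsetUr _ _)) sx.
Qed.

Variables (a : {set 'I_n} -> int) (D U : {set 'I_n}) (i : 'I_n).
Hypotheses (sa : submod a D U) (DU : D \subset U) (iU : i \in U) (iD : i \notin D).

Let c := a (i |: D) - a D.

(* On tight sets a has the same increment at i as at D; as this increment can only
   decrease by submodularity, lowering a by 1 there keeps a submodular. *)
Definition tight : {set {set 'I_n}} :=
  [set S : {set 'I_n} | [&& D \subset S, S \subset U, i \in S & a S - a (S :\ i) == c]].

Definition trim : {set 'I_n} -> int := fun S : {set 'I_n} => a S - (S \in tight)%:R.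

Lemma trim_notin (S : {set 'I_n}) : i \notin S -> trim S = a S.
Proof. by move=> h; rewrite /trim inE (negbTE h) /= !andbF subr0. Qed.

Lemma tightE (Y : {set 'I_n}) : D \subset Y -> Y \subset U :\ i -> (i |: Y \in tight) = (a (i |: Y) - a Y == c).
Proof.
move=> DY YU; have iY : i \notin Y by apply/negP => /(subsetP YU); rewrite !inE eqxx.
rewrite inE setU11 (setU1K iY) subUset sub1set iU (subset_trans DY (subsetUr _ _)) /=.
by rewrite (subset_trans YU) // subsetDl.
Qed.

(** Trimming replaces the increment at [i] over a set by its minimum with c - 1. Increments still
    decrease, which settles the squares in the direction of [i]; squares of sets avoiding [i] do not
    change, and squares of sets containing [i] are [trim_ineq]. *)
Lemma submod_trim : submod trim D U.
Proof.
have key (Y : {set 'I_n}) : D \subset Y -> Y \subset U :\ i ->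
    exists2 d : int, 0 <= d & a (i |: Y) = a Y + c - d /\ trim (i |: Y) = a Y + c - d - (d == 0)%:R.
  move=> DY YU; have h := submod_incr sa (subxx D) DY YU iU.
  exists (c - (a (i |: Y) - a Y)); first by rewrite subr_ge0.
  have E : a (i |: Y) = a Y + c - (c - (a (i |: Y) - a Y)) by ring.
  by rewrite -E; split=> //; rewrite /trim tightE // subr_eq0 eq_sym.
move=> X p q DX pqU pX qX pq; have h := sa DX pqU pX qX pq.
have [pU [qU XU]] : p \in U /\ (q \in U /\ X \subset U).
  by move: pqU; rewrite !subUset !sub1set => /and3P[].
have sub1 (Y : {set 'I_n}) : i \notin Y -> Y \subset U -> Y \subset U :\ i.
  by move=> iY YU; rewrite subsetD1 YU.
have [iX|iX] := boolP (i \in X); last first.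
  have side r s : r |: (s |: X) \subset U -> s \notin X -> i != s -> r = i -> a X + a (r |: (s |: X)) <= a (r |: X) + a (s |: X) ->
    trim X + trim (r |: (s |: X)) <= trim (r |: X) + trim (s |: X).
    move=> rsU sX si ->; rewrite !(trim_notin (S := X)) // (trim_notin (S := s |: X)); last first.
      by rewrite !inE negb_or si.
    have sU : s \in U by move: rsU; rewrite !subUset !sub1set => /and3P[].
    have [] := key X; rewrite ?sub1 // => d d0 [E1 ->].
    have [] := key (s |: X); rewrite ?sub1 ?subUset ?sub1set ?sU ?(subset_trans DX (subsetUr _ _)) //.
      by rewrite !inE negb_or si.
    move=> d' d'0 [E2 ->].
    have hs : s |: X \subset U :\ i.
      by rewrite sub1 ?subUset ?sub1set ?sU //; rewrite !inE negb_or si.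
    have := submod_incr sa DX (subsetUr [set s] X) hs iU.
    rewrite E1 E2 gap_arith => dd.
    have -> : a X + (a (s |: X) + c - d' - (d' == 0)%:R) = a X + (a (s |: X) - d' - (d' == 0)%:R) + c by ring.
    have -> : a X + c - d - (d == 0)%:R + a (s |: X) = (a X - d - (d == 0)%:R) + a (s |: X) + c by ring.
    by rewrite lerD2r => _; apply: trim_ineq1.
  have [ip|ip] := eqVneq i p.
    by apply: side => //; rewrite ip.
  have [iq|iq] := eqVneq i q.
    rewrite setUCA [trim (p |: X) + _]addrC; apply: side => //; first by rewrite setUCA.
    by rewrite setUCA [a (q |: X) + _]addrC.
  by rewrite !trim_notin // !inE !negb_or ?ip ?iq.
have ip : i != p by apply: contraNneq pX => <-.
have iq : i != q by apply: contraNneq qX => <-.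
have EX : X = i |: (X :\ i) by rewrite setD1K.
set Z := X :\ i in EX.
have E1 : p |: X = i |: (p |: Z) by rewrite {1}EX setUCA.
have E2 : q |: X = i |: (q |: Z) by rewrite {1}EX setUCA.
have E3 : p |: (q |: X) = i |: (p |: (q |: Z)) by rewrite E2; apply: setUCA.
have DZ : D \subset Z by rewrite /Z subsetD1 DX.
have ZU : Z \subset U :\ i by rewrite setSD.
have inU r : i != r -> r \in U -> r \in U :\ i by move=> ir rU; rewrite !inE eq_sym ir.
have DrZ r : D \subset r |: Z by apply: subset_trans DZ _; apply: subsetUr.
have DpqZ : D \subset p |: (q |: Z) by apply: subset_trans (DrZ q) _; apply: subsetUr.
have pZU : p |: Z \subset U :\ i by rewrite subUset sub1set inU.
have qZU : q |: Z \subset U :\ i by rewrite subUset sub1set inU.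
have pqZU : p |: (q |: Z) \subset U :\ i by rewrite subUset sub1set inU.
have pqZ : a Z + a (p |: (q |: Z)) <= a (p |: Z) + a (q |: Z).
  apply: sa => //; first by rewrite (subset_trans pqZU) // subsetDl.
    by rewrite !inE (negbTE pX) andbF.
  by rewrite !inE (negbTE qX) andbF.
have m1 := submod_incr sa DZ (subsetUr [set p] Z) pZU iU.
have m2 := submod_incr sa DZ (subsetUr [set q] Z) qZU iU.
have m3 := submod_incr sa (DrZ q) (subsetUr [set p] (q |: Z)) pqZU iU.
have m4 : a (i |: (p |: (q |: Z))) - a (p |: (q |: Z)) <= a (i |: (p |: Z)) - a (p |: Z).
  by rewrite [p |: (q |: Z)]setUCA; apply: (submod_incr sa) => //; rewrite ?subsetUr // -setUCA.
rewrite E3 E1 E2 EX in h *.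
have [d0 g0 [A0 ->]] := key Z DZ ZU.
have [d1 g1 [A1 ->]] := key _ (DrZ p) pZU.
have [d2 g2 [A2 ->]] := key _ (DrZ q) qZU.
have [d3 g3 [A3 ->]] := key _ DpqZ pqZU.
move: h m1 m2 m3 m4; rewrite A0 A1 A2 A3 !gap_arith => h m1 m2 m3 m4.
have E (x d : int) : x + c - d - (d == 0)%:R = (x - d - (d == 0)%:R) + c by ring.
rewrite !{}E [leLHS]addrACA [leRHS]addrACA lerD2r.
have E (x y d d' : int) : x + c - d + (y + c - d') = (x - d + (y - d')) + (c + c) by ring.
rewrite !{}E lerD2r in h.
exact: trim_ineq.
Qed.

End Submodular.

Definition nonneg_poly (q : {poly int}) := forall i, 0 <= q`_i.

Lemma nonneg_polyD p q : nonneg_poly p -> nonneg_poly q -> nonneg_poly (p + q).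
Proof. by move=> hp hq i; rewrite coefD addr_ge0. Qed.

Lemma nonneg_polyM p q : nonneg_poly p -> nonneg_poly q -> nonneg_poly (p * q).
Proof. by move=> hp hq i; rewrite coefM sumr_ge0 // => j _; rewrite mulr_ge0. Qed.

Lemma nonneg_polyC c : 0 <= c -> nonneg_poly c%:P.
Proof. by move=> hc i; rewrite coefC; case: ifP. Qed.

Lemma nonneg_polyX : nonneg_poly 'X.
Proof. by move=> i; rewrite coefX; case: (i == 1%N). Qed.

Lemma ltn_card_setDl (T : finType) (D S U : {set T}) :
  D \subset S -> S \proper U -> (#|S :\: D| < #|U :\: D|)%N.
Proof.
move=> DS /properP[SU [x xU xS]]; apply/proper_card/properP; split; first exact: setSD.
by exists x; rewrite !inE ?xU ?(negbTE xS) ?andbF // andbT; apply: contra xS; apply: (subsetP DS).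
Qed.

Lemma ltn_card_setDr (T : finType) (D S U : {set T}) :
  D \proper S -> S \subset U -> (#|U :\: S| < #|U :\: D|)%N.
Proof.
move=> /properP[DS [x xS xD]] SU; apply/proper_card/properP; split; first exact: setDS.
by exists x; rewrite !inE ?xS ?xD // (subsetP SU).
Qed.

(** * Positivity *)

Section Positivity.
Variables (K : fieldType) (n : nat) (t : 'I_n -> K) (u : K).
Hypothesis t_neq0 : forall i, t i != 0.
Hypothesis t_inj : injective t.
Variable cl : {set 'I_n} -> 'I_n -> bool.
Hypothesis cl_sub : forall (X Y : {set 'I_n}) i, X \subset Y -> cl X i -> cl Y i.
Hypothesis cl_exch : forall (X : {set 'I_n}) i j, i \notin X -> j \notin X -> i != j ->
  (~~ cl X i + ~~ cl (i |: X) j = ~~ cl X j + ~~ cl (j |: X) i)%N.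
Variable ev : K -> {poly int} -> Prop.
Hypothesis ev1 : ev 1 1.
Hypothesis evD : forall x y p q, ev x p -> ev y q -> ev (x + y) (p + q).
Hypothesis evN : forall x p, ev x p -> ev (- x) (- p).
Hypothesis evM : forall x y p q, ev x p -> ev y q -> ev (x * y) (p * q).
Hypothesis evt : forall i (c : int), ev (t i ^ c) 1.
Hypothesis evu : ev u 'X.

Implicit Types (X Y D U S : {set 'I_n}) (a : {set 'I_n} -> int).

Local Notation sum := (flag_sum t u cl).
Local Notation inj := t_inj.

(* [ev x y] reads: x is a Laurent polynomial whose value at t = 1 is y. *)
Definition good x := exists2 q, ev x ((1 + 'X) * q) & nonneg_poly q.

Lemma goodD x y : good x -> good y -> good (x + y).
Proof.
move=> [p hp p0] [q hq q0]; exists (p + q); last exact: nonneg_polyD.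
by rewrite mulrDr; apply: evD.
Qed.

Lemma goodMl x p y : ev x p -> nonneg_poly p -> good y -> good (x * y).
Proof.
move=> hp p0 [q hq q0]; exists (p * q); last exact: nonneg_polyM.
by rewrite mulrCA; apply: evM.
Qed.

Lemma goodM x y : good x -> good y -> good (x * y).
Proof.
move=> [p hp p0]; apply: goodMl hp _; apply: nonneg_polyM p0.
by apply: nonneg_polyD nonneg_polyX; apply: (@nonneg_polyC 1).
Qed.

Lemma ev0 : ev 0 0.
Proof. by rewrite -(subrr (1 : K)) -(subrr (1 : {poly int})); apply: evD (evN ev1). Qed.

Lemma good0 : good 0.
Proof. by exists 0; rewrite ?mulr0 //; [exact: ev0 | move=> i; rewrite coef0]. Qed.

Lemma evt1 i : ev (t i) 1. Proof. by have := evt i 1; rewrite expr1z. Qed.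

Lemma good_unit_step b i (c : int) : good (unit_step t u i b * t i ^ c).
Proof.
case: b; rewrite /unit_step.
  exists 0; last by move=> j; rewrite coef0.
  rewrite mulr0 -[X in ev _ X](mul0r 1); apply: evM; last exact: evt.
  by rewrite -(subrr 1); apply: evD ev1 (evN (evt1 i)).
exists 1; last exact: (@nonneg_polyC 1).
rewrite -[X in ev _ X]mulr1; apply: evM; last exact: evt.
by rewrite mulr1; apply: evD ev1 _; rewrite -['X]mulr1; apply: evM evu (evt1 i).
Qed.

Lemma good_t i (c : int) x : good x -> good (t i ^ c * x).
Proof. by apply: goodMl (evt i c) _; apply: (@nonneg_polyC 1). Qed.

Lemma good_u x : good x -> good (u * x).
Proof. exact: goodMl evu nonneg_polyX. Qed.

Definition raise_if (e : bool) a U := if e then raise a U else a.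

(** Restores the heights on T one set at a time, a set S of maximal size first. The change is a
    product by [flag_sum_face]: below S all tight sets other than S are still lowered, which is
    [raise b S] there because T is closed downwards among tight sets; above S no set of T is
    left. *)
Lemma good_tight a e D U i (T : {set {set 'I_n}}) :
  let a1 := raise_if e a U in
  let b := trim a D U i in
  (forall S, D \proper S -> S \proper U -> good (sum (raise b S) None D S)) ->
  (forall S, D \proper S -> S \proper U -> good (sum a1 None S U)) ->
  D \subset U -> i \notin D -> U \notin tight a D U i ->
  T \subset tight a D U i ->
  (forall S S', S \in T -> S' \proper S -> S' \in tight a D U i -> S' \in T) ->
  good (sum (fun Y => a1 Y - (Y \in T)%:R) None D U) -> good (sum a1 None D U).
Proof.
move=> a1 b hb ha sDU iD ntU; have [m] := ubnP #|T|; elim: m T => // m IH T hm sT dT gT.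
have [T0|] := eqVneq T set0.
  rewrite (eq_flag_sum _ _ _ (b := fun Y => a1 Y - (Y \in T)%:R)) //.
  by move=> Y _ _; rewrite T0 inE subr0.
case/set0Pn => S0 S0T.
case: (arg_maxnP (fun S : {set 'I_n} => #|S|) S0T) => S ST0 maxS; have ST : S \in T := ST0.
have /(subsetP sT) := ST; rewrite inE => /and4P[DS SU iS /eqP tS].
have pDS : D \proper S.
  by rewrite properE DS; apply/subsetPn; exists i.
have pSU : S \proper U.
  rewrite properEneq SU andbT; by apply: contraNneq ntU => ES; have := subsetP sT _ ST; rewrite ES.
have dT' : forall S1 S2, S1 \in T :\ S -> S2 \proper S1 -> S2 \in tight a D U i -> S2 \in T :\ S.
  move=> S1 S2; rewrite !in_setD1 => /andP[n1 S1T] S21 tS2.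
  rewrite (dT S1) // andbT; apply/eqP => E2; subst S2.
  by have := maxS _ S1T; rewrite /= leqNgt (proper_card S21).
apply: (IH (T :\ S)) => //.
- by move: hm; rewrite (cardsD1 S T) ST.
- by apply: subset_trans sT; apply: subsetDl.
set a2 := (fun Y => a1 Y - (Y \in T :\ S)%:R).
have E : sum a2 None D U = sum (fun Y => a2 Y - (Y == S)%:R) None D U
    + sum a2 None D S * sum a2 None S U.
  by rewrite -(flag_sum_face u t_neq0 t_inj cl _ _ pDS pSU) addrC subrK.
rewrite E; apply: goodD.
  have <- : sum (fun Y => a1 Y - (Y \in T)%:R) None D U = sum (fun Y => a2 Y - (Y == S)%:R) None D U.
    apply: eq_flag_sum => // Y _ _; rewrite /a2 in_setD1.
    by have [->|nY] := eqVneq Y S; rewrite ?ST /= ?subr0.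
  exact: gT.
apply: goodM.
  have -> : sum a2 None D S = sum (raise b S) None D S; last exact: hb.
  apply: eq_flag_sum => // Y DY YS; rewrite /a2 /a1 /b /raise /trim.
  have YU : Y != U.
    by apply: contraTneq YS => ->; case/properP: pSU => _ [x ? ?]; apply/subsetPn; exists x.
  have -> : raise_if e a U Y = a Y by case: (e) => //=; rewrite /raise (negbTE YU) addr0.
  rewrite in_setD1; have [->|nY] /= := eqVneq Y S.
    by rewrite (subsetP sT _ ST) subr0 subrK.
  rewrite addr0; congr (_ - _%:R); congr nat_of_bool; apply/idP/idP; first exact: (subsetP sT).
  by apply: dT ST _; rewrite properEneq nY.
have -> : sum a2 None S U = sum a1 None S U; last exact: ha.
apply: eq_flag_sum => // Y SY YU; rewrite /a2 in_setD1.
have [->|nY] /= := eqVneq Y S; first by rewrite subr0.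
rewrite (_ : (Y \in T) = false) ?subr0 //; apply/negP => YT.
have : (#|S| < #|Y|)%N by rewrite proper_card // properEneq eq_sym nY.
by move: (maxS _ YT); rewrite /= leqNgt => /negbTE ->.
Qed.

(** The inner induction is on the gap between the increments of [a] at i over D and over U minus i.
    Trimming lowers the first by 1 and keeps the second, so the gap shrinks until the increments are
    constant. *)
Theorem good_flag_sum e a D U : D \proper U -> submod a D U ->
  good (sum (raise_if e a U) None D U).
Proof.
have [m] := ubnP #|U :\: D|; elim: m e a D U => // m IHm e a D U; rewrite ltnS => hm pDU sa.
have [sDU [i iU iD]] := properP pDU.
have [w] := ubnP (absz ((a (i |: D) - a D) - (a U - a (U :\ i)))%R).
elim: w a sa => // w IHw a sa hw.
have DUi : D \subset U :\ i by rewrite subsetD1 sDU.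
have h0 := submod_incr sa (subxx D) DUi (subxx _) iU.
rewrite setD1K // in h0.
have [fr|nfr] := eqVneq (a U - a (U :\ i)) (a (i |: D) - a D); last first.
  apply: (@good_tight a e D U i (tight a D U i)) => //.
  - move=> S pDS pSU; apply: (IHm true (trim a D U i) D S) => //.
      by apply: leq_trans hm; apply: ltn_card_setDl => //; apply: proper_sub.
    by apply: submod_sub _ _ (submod_trim sa iU iD) => //; apply: proper_sub.
  - move=> S pDS pSU; apply: (IHm e a S U) => //.
      by apply: leq_trans hm; apply: ltn_card_setDr => //; apply: proper_sub.
    by apply: submod_sub _ _ sa => //; apply: proper_sub.
  - by rewrite inE subxx sDU iU (negbTE nfr).
  rewrite (eq_flag_sum _ _ _ (b := raise_if e (trim a D U i) U)) //; last first.
    by move=> Y _ _; rewrite /raise_if /trim; case: (e); rewrite // /raise addrAC.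
  apply: IHw; first exact: submod_trim.
  have -> : trim a D U i D = a D by rewrite trim_notin.
  have -> : trim a D U i (U :\ i) = a (U :\ i) by rewrite trim_notin // !inE eqxx.
  have -> : trim a D U i U = a U by rewrite /trim inE subxx sDU iU (negbTE nfr) subr0.
  have -> : trim a D U i (i |: D) = a (i |: D) - 1 by rewrite /trim tightE ?eqxx.
  by move/eqP: nfr hw h0; lia.
(* Increments decrease along the interval, so equality at its two ends makes them constant. *)
have {}fr : detached U i a (a (i |: D) - a D) D.
  move=> Y DY YU.
  have h1 := submod_incr sa (subxx D) DY YU iU.
  have := submod_incr sa DY YU (subxx _) iU; rewrite setD1K // fr => h2.
  by apply/eqP; rewrite addrC -subr_eq eq_le h1 h2.
set c := a (i |: D) - a D in fr; clear IHw h0 hw.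
(* The case of a constant closure status of i. If i is the only element of U outside D, the sum is
   the single factor of i; this is where the induction starts and where 1 + u enters. *)
have mono : forall b, (forall Y, D \subset Y -> Y \subset U :\ i -> cl Y i = b) ->
   good (sum (raise_if e a U) None D U).
  move=> b hb.
  have [UiD|UiD] := boolP (U :\ i \subset D).
    have ED : D = U :\ i by apply/eqP; rewrite eqEsubset DUi UiD.
    have : sum (raise_if e a U) None D U = unit_step t u i b * t i ^ (raise_if e a U U - raise_if e a U D).
      rewrite (flag_sum_split t u cl iU) // ED -setD1D setDv big_set0 addr0.
      rewrite setD1K // flag_sum_end // mulr1 /link mul1r /step setD1K // -ED hb //.
    by move->; apply: good_unit_step.
  case: e => /=.
    rewrite (insert_raise_pure u t_neq0 t_inj cl_exch iU (c := c) (b := b)) //.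
    by rewrite /kappa oppr0 !mul0r; apply: good0.
  rewrite (insert_pure u t_inj cl_exch iU (c := c) (b := b)) //.
  rewrite /kappa mul0r subr0; apply: goodM; first exact: good_unit_step.
  apply: (IHm false) => //; last 2 first.
  - by rewrite properE DUi.
  - by apply: submod_sub _ _ sa => //; apply: subsetDl.
  by apply: leq_trans hm; rewrite setD1D [in X in (_ < X)%N](cardsD1 i) inE iD iU.
have [clD|nclD] := boolP (cl D i).
  by apply: (mono true) => Y DY _; apply: cl_sub DY clD.
have [clU|nclU] := boolP (cl (U :\ i) i); last first.
  by apply: (mono false) => Y _ YU; apply: contraNF nclU; apply: cl_sub.
have UiD : ~~ (U :\ i \subset D).
  by apply: contra nclD => h; have -> // : D = U :\ i; apply/eqP; rewrite eqEsubset DUi h.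
have g1 : good (sum (raise_if e a (U :\ i)) None D (U :\ i)).
  apply: IHm; last 2 first.
  - by rewrite properE DUi.
  - by apply: submod_sub _ _ sa => //; apply: subsetDl.
  by apply: leq_trans hm; rewrite setD1D [in X in (_ < X)%N](cardsD1 i) inE iD iU.
have g2 : good (sum (raise_if e a U) None (i |: D) U).
  have siD : i |: D \subset U by rewrite subUset sub1set iU.
  apply: IHm; last 2 first.
  - rewrite properE siD; apply: contra UiD; rewrite subDset //.
  - by apply: submod_sub _ _ sa => //; apply: subsetUr.
  by apply: leq_trans hm; rewrite setDU1 [in X in (_ < X)%N](cardsD1 i) inE iD iU.
clear mono; case: e g1 g2 => /= g1 g2.
  rewrite (insert_raise_mixed u t_neq0 t_inj cl_sub cl_exch iU (c := c)) //.
  rewrite /kappa !mul0r subr0; apply: good_t; apply: goodD => //.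
  exact: good_u.
rewrite (insert_mixed u t_inj cl_sub cl_exch iU (c := c)) //.
rewrite /kappa !mul0r subr0; apply: good_t; apply: goodD => //.
by rewrite -mulrA; apply: good_u; rewrite -[t i]expr1z; apply: good_t.
Qed.

End Positivity.

(** * Charts and orderings *)

Section Orderings.
Variable n : nat.
Implicit Types (s : seq 'I_n) (F G : {set {set 'I_n}}) (S T X : {set 'I_n}).

Definition prefix_set s (k : nat) : {set 'I_n} := [set x in take k s].

Definition flag_of s : {set {set 'I_n}} := [set prefix_set s i | i : 'I_n & (0 < i)%N].

Definition ordering s := uniq s && (size s == n).

Lemma ordering_mem s : ordering s -> forall x, x \in s.
Proof.
case/andP=> us /eqP ss x.
have [_ ->] : uniq (enum 'I_n) /\ s =i enum 'I_n; last by rewrite mem_enum.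
split; first exact: enum_uniq.
have := uniq_min_size us (s2 := enum 'I_n); rewrite ss size_enum_ord leqnn.
by case=> // y _; rewrite mem_enum.
Qed.

Lemma ordering_perm s : ordering s -> perm_eq s (enum 'I_n).
Proof.
move=> h; apply: uniq_perm; rewrite ?enum_uniq //; first by case/andP: h.
by move=> x; rewrite ordering_mem // mem_enum.
Qed.

Lemma card_prefix s k : uniq s -> (k <= size s)%N -> #|prefix_set s k| = k.
Proof.
move=> us ks; rewrite /prefix_set cardsE.
have /card_uniqP -> : uniq (take k s) by apply: take_uniq.
by rewrite size_take_min; apply/minn_idPl.
Qed.

Lemma prefix_sub s k l : (k <= l)%N -> prefix_set s k \subset prefix_set s l.
Proof.
move=> kl; apply/subsetP => x; rewrite !inE => h.
by rewrite -(subnK kl) addnC takeD mem_cat h.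
Qed.

Lemma flag_ofP s S : reflect (exists2 k, (0 < k < n)%N & S = prefix_set s k) (S \in flag_of s).
Proof.
apply: (iffP imsetP) => [[i]|[k /andP[k0 kn] ->]].
  by rewrite inE => i0 ->; exists i; rewrite ?i0 ?ltn_ord.
by exists (Ordinal kn); rewrite ?inE.
Qed.

Lemma flag_of_flag s : ordering s -> is_flag (flag_of s).
Proof.
case/andP=> us /eqP ss; apply/andP; split.
  apply/forall_inP => S /flag_ofP [k /andP[k0 kn] ->].
  have ck : #|prefix_set s k| = k by apply: card_prefix => //; rewrite ss ltnW.
  apply/andP; split; first by rewrite -card_gt0 ck.
  by apply/eqP => E; move: kn; rewrite -ck E cardsT card_ord ltnn.
apply/forall_inP => S /flag_ofP [k _ ->]; apply/forall_inP => T /flag_ofP [l _ ->].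
by case/orP: (leq_total k l) => h; apply/orP; [left|right]; apply: prefix_sub.
Qed.

Lemma flag_subset F S T : is_flag F -> S \in F -> T \in F -> (S \subset T) || (T \subset S).
Proof. by case/andP=> _ /forall_inP h /h /forall_inP; apply. Qed.

Lemma flag_proper F S : is_flag F -> S \in F -> (S != set0) && (S != setT).
Proof. by case/andP=> /forall_inP h _ /h. Qed.

Lemma flag_card F S : is_flag F -> S \in F -> (0 < #|S| < n)%N.
Proof.
move=> hF hS; have /andP[S0 ST] := flag_proper hF hS.
rewrite card_gt0 S0 /= -[X in (_ < X)%N]card_ord -cardsT proper_card //.
by rewrite properT.
Qed.

(** A member of a larger flag is comparable with the prefix of its own size, hence equal to it. *)
Lemma flag_of_max s : ordering s -> maxset (@is_flag n) (flag_of s).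
Proof.
move=> hs; apply/maxsetP; split; first exact: flag_of_flag.
move=> G hG sG; apply/eqP; rewrite eqEsubset sG andbT; apply/subsetP => S SG.
have := flag_card hG SG => kk; case/andP: hs => us /eqP ss.
have hk : prefix_set s #|S| \in G by apply: (subsetP sG); apply/flag_ofP; exists #|S|.
have ck : #|prefix_set s (#|S|)| = #|S| by apply: card_prefix => //; rewrite ss; case/andP: kk => _ /ltnW.
apply/flag_ofP; exists #|S| => //; apply/eqP.
case/orP: (flag_subset hG SG hk) => h; first by rewrite eqEcard h ck /=.
by rewrite eq_sym eqEcard h ck /=.
Qed.

(** Sorts the elements by the preorder in which i precedes j when every member containing j contains
    i. It is total because F is a chain, and every member of F becomes a prefix. *)
Lemma flag_ordering F : is_flag F -> exists2 s, ordering s & F \subset flag_of s.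
Proof.
move=> hF; pose r i j := [forall S in F, (j \in S) ==> (i \in S)].
have rP i j : reflect (forall S, S \in F -> j \in S -> i \in S) (r i j).
  apply: (iffP forall_inP) => [h S /h /implyP|h S SF]; first exact.
  by apply/implyP; apply: h.
have r_total : total r.
  move=> i j; have [//|/forall_inPn[S SF]] := boolP (r i j).
  rewrite negb_imply => /andP[jS iS] /=; apply/rP => T TF iT.
  case/orP: (flag_subset hF SF TF) => /subsetP h; first exact: h.
  by move: iS; rewrite h.
have r_trans : transitive r.
  by move=> j i l /rP h1 /rP h2; apply/rP => S SF /(h2 _ SF) /(h1 _ SF).
pose s := sort r (enum 'I_n).
have os : ordering s by rewrite /ordering sort_uniq enum_uniq size_sort size_enum_ord eqxx.
have ss : sorted r s by apply: sort_sorted.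
exists s => //; apply/subsetP => S SF; have kk := flag_card hF SF.
apply/flag_ofP; exists #|S| => //; apply/eqP.
case/andP: (os) => us /eqP sz.
have ck : #|prefix_set s (#|S|)| = #|S| by apply: card_prefix => //; rewrite sz; case/andP: kk => _ /ltnW.
rewrite eqEcard ck leqnn andbT; apply/subsetP => x xS; apply/negPn/negP => nx.
have : ~~ (prefix_set s #|S| \subset S :\ x).
  apply/negP => /subset_leq_card; rewrite ck.
  by have := cardsD1 x S; rewrite xS => {1}->; rewrite ltnn.
case/subsetPn => y yp; rewrite !inE negb_and negbK => /orP[/eqP E|yS].
  by rewrite -E yp in nx.
have ry : r y x.
  apply: (sorted_ltn_index r_trans ss); rewrite ?ordering_mem //.
  move: yp nx; rewrite !inE !in_take ?ordering_mem // -leqNgt; exact: leq_trans.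
by move: yS; rewrite (rP _ _ ry S SF xS).
Qed.

Lemma chart_ordering (F : chart n) : exists s, ordering s && (val F == flag_of s).
Proof.
have /maxsetP[hF mF] := valP F; have [s hs sF] := flag_ordering hF.
by exists s; rewrite hs -(mF _ (flag_of_flag hs) sF) eqxx.
Qed.

Definition chart_seq (F : chart n) : seq 'I_n := xchoose (chart_ordering F).

Lemma chart_seqP (F : chart n) : ordering (chart_seq F).
Proof. by have /andP[] := xchooseP (chart_ordering F). Qed.

Lemma flag_of_chart_seq (F : chart n) : flag_of (chart_seq F) = val F.
Proof. by have /andP[_ /eqP] := xchooseP (chart_ordering F). Qed.

Lemma chart_seq_uniq (F : chart n) : uniq (chart_seq F). Proof. by case/andP: (chart_seqP F). Qed.
Lemma size_chart_seq (F : chart n) : size (chart_seq F) = n. Proof. by case/andP: (chart_seqP F) => _ /eqP. Qed.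

Definition chart_of s (hs : ordering s) : chart n := exist _ (flag_of s) (flag_of_max hs).

Lemma prefix_setT s k : ordering s -> (n <= k)%N -> prefix_set s k = setT.
Proof.
move=> hs nk; apply/setP => x; rewrite !inE take_oversize ?ordering_mem //.
by case/andP: hs => _ /eqP ->.
Qed.

Lemma flag_of_prefix s1 s2 k : ordering s1 -> ordering s2 -> flag_of s1 = flag_of s2 ->
  prefix_set s1 k = prefix_set s2 k.
Proof.
move=> h1 h2 E; have [k0|k0] := posnP k.
  by apply/setP => x; rewrite !inE k0 !take0.
have [nk|kn] := leqP n k; first by rewrite !prefix_setT.
have : prefix_set s1 k \in flag_of s2 by rewrite -E; apply/flag_ofP; exists k; rewrite ?k0.
case/flag_ofP => l /andP[l0 ln] El; rewrite El.
case/andP: h1 => u1 /eqP z1; case/andP: h2 => u2 /eqP z2.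
have c1 : #|prefix_set s1 k| = k by apply: card_prefix; rewrite // z1 ltnW.
have c2 : #|prefix_set s2 l| = l by apply: card_prefix; rewrite // z2 ltnW.
by rewrite -c1 El c2.
Qed.

Lemma flag_of_inj s1 s2 : ordering s1 -> ordering s2 -> flag_of s1 = flag_of s2 -> s1 = s2.
Proof.
move=> h1 h2 E; have hk := flag_of_prefix _ h1 h2 E.
case/andP: (h1) => u1 /eqP z1; case/andP: (h2) => u2 /eqP z2.
have [s0|] := posnP (size s1).
  by rewrite (size0nil s0) (size0nil (s := s2)) // z2 -z1.
move=> s0; have x0 : 'I_n by case: (s1) s0.
apply: (@eq_from_nth _ x0); rewrite z1 ?z2 // => k kn.
have := hk k.+1; rewrite /prefix_set !(take_nth x0) ?z1 ?z2 // => /setP /(_ (nth x0 s1 k)).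
rewrite !inE !mem_rcons !inE eqxx /=; case/esym/orP => [/eqP //|].
have := hk k; move/setP/(_ (nth x0 s1 k)); rewrite !inE => <-.
by rewrite in_take ?mem_nth ?z1 // index_uniq ?z1 // ltnn.
Qed.

Lemma chart_seq_chart_of s (hs : ordering s) : chart_seq (chart_of hs) = s.
Proof. by apply: flag_of_inj; rewrite ?chart_seqP // flag_of_chart_seq. Qed.

Lemma chart_seq_inj : injective chart_seq.
Proof. by move=> F G E; apply: val_inj; rewrite -!flag_of_chart_seq E. Qed.

End Orderings.

Lemma set_in_nil (T : finType) : [set x in [::]] = set0 :> {set T}.
Proof. by apply/setP => x; rewrite !inE. Qed.

(** * Flag sums as sums over charts *)

Section ChartSums.
Variable n : nat.
Implicit Types (s : seq 'I_n) (A X U : {set 'I_n}).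

Fixpoint listings m A : seq (seq 'I_n) :=
  if m is m'.+1 then flatten [seq [seq x :: s | s <- listings m' (A :\ x)] | x <- enum A]
  else [:: [::]].

Lemma mem_listings m A s : #|A| = m ->
  (s \in listings m A) = uniq s && ([set x in s] == A).
Proof.
elim: m A s => [|m IH] A s cA /=.
  have A0 : A = set0 by apply/eqP; rewrite -cards_eq0 cA.
  rewrite inE A0; case: s => [|x s]; first by rewrite /= set_in_nil !eqxx.
  rewrite (_ : (_ == set0) = false) ?andbF //.
  by apply/eqP => /setP /(_ x); rewrite !inE eqxx.
have cx x : x \in A -> #|A :\ x| = m.
  by move=> xA; move: cA; rewrite (cardsD1 x) xA => -[].
apply/flatten_mapP/andP => [[x]|[us /eqP EA]].
  rewrite mem_enum => xA /mapP [s' + ->]; rewrite IH ?cx // => /andP[us' /eqP E].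
  have nx : x \notin s' by move/setP/(_ x): E; rewrite !inE eqxx => ->.
  split; first by rewrite /= nx us'.
  apply/eqP/setP => y; move/setP/(_ y): E; rewrite !inE => ->.
  by have [->|] := eqVneq y x.
case: s us EA => [|x s] us EA.
  by move: cA; rewrite -EA set_in_nil cards0.
have xA : x \in A by rewrite -EA !inE eqxx.
case/andP: us => nx us; exists x; first by rewrite mem_enum.
apply/mapP; exists s => //; rewrite IH ?cx //; apply/andP; split=> //; rewrite -EA.
apply/eqP/setP => y; rewrite !inE; have [->|] := eqVneq y x => //=.
exact: negbTE.
Qed.

Lemma uniq_listings m A : #|A| = m -> uniq (listings m A).
Proof.
elim: m A => [|m IH] A cA //=.
have cx x : x \in A -> #|A :\ x| = m.
  by move=> xA; move: cA; rewrite (cardsD1 x) xA => -[].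
have : all (mem A) (enum A) by apply/allP => x; rewrite mem_enum.
elim: (enum A) (enum_uniq A) => //= x e IHe /andP[xe ue] /andP[xA eA].
rewrite cat_uniq IHe // andbT map_inj_uniq ?IH ?cx //=; last by move=> ? ? [].
apply/hasPn => s /flatten_mapP [y ye /mapP [s' _ ->]].
by apply/mapP => -[s'' _ [E _]]; rewrite -E ye in xe.
Qed.

Lemma mem_listingsT s : (s \in listings n setT) = ordering s.
Proof.
rewrite mem_listings ?cardsT ?card_ord // /ordering.
case us: (uniq s) => //=; apply/eqP/eqP => [E|sz].
  by have := card_uniqP us; rewrite -cardsE E cardsT card_ord.
by apply/setP => x; rewrite !inE ordering_mem // /ordering us sz eqxx.
Qed.

Lemma sum_charts (V : zmodType) (f : seq 'I_n -> V) :
  \sum_(F : chart n) f (chart_seq F) = \sum_(s <- listings n setT) f s.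
Proof.
rewrite -(big_map (@chart_seq n) predT f); apply: perm_big; apply: uniq_perm.
- by rewrite map_inj_uniq ?index_enum_uniq //; exact: chart_seq_inj.
- by rewrite uniq_listings ?cardsT ?card_ord.
move=> s; rewrite mem_listingsT; apply/mapP/idP => [[F _ ->]|hs]; first exact: chart_seqP.
by exists (chart_of hs); rewrite ?mem_index_enum ?chart_seq_chart_of.
Qed.

Variables (K : fieldType) (t : 'I_n -> K) (u : K) (cl : {set 'I_n} -> 'I_n -> bool).
Variable a : {set 'I_n} -> int.

Fixpoint link_prod p s : K :=
  if s is x :: s' then link t p x * link_prod (Some x) s' else 1.

Fixpoint step_prod X s : K :=
  if s is x :: s' then step t u cl a X x * step_prod (x |: X) s' else 1.

Lemma flag_sum_listings p X U : flag_sum t u cl a p X U =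
  \sum_(s <- listings #|U :\: X| (U :\: X)) link_prod p s * step_prod X s.
Proof.
rewrite /flag_sum; move: {-2}#|U :\: X| (erefl #|U :\: X|) => m cm.
elim: m p X cm => [|m IH] p X cm /=; first by rewrite big_seq1 mulr1.
rewrite big_flatten big_map big_enum_cond /=; apply: eq_big => [x|x hx]; first by rewrite andbT.
have cx : #|U :\: (x |: X)| = m.
  by move: cm; rewrite (card_setDU1 hx) => -[].
rewrite IH // big_map mulr_sumr -setDU1; apply: eq_bigr => s _ /=.
by ring.
Qed.

Lemma step_prodE X s (f : 'I_n -> K) :
  (forall s1 x s2, s = s1 ++ x :: s2 -> step t u cl a (X :|: [set y in s1]) x = f x) ->
  step_prod X s = \prod_(x <- s) f x.
Proof.
elim: s X => [|x s IH] X h /=; first by rewrite big_nil.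
rewrite big_cons -(h [::] x s) // set_in_nil setU0; congr (_ * _); apply: IH => s1 y s2 E.
rewrite -(h (x :: s1) y s2) ?E //; congr step; apply/setP => z; rewrite !inE.
by case: (z == x); case: (z \in X); case: (z \in s1).
Qed.

Lemma flag_sum_charts : flag_sum t u cl a None set0 setT =
  \sum_(F : chart n) link_prod None (chart_seq F) * step_prod set0 (chart_seq F).
Proof.
rewrite flag_sum_listings setD0 cardsT card_ord.
by rewrite (sum_charts (fun s => link_prod None s * step_prod set0 s)).
Qed.

End ChartSums.

(** * Initial bases *)

Section MatroidRank.
Variables (n : nat) (M : matroid n).
Implicit Types (B C S T X Y : {set 'I_n}) (F : {set {set 'I_n}}).

Lemma bases_card B C : B \in bases M -> C \in bases M -> #|B| = #|C|.
Proof.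
have [m] := ubnP #|B :\: C|; elim: m B => // m IH B hm hB hC.
have [BC|] := boolP (B :\: C == set0).
  have [CB|] := boolP (C :\: B == set0).
    by congr #|pred_of_set _|; apply/eqP; rewrite eqEsubset -!setD_eq0 BC CB.
  case/set0Pn => x xCB; have [y] := bases_exchange hC hB xCB.
  by rewrite (eqP BC) inE.
case/set0Pn => x xBC; have [y yCB hB'] := bases_exchange hB hC xBC.
move: (xBC) (yCB); rewrite !inE => /andP[xC xB] /andP[yB yC].
rewrite -(IH _ _ hB' hC).
  by rewrite cardsU1 !inE (negbTE yB) andbF (cardsD1 x B) xB.
rewrite -ltnS; apply: leq_trans hm; rewrite ltnS; apply/proper_card/properP; split.
  apply/subsetP => z; rewrite !inE => /andP[zC]; rewrite zC /=.
  by case/orP => [/eqP E|/andP[]//]; rewrite E yC in zC.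
by exists x => //; rewrite !inE negb_and negbK eqxx /= orbF; apply/orP; right; apply: contraNneq xC => ->.
Qed.

Definition rk S : nat := (\max_(B in bases M) #|B :&: S|)%N.

Lemma rk_ge B S : B \in bases M -> (#|B :&: S| <= rk S)%N.
Proof. by move=> hB; rewrite /rk (bigD1 B) //= leq_maxl. Qed.

Lemma rk_attained S : exists2 B, B \in bases M & #|B :&: S| = rk S.
Proof.
have /set0Pn [B0 hB0] := bases_neq0 M.
have h0 : (0 < #|bases M|)%N by apply/card_gt0P; exists B0.
by have [B hB E] := eq_bigmax_cond (fun B => #|B :&: S|) h0; exists B.
Qed.

(** Unlike [is_flag] this admits the empty and the full set, so it applies to the pair of an
    intersection and a union. *)
Definition chain F := [forall S in F, forall T in F, (S \subset T) || (T \subset S)].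

Definition depth F (i : 'I_n) : int := \sum_(S in F) (i \in S)%:R.

Lemma flag_initial_exists F : exists B, B \in flag_initial_bases M F.
Proof.
have /set0Pn [B0 hB0] := bases_neq0 M.
case: (arg_maxP (fun B => \sum_(i in B) depth F i) hB0) => B hB' mB.
have hB : B \in bases M := hB'; exists B; rewrite inE hB /=; apply/forall_inP => C hC; exact: (mB C hC).
Qed.

(** Suppose some basis meets S in more elements than B, and let C be such a basis with least C \ B;
    exchange shows C \ B inside S. Replacing an element of B outside S by an element of C \ B then
    raises the total depth: members containing the old element contain S, hence the new one, and S
    itself is gained. *)
Lemma flag_initial_rk F B S : chain F -> B \in flag_initial_bases M F -> S \in F ->
  #|B :&: S| = rk S.
Proof.
move=> cF; rewrite inE => /andP[hB /forall_inP mB] SF.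
apply/eqP; rewrite eqn_leq rk_ge // leqNgt; apply/negP => lt.
pose P C := (C \in bases M) && (#|B :&: S| < #|C :&: S|)%N.
have [C0 PC0] : exists C, P C.
  by have [C hC E] := rk_attained S; exists C; rewrite /P hC E.
case: (arg_minnP (fun C : {set 'I_n} => #|C :\: B|) PC0) => C /andP[hC ltC] minC.
have sCB : C :\: B \subset S.
  apply/subsetP => y yCB; apply/negPn/negP => yS.
  have [z zBC hC'] := bases_exchange hC hB yCB.
  move: (yCB) (zBC); rewrite !inE => /andP[yB yC] /andP[zC zB].
  have PC' : P (z |: (C :\ y)).
    rewrite /P hC'; apply: leq_trans ltC _; apply: subset_leq_card.
    apply/subsetP => w; rewrite !inE => /andP[wC wS]; rewrite wC wS andbT /=.
    by have [E|_] := eqVneq w y; rewrite ?orbT //; rewrite -E wS in yS.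
  have := minC _ PC'; rewrite leqNgt => /negP; apply.
  apply/proper_card/properP; split.
    apply/subsetP => w; rewrite !inE => /andP[wB]; rewrite wB /=.
    by case/orP => [/eqP E|/andP[]//]; rewrite E zB in wB.
  exists y; first by rewrite inE yB.
  by rewrite !inE yB eqxx /= orbF; apply: contraNneq yB => ->.
have ltD : (#|C :\: S| < #|B :\: S|)%N.
  have := bases_card hB hC; rewrite -(cardsID S B) -(cardsID S C); lia.
have [x xBS xC] : exists2 x, x \in B :\: S & x \notin C.
  apply/subsetPn; apply: contraL ltD => h; rewrite -leqNgt; apply: subset_leq_card.
  by apply/subsetP => w wBS; rewrite inE (subsetP h) // andbT; move: wBS; rewrite inE => /andP[].
move: (xBS); rewrite inE => /andP[xS xB].
have xBC : x \in B :\: C by rewrite inE xC.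
have [y yCB hB'] := bases_exchange hB hC xBC.
have yS : y \in S by apply: (subsetP sCB).
move: yCB; rewrite inE => /andP[yB yC].
have := mB _ hB'; rewrite (big_setU1 y) /=; last by rewrite !inE (negbTE yB) andbF.
rewrite [leRHS](big_setD1 x xB) /= lerD2r leNgt => /negP; apply.
rewrite !(bigD1 S SF (F := fun T => (_ \in T)%:R)) /= yS (negbTE xS) add0r.
rewrite -[X in X < _]add0r; apply: ltr_leD => //.
apply: ler_sum => T /andP[TF _].
have [xT|] := boolP (x \in T); last by case: (y \in T).
have /orP[h|h] : (S \subset T) || (T \subset S).
- by move: cF => /forall_inP /(_ _ SF) /forall_inP /(_ _ TF).
- by rewrite (subsetP h).
by rewrite (subsetP h _ xT) in xS.
Qed.

(** A single basis that is initial for the chain of X :&: Y and X :|: Y computes both ranks on the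
    left. *)
Lemma rk_submod X Y : (rk (X :|: Y) + rk (X :&: Y) <= rk X + rk Y)%N.
Proof.
pose F := [set X :|: Y; X :&: Y].
have s : X :&: Y \subset X :|: Y by apply: subset_trans (subsetIl _ _) (subsetUl _ _).
have cF : chain F.
  apply/forall_inP => S /set2P[]->; apply/forall_inP => T /set2P[]->; by rewrite ?subxx ?s ?orbT.
have [B hB] := flag_initial_exists F.
rewrite -(flag_initial_rk cF hB (set21 _ _)) -(flag_initial_rk cF hB (set22 _ _)).
have bB : B \in bases M by move: hB; rewrite inE => /andP[].
apply: leq_trans (leq_add (rk_ge X bB) (rk_ge Y bB)).
by rewrite setIUr setIIr cardsUI.
Qed.

Lemma rk_sub X Y : X \subset Y -> (rk X <= rk Y)%N.
Proof.
move=> XY; have [B hB <-] := rk_attained X; apply: leq_trans (rk_ge Y hB).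
by apply: subset_leq_card; apply: setIS.
Qed.

Lemma rkU1 X i : (rk (i |: X) <= (rk X).+1)%N.
Proof.
have [B hB <-] := rk_attained (i |: X); apply: leq_trans (_ : #|i |: (B :&: X)| <= _)%N.
  apply: subset_leq_card; rewrite setIUr; apply: setSU; exact: subsetIr.
by rewrite cardsU1 -add1n leq_add ?rk_ge //; case: (_ \notin _).
Qed.

Definition cl X (i : 'I_n) := rk (i |: X) == rk X.

Lemma cl_rk X i : (rk (i |: X) = rk X + ~~ cl X i)%N.
Proof.
rewrite /cl; have h2 := rkU1 X i; have h1 := rk_sub (subsetUr [set i] X).
have [->|ne] := eqVneq (rk (i |: X)) (rk X); first by rewrite addn0.
by apply/eqP; rewrite addn1 eqn_leq h2 ltn_neqAle eq_sym ne h1.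
Qed.

Lemma cl_sub X Y i : X \subset Y -> cl X i -> cl Y i.
Proof.
move=> XY; have [iY|iY] := boolP (i \in Y).
  have -> // : cl Y i; rewrite /cl (_ : i |: Y = Y) //.
  by apply/setUidPr; rewrite sub1set.
have := rk_submod (i |: X) Y.
have -> : (i |: X) :&: Y = X.
  rewrite setIUl (setIidPl XY); apply/setUidPr/subsetP => z; rewrite !inE.
  by case/andP => /eqP -> h; rewrite h in iY.
rewrite -setUA (setUidPr XY) !cl_rk; case: (cl X i); case: (cl Y i) => //=; lia.
Qed.

(** Both sides are the rank of X with i and j added, minus the rank of X. *)
Lemma cl_exch X i j : i \notin X -> j \notin X -> i != j ->
  (~~ cl X i + ~~ cl (i |: X) j = ~~ cl X j + ~~ cl (j |: X) i)%N.
Proof.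
move=> _ _ _; have := cl_rk (i |: X) j; have := cl_rk (j |: X) i.
rewrite setUCA => ->; rewrite !cl_rk; lia.
Qed.

(** B meets every prefix of the ordering in as many elements as its rank, so x lies in B exactly
    when the rank grows at x. This is the greedy algorithm. *)
Lemma initial_mem (F : chart n) B s1 x s2 : B \in flag_initial_bases M (val F) ->
  chart_seq F = s1 ++ x :: s2 -> (x \in B) = ~~ cl [set y in s1] x.
Proof.
move=> hB E; have hF : is_flag (val F) by have /maxsetP[] := valP F.
have bB : B \in bases M by move: hB; rewrite inE => /andP[].
have cF : chain (val F) by case/andP: hF.
have hs := chart_seqP F; have us := chart_seq_uniq F; have sz := size_chart_seq F.
have rkT : #|B :&: setT| = rk setT.
  apply/eqP; rewrite eqn_leq rk_ge //; have [C hC <-] := rk_attained setT.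
  by rewrite !setIT (bases_card bB hC) /=.
have key k : (k <= n)%N -> #|B :&: prefix_set (chart_seq F) k| = rk (prefix_set (chart_seq F) k).
  move=> kn; have [->|k0] := posnP k.
    rewrite /prefix_set take0 set_in_nil setI0 cards0; apply/esym/eqP; rewrite -leqn0.
    by have [C hC <-] := rk_attained set0; rewrite setI0 cards0.
  have [nk|kn'] := leqP n k; first by rewrite prefix_setT.
  by apply: flag_initial_rk hB _ => //; rewrite -flag_of_chart_seq; apply/flag_ofP; exists k; rewrite ?k0.
have sn : (size s1 < n)%N.
  have h : (size s1 < size (chart_seq F))%N by rewrite E size_cat /= addnS ltnS leq_addr.
  by apply: leq_trans h _; rewrite sz.
have T1 : take (size s1) (s1 ++ x :: s2) = s1 by rewrite take_size_cat.
have T2 : take (size s1).+1 (s1 ++ x :: s2) = rcons s1 x.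
  by rewrite -cat_rcons take_size_cat ?size_rcons.
have := key _ sn; have := key _ (ltnW sn); rewrite /prefix_set E T1 T2 => E2.
have nx : x \notin s1 by move: us; rewrite E -cat_rcons cat_uniq rcons_uniq => /andP[/andP[]].
have -> : [set y in rcons s1 x] = x |: [set y in s1].
  by apply/setP => y; rewrite !inE mem_rcons inE.
rewrite cl_rk setIUr cardsU -E2.
have -> : B :&: [set x] :&: (B :&: [set y in s1]) = set0.
  apply/setP => y; rewrite !inE; have [->|] := eqVneq y x; rewrite ?(negbTE nx) ?andbF //.
rewrite cards0 subn0.
have -> : #|B :&: [set x]| = (x \in B).
  case xB: (x \in B).
    by rewrite (setIidPr _) ?cards1 // sub1set.
  by apply/eqP; rewrite cards_eq0; apply/eqP/setP => y; rewrite !inE; have [->|] := eqVneq y x; rewrite ?xB ?andbF.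
by rewrite addnC => /addnI; case: (x \in B); case: (cl _ _).
Qed.

Lemma mrankE B : B \in bases M -> mrank M = #|B|.
Proof.
move=> hB; apply/eqP; rewrite eqn_leq; apply/andP; split; last first.
  by rewrite /mrank (bigD1 B) //= leq_maxl.
by apply/bigmax_leqP => C hC; rewrite (bases_card hB hC).
Qed.

End MatroidRank.

Lemma big_uniq_supp (V : nmodType) (T : eqType) (L L' : seq T) (f : T -> V) :
  uniq L -> uniq L' -> {subset L <= L'} -> (forall x, x \notin L -> f x = 0) ->
  \sum_(x <- L') f x = \sum_(x <- L) f x.
Proof.
move=> uL uL' LL' f0; rewrite (bigID (mem L)) /= [X in _ + X]big1 // addr0 -big_filter.
apply: perm_big; apply: uniq_perm => //; first exact: filter_uniq.
by move=> x; rewrite mem_filter; case xL: (x \in L) => //=; apply: LL'.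
Qed.

(** * Laurent polynomials *)

Section Laurent.
Variables (k : fieldType) (n : nat).
Implicit Types (m d : lattice n) (s : seq (lattice n * k)) (a b : ratfun k n) (c : k).

Local Notation rc := (@rconst k n).
Local Notation rm := (@rmonom k n).

Lemma rconstD c c' : rc (c + c') = rc c + rc c'.
Proof. by rewrite /rconst !rmorphD. Qed.
Lemma rconstM c c' : rc (c * c') = rc c * rc c'.
Proof. by rewrite /rconst !rmorphM. Qed.
Lemma rconst0 : rc 0 = 0. Proof. by rewrite /rconst !rmorph0. Qed.
Lemma rconst1 : rc 1 = 1. Proof. by rewrite /rconst !rmorph1. Qed.
Lemma rconstN c : rc (- c) = - rc c. Proof. by rewrite /rconst !rmorphN. Qed.
Lemma rconst_sum I (r : seq I) (P : pred I) (f : I -> k) :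
  rc (\sum_(i <- r | P i) f i) = \sum_(i <- r | P i) rc (f i).
Proof. by rewrite /rconst !rmorph_sum. Qed.

Lemma tofracX_neq0 i : FracField.tofrac (mpolyX k (mnm1 i)) != 0 :> ratfun k n.
Proof.
rewrite tofrac_eq0; apply/eqP => /(congr1 (mcoeff (mnm1 i))) /eqP.
by rewrite mcoeffX eqxx mcoeff0 oner_eq0.
Qed.

Lemma rmonom0 : rm 0 = 1.
Proof. by rewrite /rmonom big1 // => i _; rewrite ffunE expr0z. Qed.

Lemma rmonomD m m' : rm (m + m') = rm m * rm m'.
Proof.
rewrite /rmonom -big_split; apply: eq_bigr => i _.
by rewrite ffunE expfzDr // tofracX_neq0.
Qed.

Lemma rmonom_neq0 m : rm m != 0.
Proof. by apply/prodf_neq0 => i _; rewrite expfz_neq0 // tofracX_neq0. Qed.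

Definition laur s : ratfun k n := \sum_(p <- s) rc p.2 * rm p.1.

Definition cf s m : k := \sum_(p <- s | p.1 == m) p.2.

Definition shift_mnm (K : nat) m : 'X_{1..n} := [multinom absz (m i + K%:Z)%R | i < n].

Lemma rmonom_shift K m : (forall i, 0 <= m i + K%:Z) ->
  rm m * rm [ffun=> K%:Z] = FracField.tofrac (mpolyX k (shift_mnm K m)).
Proof.
move=> h; rewrite -rmonomD /rmonom mpolyXE_id rmorph_prod; apply: eq_bigr => i _.
rewrite !ffunE mnmE rmorphXn /=.
by rewrite -[in LHS](gez0_abs (h i)).
Qed.

Lemma shift_bound s : exists K : nat, forall p, p \in s -> forall i, 0 <= p.1 i + K%:Z.
Proof.
exists (\sum_(p <- s) \sum_(i < n) absz (p.1 i))%N => p ps i.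
rewrite (big_rem p ps) /= (bigD1 i) //= -addnA PoszD addrA.
by apply: addr_ge0 => //; case: (p.1 i) => z //; rewrite NegzE abszN /= addNr.
Qed.

(** A monomial factor clears the negative exponents, and then the coefficients of a polynomial are
    compared. *)
Lemma laur_eq0 s : laur s = 0 -> forall m, cf s m = 0.
Proof.
move=> h m; have [mS|mS] := boolP (m \in map fst s); last first.
  rewrite /cf big_seq_cond big1 // => p /andP[ps /eqP E].
  by rewrite -E map_f in mS.
have [K hK] := shift_bound s.
have hm i : 0 <= m i + K%:Z by case/mapP: mS => p ps ->; apply: hK.
have E : \sum_(p <- s) p.2 *: mpolyX k (shift_mnm K p.1) = 0.
  apply/eqP; rewrite -(tofrac_eq0 (\sum_(p <- s) _)); apply/eqP.
  transitivity (laur s * rm [ffun=> K%:Z]); last by rewrite h mul0r.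
  rewrite /laur mulr_suml rmorph_sum big_seq [RHS]big_seq; apply: eq_bigr => p ps.
  by rewrite -mulrA rmonom_shift; [rewrite -mul_mpolyC rmorphM | apply: hK].
have : (\sum_(p <- s) p.2 *: mpolyX k (shift_mnm K p.1))@_(shift_mnm K m) = 0.
  by rewrite E mcoeff0.
rewrite raddf_sum /= /cf => E2; rewrite -[RHS]E2 [LHS]big_mkcond big_seq [RHS]big_seq.
apply: eq_bigr => p ps; rewrite mcoeffZ mcoeffX.
have -> : (shift_mnm K p.1 == shift_mnm K m) = (p.1 == m).
  apply/eqP/eqP => [/mnmP e|-> //]; apply/ffunP => i.
  have := e i; rewrite !mnmE => ei; apply: (addIr K%:Z).
  by rewrite -(gez0_abs (hm i)) -(gez0_abs (hK p ps i)) ei.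
by case: eqP => _; rewrite ?mulr1 ?mulr0.
Qed.

Lemma laur_cat s s' : laur (s ++ s') = laur s + laur s'.
Proof. by rewrite /laur big_cat. Qed.
Lemma cf_cat s s' m : cf (s ++ s') m = cf s m + cf s' m.
Proof. by rewrite /cf big_cat. Qed.

Definition lscale c d s := [seq (d + p.1, c * p.2) | p <- s].

Lemma laur_scale c d s : laur (lscale c d s) = rc c * rm d * laur s.
Proof.
rewrite /laur big_map mulr_sumr; apply: eq_bigr => p _ /=.
by rewrite rconstM rmonomD; ring.
Qed.

Lemma cf_scale c d s m : cf (lscale c d s) m = c * cf s (m - d).
Proof.
rewrite /cf big_map mulr_sumr; apply: eq_bigl => p /=.
by rewrite addrC eq_sym -subr_eq eq_sym.
Qed.

Lemma laur_ext s s' : laur s = laur s' -> cf s =1 cf s'.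
Proof.
move=> h m; have : laur (s ++ lscale (-1) 0 s') = 0.
  by rewrite laur_cat laur_scale h rconstN rconst1 rmonom0 mulr1 mulN1r subrr.
move/laur_eq0/(_ m); rewrite cf_cat cf_scale subr0 mulN1r => /eqP.
by rewrite subr_eq0 => /eqP.
Qed.

Lemma laurE s (L : seq (lattice n)) : uniq L -> (forall p, p \in s -> p.1 \in L) ->
  laur s = \sum_(m <- L) rc (cf s m) * rm m.
Proof.
move=> uL hL; rewrite /cf.
under eq_bigr do rewrite rconst_sum mulr_suml.
rewrite (exchange_big_dep predT) //= /laur big_seq [RHS]big_seq; apply: eq_bigr => p ps.
rewrite big_mkcond (bigD1_seq p.1) ?hL //= eqxx big1 ?addr0 //.
by move=> m; rewrite eq_sym => /negbTE ->.
Qed.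

Definition is_laur a := exists s, a = laur s.

(** The representation is chosen by [epsilon]; by [laur_ext] the coefficients of a Laurent
    polynomial do not depend on the choice. *)
Definition lcoef a : lattice n -> k := cf (epsilon (inhabits [::]) (fun s => a = laur s)).

Lemma lcoef_laur s m : lcoef (laur s) m = cf s m.
Proof.
apply: laur_ext; symmetry.
exact: (epsilon_spec (inhabits [::]) (fun s' => laur s = laur s') (ex_intro _ s erefl)).
Qed.

Lemma is_laur0 : is_laur 0. Proof. by exists [::]; rewrite /laur big_nil. Qed.

Lemma is_laurD a b : is_laur a -> is_laur b -> is_laur (a + b).
Proof. by move=> [s ->] [s' ->]; exists (s ++ s'); rewrite laur_cat. Qed.

Lemma is_laur_scale c d a : is_laur a -> is_laur (rc c * rm d * a).
Proof. by move=> [s ->]; exists (lscale c d s); rewrite laur_scale. Qed.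

Lemma lcoefD a b m : is_laur a -> is_laur b -> lcoef (a + b) m = lcoef a m + lcoef b m.
Proof. by move=> [s ->] [s' ->]; rewrite -laur_cat !lcoef_laur cf_cat. Qed.

Lemma lcoef_scale c d a m : is_laur a -> lcoef (rc c * rm d * a) m = c * lcoef a (m - d).
Proof. by move=> [s ->]; rewrite -laur_scale !lcoef_laur cf_scale. Qed.

Lemma lcoef0 m : lcoef 0 m = 0.
Proof. by have -> : (0 : ratfun k n) = laur [::]; rewrite ?lcoef_laur /laur /cf big_nil. Qed.

Lemma is_laur_sum I (r : seq I) (P : pred I) (f : I -> ratfun k n) :
  (forall i, P i -> is_laur (f i)) -> is_laur (\sum_(i <- r | P i) f i).
Proof. by move=> h; apply: (big_ind is_laur) => //; [exact: is_laur0 | exact: is_laurD]. Qed.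

Lemma lcoef_sum I (r : seq I) (P : pred I) (f : I -> ratfun k n) m :
  (forall i, P i -> is_laur (f i)) ->
  lcoef (\sum_(i <- r | P i) f i) m = \sum_(i <- r | P i) lcoef (f i) m.
Proof.
move=> h; elim: r => [|i r IH]; first by rewrite !big_nil lcoef0.
by rewrite !big_cons; case: ifP => // Pi; rewrite lcoefD ?IH //; [exact: h | exact: is_laur_sum].
Qed.

Lemma is_laur_monom c d : is_laur (rc c * rm d).
Proof. by exists [:: (d, c)]; rewrite /laur big_seq1. Qed.

Lemma lcoef_monom c d m : lcoef (rc c * rm d) m = if d == m then c else 0.
Proof.
have -> : rc c * rm d = laur [:: (d, c)] by rewrite /laur big_seq1.
by rewrite lcoef_laur /cf big_mkcond big_seq1.
Qed.

Lemma lcoef_supp a : is_laur a -> exists L : seq (lattice n),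
  uniq L /\ forall m, lcoef a m != 0 -> m \in L.
Proof.
move=> [s ->]; exists (undup (map fst s)); split; first exact: undup_uniq.
move=> m; rewrite lcoef_laur mem_undup; apply: contra_neqT => mS.
rewrite /cf big_seq_cond big1 // => p /andP[ps /eqP E].
by rewrite -E map_f in mS.
Qed.

Lemma lcoefE a L : is_laur a -> uniq L -> (forall m, lcoef a m != 0 -> m \in L) ->
  a = \sum_(m <- L) rc (lcoef a m) * rm m.
Proof.
move=> [s ->] uL hL; pose L' := undup (L ++ map fst s).
rewrite {1}(laurE (L := L')) ?undup_uniq //; last first.
  by move=> p ps; rewrite mem_undup mem_cat map_f ?orbT.
under eq_bigr do rewrite -lcoef_laur.
apply: big_uniq_supp => //; first exact: undup_uniq.
  by move=> m hm; rewrite mem_undup mem_cat hm.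
by move=> m /(contraNN (hL m)); rewrite negbK => /eqP ->; rewrite rconst0 mul0r.
Qed.

Lemma lcoef_inj a b : is_laur a -> is_laur b -> lcoef a =1 lcoef b -> a = b.
Proof.
move=> ha hb E; have [L [uL hL]] := lcoef_supp ha.
rewrite (lcoefE ha uL hL) (lcoefE hb uL); last by move=> m; rewrite -E; apply: hL.
by apply: eq_bigr => m _; rewrite E.
Qed.

Lemma regularP (F : {set {set 'I_n}}) a :
  regular F a <-> is_laur a /\ forall m, lcoef a m != 0 -> dual_cone F m.
Proof.
split=> [[s [/allP hs ->]]|[ha h]].
  split; first by exists s.
  move=> m; rewrite lcoef_laur => hm; apply: contraR hm => nm.
  rewrite /cf big_seq_cond big1 // => p /andP[/hs hp /eqP E].
  by rewrite -E hp in nm.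
have [L [uL hL]] := lcoef_supp ha.
have hL' m : lcoef a m != 0 -> m \in [seq m <- L | lcoef a m != 0].
  by move=> hm; rewrite mem_filter hm hL.
exists [seq (m, lcoef a m) | m <- L & lcoef a m != 0]; split.
  by apply/allP => p /mapP [m]; rewrite mem_filter => /andP[hm _] -> /=; apply: h.
rewrite {1}(lcoefE ha _ hL') ?filter_uniq //.
by rewrite big_map.
Qed.

Lemma dual_cone0 (F : {set {set 'I_n}}) : dual_cone F 0.
Proof.
have h (S : {set 'I_n}) : pairing (0 : lattice n) S = 0 by rewrite /pairing big1 // => i _; rewrite ffunE.
by rewrite /dual_cone h eqxx; apply/forall_inP => S _; rewrite h.
Qed.

Lemma pairingD m m' (S : {set 'I_n}) : pairing (m + m') S = pairing m S + pairing m' S.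
Proof. by rewrite /pairing -big_split; apply: eq_bigr => i _; rewrite ffunE. Qed.
Lemma pairingN m (S : {set 'I_n}) : pairing (- m) S = - pairing m S.
Proof. by rewrite /pairing -sumrN; apply: eq_bigr => i _; rewrite ffunE. Qed.

Lemma dual_coneD (F : {set {set 'I_n}}) m m' : dual_cone F m -> dual_cone F m' -> dual_cone F (m + m').
Proof.
case/andP=> /eqP h1 /forall_inP h2 /andP[/eqP h3 /forall_inP h4].
rewrite /dual_cone pairingD h1 h3 addr0 eqxx; apply/forall_inP => S SF.
by rewrite pairingD addr_ge0 ?h2 ?h4.
Qed.

Lemma dual_cone_sub (F G : {set {set 'I_n}}) m : F \subset G -> dual_cone G m -> dual_cone F m.
Proof.
move=> FG /andP[h1 /forall_inP h2]; rewrite /dual_cone h1.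
by apply/forall_inP => S SF; apply: h2; apply: (subsetP FG).
Qed.

Lemma regular0 F : regular F (0 : ratfun k n).
Proof. by apply/regularP; split=> [|m]; rewrite ?lcoef0 ?eqxx //; exact: is_laur0. Qed.

Lemma regularD F a b : regular F a -> regular F b -> regular F (a + b).
Proof.
move=> [s [hs ->]] [s' [hs' ->]]; exists (s ++ s').
by rewrite all_cat hs hs' big_cat.
Qed.

Lemma regularM F a b : regular F a -> regular F b -> regular F (a * b).
Proof.
move=> [s [/allP hs ->]] [s' [/allP hs' ->]].
exists [seq (p.1 + q.1, p.2 * q.2) | p <- s, q <- s']; split.
  by apply/allP => r /allpairsP [[p q] [/= ps qs ->]] /=; apply: dual_coneD; [apply: hs|apply: hs'].
rewrite big_allpairs_dep mulr_suml; apply: eq_bigr => p _.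
by rewrite mulr_sumr; apply: eq_bigr => q _ /=; rewrite rconstM rmonomD; ring.
Qed.

Lemma regular_const F c : regular F (rc c).
Proof. by exists [:: (0, c)]; rewrite /= dual_cone0 big_seq1 rmonom0 mulr1. Qed.

Lemma regular_monom F c m : dual_cone F m -> regular F (rc c * rm m).
Proof. by move=> h; exists [:: (m, c)]; rewrite /= h big_seq1. Qed.

Lemma rconst_inj : injective rc.
Proof.
move=> c c' h; have := lcoef_monom c 0 0; have := lcoef_monom c' 0 0.
by rewrite eqxx rmonom0 !mulr1 h => -> ->.
Qed.

End Laurent.

Lemma antisym_sum (T : finType) (V : zmodType) (A : {set T}) (t : T -> T -> V) :
  (forall x y, x \in A -> y \in A -> x != y -> t x y = - t y x) ->
  \sum_(x in A) \sum_(y in A | y != x) t x y = 0.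
Proof.
move=> anti; pose lt (x y : T) := (enum_rank x < enum_rank y)%N.
transitivity (\sum_(x in A) (\sum_(y in A | lt x y) t x y + \sum_(y in A | lt y x) t x y)).
  apply: eq_bigr => x xA; rewrite (bigID (lt x)) /=; congr (_ + _); apply: eq_bigl => y.
    by rewrite /lt -andbA; case: (y \in A) => //=; have [->|] := eqVneq y x; rewrite ?ltnn.
  rewrite /lt -andbA -leqNgt; case: (y \in A) => //=.
  by rewrite ltn_neqAle -(inj_eq enum_rank_inj) -(inj_eq val_inj).
rewrite big_split /= [X in _ + X](exchange_big_dep (mem A)) //=; last by move=> x y _ /andP[].
rewrite -big_split big1 //= => x xA; apply/eqP; rewrite addr_eq0 -sumrN; apply/eqP.
apply: eq_big => [y|y /andP[yA xy]]; first by rewrite xA.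
by apply: anti => //; apply: contraTneq xy => ->; rewrite /lt ltnn.
Qed.

Lemma index_enum_card (T : finType) (A : {set T}) x : x \in A ->
  index x (enum A) = #|[set y in A | (enum_rank y < enum_rank x)%N]|.
Proof.
move=> xA; have E (y : T) : (enum_rank y : nat) = index y (enum T).
  by rewrite -[in RHS](enum_rankK y) index_uniq ?enum_uniq // -cardE.
have -> : index x (enum A) = count (mem A) (take (index x (enum T)) (enum T)).
  have -> : enum A = filter (mem A) (enum T) by rewrite enumT.
  have : x \in enum T by rewrite mem_enum.
  elim: (enum T) => //= y r IH; rewrite inE eq_sym.
  have [->|ne] /= := eqVneq y x; first by move: xA => /= ->; rewrite /= eqxx.
  move=> xr; rewrite -IH //; case: ifP => yA /=; rewrite ?(negbTE ne) ?yA ?add1n ?add0n //.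
rewrite -size_filter cardE; apply: perm_size; apply: uniq_perm; rewrite ?enum_uniq ?filter_uniq ?take_uniq ?enum_uniq //.
by move=> y; rewrite mem_filter mem_enum in_take ?mem_enum // [RHS]inE -!E.
Qed.

(** * Acyclic families of charts *)

Section AcyclicFamilies.
Variables (C : finType) (k : fieldType).
Implicit Types (W X Y : {set C}) (P Q : C) (f g h : {set C} -> k).

(** What the coboundary needs of incidence signs in order to square to zero. Kept abstract because
    the complex of sets containing a fixed chart carries twisted signs. *)
Definition sign_rule (e : C -> {set C} -> k) :=
  (forall P W, e P W * e P W = 1) /\
  forall P Q W, P \in W -> Q \in W -> P != Q ->
    e P W * e Q (W :\ P) = - (e Q W * e P (W :\ Q)).

Definition cech_sign P W : k := (-1) ^+ index P (enum W).

Lemma cech_sign_rule : sign_rule cech_sign.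
Proof.
split=> [P W|P Q W PW QW PQ]; first by rewrite /cech_sign -expr2 sqrr_sign.
have key x y : x \in W -> y \in W -> (enum_rank x < enum_rank y)%N ->
    cech_sign x W * cech_sign y (W :\ x) = - (cech_sign y W * cech_sign x (W :\ y)).
  move=> xW yW xy; rewrite /cech_sign.
  have yx : y != x by apply: contraTneq xy => ->; rewrite ltnn.
  rewrite !index_enum_card ?inE ?yx ?xW ?yW 1?eq_sym ?yx //.
  have -> : [set z in W :\ y | (enum_rank z < enum_rank x)%N] = [set z in W | (enum_rank z < enum_rank x)%N].
    apply/setP => z; rewrite !inE; have [->|//] := eqVneq z y.
    by rewrite (ltnNge (enum_rank y)) (ltnW xy) /= !andbF.
  rewrite (cardsD1 x [set z in W | (enum_rank z < enum_rank y)%N]) !inE xW xy /= exprD expr1 mulN1r mulNr opprK mulrC.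
  congr (_ ^+ _ * _); congr #|pred_of_set _|; apply/setP => z; rewrite !inE.
  by rewrite andbA.
have [lt|gt|E] := ltngtP (enum_rank P) (enum_rank Q); first exact: key.
- by rewrite (key Q P) // opprK.
- by move: PQ; rewrite (enum_rank_inj (val_inj E)) eqxx.
Qed.

Variable e : C -> {set C} -> k.
Hypothesis se : sign_rule e.

Definition cobord f W : k := \sum_(P in W) e P W * f (W :\ P).

Lemma eq_cobord f g W : (forall P, P \in W -> f (W :\ P) = g (W :\ P)) -> cobord f W = cobord g W.
Proof. by move=> h; apply: eq_bigr => P PW; rewrite h. Qed.

Lemma cobordB f g W : cobord (fun W => f W - g W) W = cobord f W - cobord g W.
Proof. by rewrite /cobord -sumrB; apply: eq_bigr => P _; rewrite mulrBr. Qed.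

Lemma cobord0 f W : (forall P, P \in W -> f (W :\ P) = 0) -> cobord f W = 0.
Proof. by move=> h; rewrite /cobord big1 // => P PW; rewrite h // mulr0. Qed.

Lemma cobord_cobord f W : cobord (cobord f) W = 0.
Proof.
have [_ anti] := se.
rewrite /cobord; under eq_bigr do rewrite mulr_sumr.
rewrite -[RHS](@antisym_sum _ _ W (fun P Q => e P W * (e Q (W :\ P) * f (W :\ P :\ Q)))).
  by apply: eq_bigr => P _; apply: eq_bigl => Q; rewrite !inE andbC.
move=> P Q PW QW PQ; rewrite !mulrA anti // mulNr; congr (- (_ * f _)).
by apply/setP => x; rewrite !inE; case: (x == P); case: (x == Q).
Qed.

(** Exactness of the cochains supported on Fam, in all degrees at once. The empty set may belong to
    Fam, so that for all subsets of X this is the augmented complex of a simplex. *)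
Definition acyclic (Fam : pred {set C}) :=
  forall f, (forall W, ~~ Fam W -> f W = 0) -> (forall W, Fam W -> cobord f W = 0) ->
  exists2 g, forall W, ~~ Fam W -> g W = 0 & forall W, Fam W -> cobord g W = f W.

Lemma acyclic_empty (Fam : pred {set C}) : (forall W, ~~ Fam W) -> acyclic Fam.
Proof. by move=> h f f0 _; exists (fun _ => 0) => // W; rewrite (negbTE (h W)). Qed.

Lemma eq_acyclic (F1 F2 : pred {set C}) : F1 =1 F2 -> acyclic F1 -> acyclic F2.
Proof.
move=> E a f f0 df; have [W|W|g g0 dg] := a f; rewrite ?E; [exact: f0|exact: df|].
by exists g => W; rewrite -E; [apply: g0|apply: dg].
Qed.

(** The contracting homotopy is the cone over P. *)
Lemma acyclic_simplex X P : P \in X -> acyclic (fun W => W \subset X).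
Proof.
have [sq anti] := se; move=> PX f f0 df.
exists (fun W => if (P \notin W) && (W \subset X) then e P (P |: W) * f (P |: W) else 0).
  by move=> W /negbTE ->; rewrite andbF.
move=> W WX; have sX Q : W :\ Q \subset X by apply: subset_trans WX; apply: subsetDl.
have [PW|PW] := boolP (P \in W).
  rewrite /cobord (bigD1 P PW) /= big1 ?addr0; last first.
    by move=> Q /andP[QW QP]; rewrite !inE PW eq_sym QP /= mulr0.
  by rewrite !inE eqxx sX /= setD1K // mulrA sq mul1r.
have := df (P |: W); rewrite subUset sub1set PX => /(_ WX).
rewrite /cobord (bigD1 P) ?setU11 //= setU1K // => /eqP; rewrite addr_eq0 => /eqP h.
have {h} -> : f W = - (e P (P |: W) * \sum_(Q in W) e Q (P |: W) * f ((P |: W) :\ Q)).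
  rewrite -[LHS]mul1r -(sq P (P |: W)) -mulrA h mulrN; congr (- (_ * _)).
  apply: eq_bigl => Q; rewrite !inE; have [->|_] := eqVneq Q P; last by rewrite andbT.
  by rewrite (negbTE PW).
rewrite mulr_sumr -sumrN; apply: eq_bigr => Q QW.
have QP : Q != P by apply: contraTneq QW => ->.
have E : P |: (W :\ Q) = (P |: W) :\ Q.
  by apply/setP => x; rewrite !inE; have [->|] := eqVneq x P; rewrite ?(eq_sym P) ?QP.
rewrite !inE negb_and PW orbT sX /= E !mulrA -mulNr; congr (_ * _).
have := anti P Q (P |: W); rewrite !inE eqxx QW orbT eq_sym => /(_ isT isT QP).
rewrite setU1K // => h.
rewrite -[LHS]mul1r -(sq P (P |: W)) -mulrA [in X in _ * X]mulrA h mulNr mulrN.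
by rewrite -[e Q (P |: W) * _ * _]mulrA sq mulr1.
Qed.

(** The long exact sequence of a pair. F2 is closed downwards inside F1, so restriction of cochains
    from F1 to F2 commutes with the coboundaries, with kernel the cochains on the difference;
    convexity of F1 makes its coboundary square to zero. *)
Lemma acyclic_diff (F1 F2 : pred {set C}) :
  (forall W, F2 W -> F1 W) ->
  (forall W P, F2 W -> F1 (W :\ P) -> F2 (W :\ P)) ->
  (forall W P Q, F1 W -> F1 (W :\ P :\ Q) -> F1 (W :\ P)) ->
  acyclic F1 -> acyclic F2 -> acyclic (fun W => F1 W && ~~ F2 W).
Proof.
move=> F21 dn cvx a1 a2 f f0 df.
have f01 W : ~~ F1 W -> f W = 0 by move=> h; apply: f0; rewrite (negbTE h).
have f02 W : F2 W -> f W = 0 by move=> h; apply: f0; rewrite h andbF.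
have [|g g0 dg] := a1 f f01.
  move=> W h1; have [h2|h2] := boolP (F2 W); last by apply: df; rewrite h1.
  apply: cobord0 => P _; have [h|h] := boolP (F1 (W :\ P)); last exact: f01.
  by apply: f02; apply: dn.
have [W h|W h|h h0 dh] := a2 (fun W => if F2 W then g W else 0).
- by rewrite (negbTE h).
- rewrite -[RHS](f02 W h) -dg ?F21 //; apply: eq_cobord => P _.
  case: ifP => // h2; rewrite g0 //; apply: contraFN h2; exact: dn.
exists (fun W => if F1 W then g W - cobord h W else 0).
  move=> W; rewrite negb_and negbK => /orP[/negbTE -> //|h2].
  by rewrite F21 // dh // h2 subrr.
move=> W /andP[h1 h2]; transitivity (cobord (fun W => g W - cobord h W) W).
  2: by rewrite cobordB cobord_cobord subr0 dg.
apply: eq_cobord => P PW; case: ifP => // h3.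
have E : cobord h (W :\ P) = 0.
  apply: cobord0 => Q _; apply: h0; apply: contraFN h3 => h4.
  by apply: cvx h1 (F21 _ h4).
by rewrite /= g0 ?h3 // E subr0.
Qed.

End AcyclicFamilies.

(** * Relative complexes of charts through given members *)

Section Nerve.
Variables (C D : finType) (k : fieldType) (mem_of : D -> C -> bool).
Variable e : C -> {set C} -> k.
Hypothesis se : sign_rule e.
Variables (Y : {set C}) (R A : {set D}).
Implicit Types (T B : {set D}) (W : {set C}).

Definition above T : {set C} := [set P in Y | [forall S in T, mem_of S P]].

(** With T empty and B the members of a chart P on which a monomial is negative, these are the sets
    W of charts such that no member in B is common to P and all of W. For a monomial of total degree
    0 this means regularity on the intersection of U_P with the charts of W. *)
Definition escaping T B : pred {set C} := fun W =>
  (W \subset above T) && [forall S in B, ~~ (W \subset above [set S])].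

Hypothesis above_nonempty : forall T, T \subset A -> ~~ (R \subset T) -> above T != set0.
Hypothesis above_empty : forall T, T \subset A -> R \subset T -> above T = set0.

Lemma aboveU T S : above (S |: T) = above T :&: above [set S].
Proof.
apply/setP => P; rewrite !inE; case PY: (P \in Y) => //=.
apply/forall_inP/andP => [h|[/forall_inP h1 /forall_inP h2] S'].
  split; apply/forall_inP => S'; first by move=> hS; apply: h; rewrite inE hS orbT.
  by rewrite inE => /eqP ->; apply: h; rewrite setU11.
by rewrite !inE => /orP[/eqP ->|]; [apply: h2; rewrite inE|apply: h1].
Qed.

Lemma escaping_step T B S : S \notin B -> acyclic e (escaping T B) ->
  acyclic e (escaping (S |: T) B) -> acyclic e (escaping T (S |: B)).
Proof.
move=> SB a1 a2.
apply: (@eq_acyclic _ _ _ (fun W => escaping T B W && ~~ escaping (S |: T) B W)).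
  move=> W; rewrite /escaping aboveU subsetI.
  case: (W \subset above T) => //=.
  have -> : [forall S0 in S |: B, ~~ (W \subset above [set S0])] =
     ~~ (W \subset above [set S]) && [forall S0 in B, ~~ (W \subset above [set S0])].
    apply/forall_inP/andP => [h|[h1 /forall_inP h2] S'].
      by split; [apply: h; rewrite setU11|apply/forall_inP => S' h'; apply: h; rewrite inE h' orbT].
    by rewrite !inE => /orP[/eqP ->|/h2].
  by case: (W \subset _); case: [forall _ in _, _].
apply: acyclic_diff => //.
- by move=> W /andP[]; rewrite /escaping aboveU subsetI => /andP[-> _] ->.
- move=> W P /andP[h _] /andP[_ h2]; rewrite /escaping h2 andbT.
  by apply: subset_trans h; apply: subsetDl.
move=> W P Q /andP[h1 _] /andP[_ /forall_inP h2]; apply/andP; split.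
  by apply: subset_trans h1; apply: subsetDl.
apply/forall_inP => S' hS; apply: contra (h2 _ hS); apply: subset_trans; exact: subsetDl.
Qed.

(** Removing the members of B one by one reduces the family to full simplices on sets [above T']
    with T' inside T :|: B. No such T' contains R, so all these simplices are nonempty. *)
Lemma escaping_acyclic1 T B : T :|: B \subset A -> ~~ (R \subset T :|: B) ->
  acyclic e (escaping T B).
Proof.
have [m] := ubnP #|B|; elim: m T B => // m IH T B hm hA nR.
have [B0|/set0Pn [S SB]] := eqVneq B set0.
  rewrite B0 setU0 in hA nR *; have /set0Pn [P PX] := above_nonempty hA nR.
  apply: (@eq_acyclic _ _ _ (fun W => W \subset above T)); last exact: (acyclic_simplex se PX).
  by move=> W; rewrite /escaping; case: (W \subset _) => //=; apply/esym/forall_inP => S; rewrite inE.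
rewrite -(setD1K SB) in hA nR *; move: hm; rewrite (cardsD1 S) SB ltnS => hm.
have sub : T :|: B :\ S \subset T :|: (S |: B :\ S) by apply: setUS; apply: subsetUr.
apply: escaping_step; first by rewrite !inE eqxx.
  apply: IH => //; first exact: subset_trans sub hA.
  by apply: contra nR => h; apply: subset_trans h sub.
by apply: IH => //; rewrite -setUA setUCA.
Qed.

(** The members of B lying in R are moved away first; at least one member of B remains. If then R is
    inside T, no chart is available, and the empty W does not escape the remaining member. Otherwise
    R is not inside T :|: B, as B no longer meets R. *)
Lemma escaping_acyclic2 T B : T :|: B \subset A -> ~~ (B \subset R) ->
  acyclic e (escaping T B).
Proof.
have [m] := ubnP #|B :&: R|; elim: m T B => // m IH T B hm hA nR.
have [S1 S1B S1R] := subsetPn nR.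
have [B0|/set0Pn [S]] := eqVneq (B :&: R) set0.
  have [RT|nRT] := boolP (R \subset T).
    apply: acyclic_empty => W; apply/negP => /andP[].
    rewrite above_empty // ?subset0; last exact: subset_trans (subsetUl _ _) hA.
    by move=> /eqP -> /forall_inP /(_ _ S1B); rewrite sub0set.
  apply: escaping_acyclic1 => //; apply: contra nRT => /subsetP h.
  apply/subsetP => S SR; have := h S SR; rewrite inE => /orP[//|SB].
  by move/setP/(_ S): B0; rewrite !inE SB SR.
rewrite inE => /andP[SB SR].
have nR' : ~~ (B :\ S \subset R).
  by apply/subsetPn; exists S1 => //; rewrite !inE S1B andbT; apply: contraNneq S1R => ->.
have hm' : (#|(B :\ S) :&: R| < m)%N.
  rewrite -ltnS; apply: leq_trans hm; rewrite ltnS; apply/proper_card/properP; split.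
    by apply: setSI; apply: subsetDl.
  by exists S; rewrite !inE ?SB ?SR ?eqxx.
rewrite -(setD1K SB); apply: escaping_step; first by rewrite !inE eqxx.
  by apply: IH => //; apply: subset_trans hA; apply: setUS; apply: subsetDl.
apply: IH => //; rewrite -setUA setUCA setUA -setUA.
by rewrite setD1K.
Qed.

Lemma escaping_acyclic B : B \subset A -> R \subset A -> B != R -> acyclic e (escaping set0 B).
Proof.
move=> BA RA BR; have [h|h] := boolP (B \subset R).
  apply: escaping_acyclic1; rewrite set0U //.
  by apply: contra BR => h2; rewrite eqEsubset h h2.
by apply: escaping_acyclic2; rewrite ?set0U.
Qed.

End Nerve.

(** * Shelling of the braid fan *)

Section Shelling.
Variables (n : nat) (xi : 'I_n -> int).
Hypothesis xi_inj : injective xi.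
Implicit Types (s : seq 'I_n) (F G : chart n) (S : {set 'I_n}) (T : {set {set 'I_n}}).

Lemma mem_prefix s k x : ordering s -> (x \in prefix_set s k) = (index x s < k)%N.
Proof. by move=> hs; rewrite inE in_take ?ordering_mem. Qed.

Definition weight S : int := \sum_(i in S) xi i.

(* The charts are shelled in the order of increasing height. *)
Definition height T : int := \sum_(S in T) weight S.

Lemma heightE s : ordering s ->
  height (flag_of s) = \sum_(k < n | (0 < k)%N) weight (prefix_set s k).
Proof.
move=> hs; rewrite /height big_imset /=; first by apply: eq_bigl => k; rewrite inE.
have /andP[us /eqP sz] := hs.
move=> k l _ _ E; apply: val_inj => /=.
rewrite -(card_prefix us (k := k)) ?sz; last by rewrite ltnW.
by rewrite E card_prefix // sz ltnW.
Qed.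

(** The restriction set of the chart in the shelling: for T inside [val F], a chart of smaller
    height contains T unless T contains all descents of F. *)
Definition descents F : {set {set 'I_n}} :=
  [set prefix_set (chart_seq F) a | a : 'I_n &
    (0 < a)%N && (xi (nth a (chart_seq F) a) < xi (nth a (chart_seq F) a.-1))].

Lemma descents_sub F : descents F \subset val F.
Proof.
apply/subsetP => S /imsetP [a]; rewrite inE => /andP[a0 _] ->.
by rewrite -flag_of_chart_seq; apply/flag_ofP; exists a; rewrite ?a0 /=.
Qed.

Lemma swap_prefix s1 (x y : 'I_n) s2 k : k != (size s1).+1 ->
  prefix_set (s1 ++ x :: y :: s2) k = prefix_set (s1 ++ y :: x :: s2) k.
Proof.
move=> ne; apply/setP => z; rewrite !inE !take_cat.
case: ltnP => // h; rewrite !mem_cat; congr (_ || _).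
case E: (k - size s1)%N => [|[|j]] //=; last by rewrite !inE orbCA.
by move/eqP: ne; case; rewrite -(subnK h) E.
Qed.

Lemma swap_ordering s1 x y s2 : ordering (s1 ++ x :: y :: s2) ->
  ordering (s1 ++ y :: x :: s2).
Proof.
rewrite /ordering !size_cat /= => /andP[us ->]; rewrite andbT -(perm_uniq (s1 := s1 ++ x :: y :: s2)) //.
by rewrite perm_cat2l; apply/permPl; apply: (perm_catCA [:: x] [:: y] s2).
Qed.

(** Swapping the adjacent pair separated by S changes no prefix but S, where the larger value of the
    pair is replaced by the smaller one. *)
Lemma descent_lower F S T : T \subset val F -> S \in descents F -> S \notin T ->
  exists2 G : chart n, T \subset val G & height (val G) < height (val F).
Proof.
move=> TF /imsetP [a]; rewrite inE => /andP[a0 lt] ES ST.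
have hs := chart_seqP F; set s := chart_seq F in lt ES hs.
have /andP[us /eqP sz] := hs.
have an : (a < size s)%N by rewrite sz.
have a1n : (a.-1 < size s)%N by apply: leq_ltn_trans an; apply: leq_pred.
set x := nth a s a.-1 in lt; set y := nth a s a in lt.
pose s1 := take a.-1 s; pose s2 := drop a.+1 s.
have sE : s = s1 ++ x :: y :: s2.
  rewrite -[LHS](cat_take_drop a.-1) (drop_nth a) // (drop_nth a (n := a.-1.+1)) prednK //.
have szs1 : (size s1).+1 = a by rewrite size_takel ?prednK // ltnW.
have hs' : ordering (s1 ++ y :: x :: s2) by apply: swap_ordering; rewrite -sE.
exists (chart_of hs').
  apply/subsetP => S' S'T; have := subsetP TF _ S'T.
  rewrite -flag_of_chart_seq -/s => /flag_ofP [k kn ES'].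
  apply/flag_ofP; exists k => //; rewrite ES' sE swap_prefix // szs1.
  by apply: contraNneq ST => E; rewrite ES -E -ES'.
rewrite -[val F]flag_of_chart_seq -/s !heightE // (bigD1 a) //= [X in _ < X](bigD1 a) //=.
rewrite (eq_bigr (fun k : 'I_n => weight (prefix_set s k))); last first.
  by move=> k /andP[_ ka]; rewrite sE swap_prefix // szs1.
rewrite ltrD2r -szs1.
have nx z z' s3 : uniq (s1 ++ z :: z' :: s3) ->
    weight (prefix_set (s1 ++ z :: z' :: s3) (size s1).+1) = xi z + \sum_(i in [set j in s1]) xi i.
  move=> u; have z1 : z \notin s1 by move: u; rewrite cat_uniq /= negb_or => /and3P[_ /andP[]].
  have -> : prefix_set (s1 ++ z :: z' :: s3) (size s1).+1 = z |: [set j in s1].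
    apply/setP => j; rewrite !inE -cat_rcons take_size_cat ?size_rcons //.
    by rewrite mem_rcons inE.
  by rewrite /weight big_setU1 // inE.
rewrite nx; last by case/andP: hs'.
by rewrite sE nx ?ltrD2r // -sE.
Qed.

Lemma increasing_between F T x y : descents F \subset T ->
  (index x (chart_seq F) < index y (chart_seq F))%N ->
  (forall S, S \in T -> x \in S -> y \in S) -> xi x < xi y.
Proof.
move=> dT; have hs := chart_seqP F; have us := chart_seq_uniq F; have sz := size_chart_seq F.
set s := chart_seq F in hs us sz * => xy hT.
have nT k : (index x s < k)%N -> (k <= index y s)%N -> prefix_set s k \notin T.
  move=> xk ky; apply/negP => /hT; rewrite !mem_prefix // => /(_ xk).
  by rewrite ltnNge ky.
have iy : (index y s < n)%N.
  have : (index y s < size s)%N by rewrite index_mem ordering_mem.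
  by rewrite sz.
rewrite -(nth_index x (ordering_mem hs y)); move: iy nT xy; move: (index y s) => b.
elim: b => // b IH bn nT; rewrite ltnS => xb.
have step : xi (nth x s b) < xi (nth x s b.+1).
  have : prefix_set s b.+1 \notin descents F by apply: contra (nT b.+1 xb (leqnn _)); apply: (subsetP dT).
  apply: contraNT; rewrite -leNgt => le; apply/imsetP; exists (Ordinal bn) => //=.
  rewrite inE /= !(set_nth_default x) ?sz // 1?ltnW // lt_neqAle le andbT.
  by rewrite (inj_eq xi_inj) nth_uniq ?sz // ?gtn_eqF // ltnW.
move: xb; rewrite leq_eqVlt => /orP[/eqP E|xb].
  by move: step; rewrite -E nth_index ?ordering_mem.
apply: lt_trans step; apply: IH => //; first exact: ltnW.
by move=> k xk kb; apply: nT => //; apply: leqW.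
Qed.

(** Both orderings list the blocks cut out by T in the same order and the elements inside each block
    increasingly. *)
Lemma descents_unique F G T : T \subset val F -> T \subset val G ->
  descents F \subset T -> descents G \subset T -> F = G.
Proof.
move=> TF TG dF dG; apply: chart_seq_inj.
have hF := chart_seqP F; have hG := chart_seqP G.
have pre (H : chart n) (S : {set 'I_n}) a b : S \in val H ->
   (index a (chart_seq H) <= index b (chart_seq H))%N -> b \in S -> a \in S.
  rewrite -flag_of_chart_seq => /flag_ofP [k _ ->] ab; rewrite !mem_prefix ?chart_seqP //.
  exact: leq_ltn_trans.
have lt a b : (index a (chart_seq F) < index b (chart_seq F))%N ->
    (index a (chart_seq G) < index b (chart_seq G))%N.
  move=> ab; rewrite ltnNge leq_eqVlt; apply/negP => /orP[/eqP E|ba].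
    have Eab : a = b by rewrite -(nth_index b (ordering_mem hG a)) -E nth_index ?ordering_mem.
    by move: ab; rewrite Eab ltnn.
  have h1 : xi a < xi b.
    apply: increasing_between dF ab _ => S ST; apply: (pre G); first exact: (subsetP TG).
    exact: ltnW.
  have h2 : xi b < xi a.
    apply: increasing_between dG ba _ => S ST; apply: (pre F); first exact: (subsetP TF).
    exact: ltnW.
  by move: (lt_trans h1 h2); rewrite ltxx.
pose r a b := (index a (chart_seq G) < index b (chart_seq G))%N.
apply: (@irr_sorted_eq _ r).
- by move=> a b c; apply: ltn_trans.
- by move=> a; rewrite /r ltnn.
- case: (chart_seq F) (chart_seqP F) lt => // x0 s hs lt.
  apply/(sortedP x0) => i hi; apply: lt.
  have /andP[us _] := hs; by rewrite !index_uniq // ltnW.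
- case: {-1}(chart_seq G) (erefl (chart_seq G)) => // x0 s E.
  apply/(sortedP x0) => i hi; rewrite /r E.
  have us := chart_seq_uniq G; rewrite E in us; by rewrite !index_uniq // ltnW.
by move=> a; rewrite !ordering_mem.
Qed.

(** By [descent_lower] a chart of least height among those containing T has all its descents in T,
    so by uniqueness it is F, and no other chart reaches the same height. *)
Lemma descents_min F G T : T \subset val F -> descents F \subset T -> T \subset val G ->
  G != F -> height (val F) < height (val G).
Proof.
move=> TF dF; case: (@arg_minP _ _ _ F (fun G : chart n => T \subset val G) (fun G : chart n => height (val G)) TF) => H TH minH TG GF.
have mind (G' : chart n) : T \subset val G' -> height (val G') <= height (val H) -> descents G' \subset T.
  move=> TG' le; apply/subsetP => S SG; apply/negPn/negP => ST.
  have [G2 TG2 lt] := descent_lower TG' SG ST.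
  by have := minH _ TG2; rewrite leNgt (lt_le_trans lt le).
have EH : H = F by apply: (descents_unique TH TF) => //; apply: mind.
rewrite ltNge; apply: contra GF; rewrite -EH => le.
by apply/eqP; apply: (descents_unique TG TH); apply: mind.
Qed.

End Shelling.

(** * Graded pieces of the Cech complex *)

Section WeightExact.
Variables (k : fieldType) (n : nat) (I : finType).
Variables (gam : chart n -> chart n -> I -> I -> k) (wt : chart n -> I -> lattice n).
Hypothesis gam_id : forall F i j, gam F F i j = (i == j)%:R.
Hypothesis gam_comp : forall F G P i l, \sum_j gam F G i j * gam G P j l = gam F P i l.
Hypothesis gam_reg : forall F G i j, gam F G i j != 0 ->
  dual_cone (val F :&: val G) (wt F i - wt G j).
Variable m : lattice n.

Local Notation family := ({set chart n} -> chart n -> I -> k).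
Implicit Types (W X : {set chart n}) (F G P : chart n) (phi psi : family).

Definition compat phi := forall W F G i, phi W F i = \sum_j gam F G i j * phi W G j.

(* The part of weight m of a Cech cochain: phi W F i is the coefficient of
   x^(wt F i + m) in its value at (W, F, i). *)
Definition weight_family phi :=
  [/\ forall F i, phi set0 F i = 0, compat phi
    & forall W F i, F \in W -> phi W F i != 0 -> dual_cone (common W) (wt F i + m)].

Definition fam_diff phi : family :=
  fun W F i => cobord (@cech_sign (chart n) k) (fun W => phi W F i) W.

Lemma fam_diff_compat phi : compat phi -> compat (fam_diff phi).
Proof.
move=> h W F G i; rewrite /fam_diff /cobord.
under eq_bigr do rewrite (h _ F G) mulr_sumr.
rewrite exchange_big /=; apply: eq_bigr => j _; rewrite mulr_sumr.
by apply: eq_bigr => P _; rewrite mulrCA.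
Qed.

Lemma common_sub W F : F \in W -> common W \subset val F.
Proof. by move=> FW; apply: (bigcap_inf F). Qed.

Lemma common_anti W W' : W' \subset W -> common W \subset common W'.
Proof. by move=> h; apply/bigcapsP => F /(subsetP h); apply: common_sub. Qed.

Lemma gam_dual W F G i j x : F \in W -> G \in W -> gam F G i j != 0 ->
  dual_cone (common W) (wt G j + x) -> dual_cone (common W) (wt F i + x).
Proof.
move=> FW GW g h; have -> : wt F i + x = (wt F i - wt G j) + (wt G j + x) by rewrite addrA subrK.
apply: dual_coneD h; apply: dual_cone_sub (gam_reg g).
by rewrite subsetI !common_sub.
Qed.

Lemma fam_diff_family phi : weight_family phi -> weight_family (fam_diff phi).
Proof.
move=> [h0 hc hs]; split.
- by move=> F i; rewrite /fam_diff /cobord big_set0.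
- exact: fam_diff_compat.
move=> W F i FW; apply: contraNT => nd; rewrite /fam_diff; apply/eqP; apply: cobord0 => P PW.
have [W0|/set0Pn [G GW]] := eqVneq (W :\ P) set0; first by rewrite W0 h0.
rewrite (hc _ F G) big1 // => j _; apply/eqP; apply: contraNT nd.
rewrite mulf_eq0 negb_or => /andP[g f].
move: (GW); rewrite inE => /andP[_ GW'].
apply: gam_dual g _ => //; apply: dual_cone_sub (hs _ _ _ GW f).
by apply: common_anti; apply: subsetDl.
Qed.

Definition bad F i : {set {set 'I_n}} := [set S in val F | pairing (wt F i + m) S < 0].

Variable xi : 'I_n -> int.
Hypothesis xi_inj : injective xi.
Hypothesis bad_descents : forall F i, pairing (wt F i + m) setT = 0 ->
  bad F i != descents xi F.

(** The change of sign of the face at Q caused by adding P: the position of Q shifts by one exactly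
    when P comes before Q. *)
Let sg (P Q : chart n) : k := (-1) ^+ (enum_rank P < enum_rank Q)%N.

Lemma cech_sign_cone P Q W : P \notin W -> Q \in W ->
  cech_sign k Q (P |: W) = cech_sign k Q W * sg P Q.
Proof.
move=> PW QW; rewrite /cech_sign !index_enum_card // ?inE ?QW ?orbT //.
rewrite -exprD; congr (_ ^+ _).
rewrite (cardsD1 P) addnC !inE eqxx /=; congr (_ + _)%N; congr #|pred_of_set _|.
by apply/setP => z; rewrite !inE; have [->|//] := eqVneq z P; rewrite (negbTE PW).
Qed.

Lemma sign_rule_cone P : sign_rule (fun Q W => cech_sign k Q W * sg P Q).
Proof.
have [sq anti] := cech_sign_rule (chart n) k; split=> [Q W|Q Q' W QW Q'W QQ'].
  by rewrite mulrACA sq mul1r /sg -expr2 sqrr_sign.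
by rewrite mulrACA anti // mulNr [sg P Q * _]mulrC [in RHS]mulrACA.
Qed.

Definition low_closed X := forall F G, F \in X -> height xi (val G) < height xi (val F) -> G \in X.

Lemma bad_escaping X P i : P \in X -> low_closed X ->
  (forall G, G \in X -> height xi (val G) <= height xi (val P)) ->
  pairing (wt P i + m) setT = 0 ->
  acyclic (fun Q W => cech_sign k Q W * sg P Q)
    (escaping (fun (S : {set 'I_n}) (F : chart n) => S \in val F) (X :\ P) set0 (bad P i)).
Proof.
move=> PX lX maxP sum0.
apply: (@escaping_acyclic _ _ _ _ _ (sign_rule_cone P) _ (descents xi P) (val P)).
- move=> T TP /subsetPn [S SR ST].
  have [G TG lt] := descent_lower TP SR ST.
  apply/set0Pn; exists G; rewrite !inE (lX _ _ PX lt) andbT.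
  have -> /= : G != P by apply: contraTneq lt => ->; rewrite ltxx.
  by apply/forall_inP => S' /(subsetP TG).
- move=> T TP RT; apply/setP => G; rewrite !inE; apply/negP => /andP[/andP[GP GX] /forall_inP h].
  have TG : T \subset val G by apply/subsetP => S /h.
  by have := descents_min xi_inj TP RT TG GP; rewrite ltNge maxP.
- by apply/subsetP => S; rewrite inE => /andP[].
- exact: descents_sub.
exact: bad_descents.
Qed.

(** As phi vanishes on sets without P, its values on the sets [P |: W], read in the frame of P, form
    for each i a cocycle with twisted signs on the W escaping [bad P i]. A primitive exists by the
    shelling; transported to the other frames by gam it is the required psi. *)
Lemma weight_exact_step X P phi : weight_family phi -> P \in X -> low_closed X ->
  (forall G, G \in X -> height xi (val G) <= height xi (val P)) ->
  (forall W F i, W \subset X :\ P -> phi W F i = 0) ->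
  (forall W F i, W \subset X -> fam_diff phi W F i = 0) ->
  exists2 psi, weight_family psi & forall W F i, W \subset X -> fam_diff psi W F i = phi W F i.
Proof.
move=> [phi0 phic phis] PX lX maxP van dphi; set Y := X :\ P.
have YX W : W \subset Y -> W \subset X by move=> h; apply: subset_trans h (subsetDl _ _).
have PY W : W \subset Y -> P \notin W.
  by move=> h; apply/negP => /(subsetP h); rewrite !inE eqxx.
pose e1 := fun Q W => cech_sign k Q W * sg P Q.
pose good_i i W := (pairing (wt P i + m) setT == 0) &&
   escaping (fun (S : {set 'I_n}) (F : chart n) => S \in val F) Y set0 (bad P i) W.
pose f i W := if W \subset Y then phi (P |: W) P i else 0.
have aboveY : above (fun (S : {set 'I_n}) (F : chart n) => S \in val F) Y set0 = Y.
  by apply/setP => F; rewrite !inE (_ : [forall S in set0, _]) ?andbT //; apply/forall_inP => S; rewrite inE.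
have aboveS S : above (fun (S : {set 'I_n}) (F : chart n) => S \in val F) Y [set S] = [set F in Y | S \in val F].
  apply/setP => F; rewrite !inE; congr (_ && _); apply/forall_inP/idP => [h|h S']; first by apply: h; rewrite inE.
  by rewrite inE => /eqP ->.
have good_dual i W : good_i i W -> dual_cone (common (P |: W)) (wt P i + m).
  case/andP=> s0 /andP[WY /forall_inP hb]; rewrite aboveY in WY.
  rewrite /dual_cone s0; apply/forall_inP => S SW; rewrite leNgt; apply/negP => neg.
  have SP : S \in val P by apply: (subsetP (common_sub (setU11 _ _)) _ SW).
  have /hb : S \in bad P i by rewrite inE SP.
  move=> /subsetPn [F FW]; rewrite aboveS inE (subsetP WY) //= => /negP; apply.
  by apply: (subsetP (common_sub (_ : F \in P |: W)) _ SW); rewrite inE FW orbT.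
have up i W Q : W \subset Y -> good_i i (W :\ Q) -> good_i i W.
  move=> WY /andP[s0 /andP[_ /forall_inP hb]]; rewrite /good_i s0 /escaping aboveY WY /=.
  by apply/forall_inP => S /hb; apply: contra; apply: subset_trans; apply: subsetDl.
have fsupp i W : ~~ good_i i W -> f i W = 0.
  rewrite /f; case: ifP => // WY; apply: contraNeq => /(phis _ _ _ (setU11 _ _)) hd.
  have /andP[s0 /forall_inP hd'] := hd; rewrite /good_i s0 /escaping aboveY WY /=.
  apply/forall_inP => S; rewrite inE => /andP[SP neg]; apply/negP => /subsetP h.
  have : S \in common (P |: W).
    apply/bigcapP => F; rewrite !inE => /orP[/eqP -> //|/h]; rewrite aboveS inE => /andP[] //.
  by move/hd'; rewrite leNgt neg.
have cone_diff chi W i : W \subset Y -> fam_diff chi (P |: W) P i =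
    cech_sign k P (P |: W) * chi W P i + cobord e1 (fun W => chi (P |: W) P i) W.
  move=> WY; have PW := PY _ WY; rewrite /fam_diff /cobord big_setU1 //= setU1K //; congr (_ + _).
  apply: eq_bigr => Q QW; rewrite cech_sign_cone //; congr (_ * chi _ _ _).
  by apply/setP => z; rewrite !inE; have [->|//] := eqVneq z P; rewrite (contraNneq _ PW) // => ->.
have df i W : W \subset Y -> cobord e1 (f i) W = 0.
  move=> WY; have := cone_diff phi W i WY.
  rewrite dphi ?van // ?mulr0 ?add0r; last by rewrite subUset sub1set PX YX.
  move=> h; rewrite h; apply: eq_cobord => Q QW.
  by rewrite /f (subset_trans (subsetDl _ _) WY).
have [g g0 dg] : exists2 g : I -> {set chart n} -> k,
    forall i, forall W, ~~ good_i i W -> g i W = 0 &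
    forall i W, W \subset Y -> cobord e1 (g i) W = f i W.
  apply: (@fin_all_exists2 _ _ (fun i g => forall W, ~~ good_i i W -> g W = 0)
    (fun i g => forall W, W \subset Y -> cobord e1 g W = f i W)) => i.
  have [s0|s0] := boolP (pairing (wt P i + m) setT == 0); last first.
    exists (fun _ => 0) => // W WY; rewrite fsupp ?cobord0 //.
    by rewrite /good_i (negbTE s0).
  have [W h|W h|g g0 dg] := bad_escaping PX lX maxP (eqP s0) (f := f i).
  - by apply: fsupp; rewrite /good_i s0.
  - by apply: df; case/andP: h; rewrite aboveY.
  exists g => [W|W WY]; first by rewrite /good_i s0 => /g0.
  have [gd|ngd] := boolP (good_i i W); first by apply: dg; case/andP: gd.
  rewrite fsupp // cobord0 // => Q QW; apply: g0; apply: contra ngd => h.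
  by apply: (up i W Q WY); rewrite /good_i s0.
pose psi : family := fun W F i =>
  if (P \in W) && (W :\ P \subset Y) then \sum_j gam F P i j * g j (W :\ P) else 0.
have psiP W i : W \subset Y -> psi (P |: W) P i = g i W.
  move=> WY; rewrite /psi setU11 (setU1K (PY _ WY)) WY /=.
  rewrite (bigD1 i) //= gam_id eqxx mul1r big1 ?addr0 // => j ji.
  by rewrite gam_id eq_sym (negbTE ji) mul0r.
have psi_out W F i : P \notin W -> psi W F i = 0 by move=> h; rewrite /psi (negbTE h).
have psic : compat psi.
  move=> W F G i; rewrite /psi; case: ifP => _; last by rewrite big1 // => j _; rewrite mulr0.
  under [RHS]eq_bigr do rewrite mulr_sumr.
  rewrite exchange_big /=; apply: eq_bigr => l _.
  by rewrite -(gam_comp F G P i l) mulr_suml; apply: eq_bigr => j _; rewrite mulrA.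
have psif : weight_family psi.
  split=> // [F i|W F i FW]; first by rewrite psi_out ?inE.
  rewrite /psi; case: ifP => [/andP[PW WY]|]; last by rewrite eqxx.
  apply: contraNT => nd; rewrite big1 // => j _; apply/eqP; apply: contraNT nd.
  rewrite mulf_eq0 negb_or => /andP[gm gj].
  apply: gam_dual gm _ => //; rewrite -(setD1K PW); apply: good_dual.
  by apply: contraNT gj => /g0 ->.
exists psi => // W F i WX; have [PW|PW] := boolP (P \in W); last first.
  have WY : W \subset Y by rewrite subsetD1 WX.
  rewrite van // /fam_diff cobord0 // => Q _; rewrite psi_out // !inE negb_and PW orbT //.
have WY : W :\ P \subset Y by apply: setSD.
rewrite (fam_diff_compat psic W F P) (phic W F P); apply: eq_bigr => j _; congr (_ * _).
rewrite -(setD1K PW) cone_diff // psi_out ?mulr0 ?add0r; last exact: PY.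
transitivity (cobord e1 (g j) (W :\ P)); last by rewrite dg // /f WY.
by apply: eq_cobord => Q _; rewrite psiP // (subset_trans (subsetDl _ _)).
Qed.

Lemma weight_familyB phi psi : weight_family phi -> weight_family psi ->
  weight_family (fun W F i => phi W F i - psi W F i).
Proof.
move=> [h0 hc hs] [h0' hc' hs']; split.
- by move=> F i; rewrite h0 h0' subrr.
- move=> W F G i; rewrite (hc W F G) (hc' W F G) -sumrB.
  by apply: eq_bigr => j _; rewrite mulrBr.
move=> W F i FW; have [->|/(hs _ _ _ FW) //] := eqVneq (phi W F i) 0.
by rewrite sub0r oppr_eq0 => /(hs' _ _ _ FW).
Qed.

Lemma fam_diffB phi psi W F i :
  fam_diff (fun W F i => phi W F i - psi W F i) W F i = fam_diff phi W F i - fam_diff psi W F i.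
Proof. exact: cobordB. Qed.

Lemma fam_diff_sq phi W F i : fam_diff (fam_diff phi) W F i = 0.
Proof. exact: (cobord_cobord (cech_sign_rule _ _)). Qed.

(** Charts are added in the order of the shelling. The differential of a primitive on X without its
    highest chart P is subtracted, so that the remainder vanishes on sets without P. *)
Lemma weight_exact_low X phi : low_closed X -> weight_family phi ->
  (forall W F i, fam_diff phi W F i = 0) ->
  exists2 psi, weight_family psi & forall W F i, W \subset X -> fam_diff psi W F i = phi W F i.
Proof.
move=> + fphi dphi; have [N] := ubnP #|X|; elim: N X => // N IH X hN lX.
have [X0|/set0Pn [P0 P0X]] := eqVneq X set0.
  exists (fun _ _ _ => 0).
    split=> // [W F G i|W F i _]; last by rewrite eqxx.
    by rewrite big1 // => j _; rewrite mulr0.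
  move=> W F i; rewrite X0 subset0 => /eqP ->; case: fphi => -> _ _.
  by rewrite /fam_diff cobord0.
case: (@arg_maxP _ _ _ P0 (fun G => G \in X) (fun G : chart n => height xi (val G)) P0X) => P PX maxP.
have [|F G|psi1 f1 d1] := IH (X :\ P).
- by move: hN; rewrite (cardsD1 P X) PX.
- rewrite !inE => /andP[FP FX] lt; rewrite (lX _ _ FX lt) andbT.
  by apply: contraTneq lt => ->; rewrite -leNgt; apply: maxP.
have f2 := weight_familyB fphi (fam_diff_family f1).
have [//|W F i WX|W F i WX|psi2 g2 d2] := weight_exact_step f2 PX lX.
- by rewrite d1 // subrr.
- by rewrite fam_diffB dphi fam_diff_sq subrr.
(* This is psi2 + psi1, written as a difference for [weight_familyB]. *)
exists (fun W F i => psi2 W F i - (- psi1 W F i)).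
  apply: weight_familyB => //; case: f1 => h0 hc hs; split.
  - by move=> F i; rewrite h0 oppr0.
  - by move=> W F G i; rewrite (hc W F G) -sumrN; apply: eq_bigr => j _; rewrite mulrN.
  by move=> W F i FW; rewrite oppr_eq0; apply: hs.
move=> W F i WX; rewrite fam_diffB d2 //.
have -> : fam_diff (fun W F i => - psi1 W F i) W F i = - fam_diff psi1 W F i.
  by rewrite /fam_diff /cobord -sumrN; apply: eq_bigr => Q _; rewrite mulrN.
by rewrite opprK subrK.
Qed.

Theorem weight_exact phi : weight_family phi -> (forall W F i, fam_diff phi W F i = 0) ->
  exists2 psi, weight_family psi & forall W F i, fam_diff psi W F i = phi W F i.
Proof.
move=> fphi dphi; have [|psi fpsi h] := @weight_exact_low setT phi _ fphi dphi.
  by move=> *; rewrite inE.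
by exists psi => // W F i; apply: h; apply: subsetT.
Qed.

End WeightExact.

(** * Boundedness of the weights that are not exact *)

Section Box.
Variable n : nat.
Implicit Types (x m : lattice n).

Lemma abel_sum (f A : nat -> int) N : (0 < N)%N ->
  \sum_(0 <= i < N) f i * (A i.+1 - A i) =
  f N.-1 * A N - f 0%N * A 0%N + \sum_(0 <= i < N.-1) A i.+1 * (f i - f i.+1).
Proof.
case: N => // N _ /=; elim: N => [|N IH]; first by rewrite big_nat1 big_geq //; ring.
by rewrite big_nat_recr //= IH [in RHS]big_nat_recr //=; ring.
Qed.

Lemma pairing_prefix_succ x s j : ordering s ->
  x j = pairing x (prefix_set s (index j s).+1) - pairing x (prefix_set s (index j s)).
Proof.
move=> hs; rewrite /pairing.
have -> : prefix_set s (index j s).+1 = j |: prefix_set s (index j s).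
  apply/setP => y; rewrite in_setU1 !mem_prefix // ltnS leq_eqVlt; congr (_ || _).
  apply/eqP/eqP => [E|-> //].
  by rewrite -(nth_index j (ordering_mem hs y)) E nth_index ?ordering_mem.
by rewrite big_setU1 ?mem_prefix ?ltnn //= addrK.
Qed.

(** Let A_k be the values of x on the prefixes. Abel summation writes the pairing of xi with x as
    the sum of A_k times the drop of xi at k. A_k is negative exactly at descents, where the drop is
    positive, and drops of an injective integral xi are at least 1 in absolute value; so each term
    is at most -|A_k|. A coordinate of x is a difference of two A_k, whence the factor 2. *)
Lemma pairing_bound xi x (F : chart n) : injective xi -> pairing x setT = 0 ->
  [set S in val F | pairing x S < 0] = descents xi F ->
  forall j, `|x j| <= - (\sum_i xi i * x i) *+ 2.
Proof.
move=> xi_inj x0 hb j; have hs := chart_seqP F; have us := chart_seq_uniq F; have sz := size_chart_seq F.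
set s := chart_seq F in hs us sz.
pose A k := pairing x (prefix_set s k).
have A0 : A 0%N = 0 by rewrite /A /prefix_set take0 set_in_nil /pairing big_set0.
have An k : (n <= k)%N -> A k = 0 by move=> h; rewrite /A prefix_setT.
pose f k := xi (nth j s k).
have n0 : (0 < n)%N by apply: leq_ltn_trans (ltn_ord j).
pose T := \sum_(0 <= k < n.-1) `|A k.+1|.
have sumE : \sum_i xi i * x i = \sum_(0 <= k < n.-1) A k.+1 * (f k - f k.+1).
  have -> : \sum_i xi i * x i = \sum_(0 <= k < n) f k * (A k.+1 - A k).
    transitivity (\sum_(i <- s) xi i * x i).
      by rewrite (perm_big _ (ordering_perm hs)) big_enum.
    rewrite (big_nth j) sz !big_nat; apply: eq_bigr => k /= kn; congr (_ * _).
    by rewrite (pairing_prefix_succ x _ hs) index_uniq // sz.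
  by rewrite abel_sum // A0 An // !mulr0 subrr add0r.
have TE : T <= - (\sum_i xi i * x i).
  rewrite sumE -sumrN /T !big_nat; apply: ler_sum => k /= kn.
  have kn' : (k.+1 < n)%N by rewrite -(prednK n0) ltnS.
  have SF : prefix_set s k.+1 \in val F.
    by rewrite -flag_of_chart_seq; apply/flag_ofP; exists k.+1.
  have card_pre l : (l <= n)%N -> #|prefix_set s l| = l by move=> h; rewrite card_prefix ?sz.
  have ne : f k != f k.+1.
    by rewrite /f (inj_eq xi_inj) nth_uniq ?sz // ?ltn_eqF // ltnW.
  have [neg|pos] := ltP (A k.+1) 0.
    have : prefix_set s k.+1 \in descents xi F by rewrite -hb inE SF.
    case/imsetP => a; rewrite inE => /andP[a0 lt] Ea.
    have E : a = k.+1 :> nat by rewrite -(card_pre a) ?(ltnW (ltn_ord a)) // -/s -Ea card_pre // ltnW.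
    have {}lt : f k.+1 < f k.
      by move: lt; rewrite E /= /f !(set_nth_default j) -/s ?sz // ltnW.
    rewrite ltr0_norm // lerN2 -[leRHS]mulr1 -subr_ge0 -mulrBr; apply: mulr_le0; first exact: ltW.
    by rewrite subr_le0 -[1]add0r lezD1 subr_gt0.
  have : prefix_set s k.+1 \notin descents xi F by rewrite -hb inE SF /= -leNgt.
  move=> nd; have le : f k <= f k.+1.
    rewrite leNgt; apply: contra nd => lt; apply/imsetP; exists (Ordinal kn') => //=.
    by rewrite inE /= !(set_nth_default j) -/s ?sz // ltnW.
  rewrite ger0_norm // -mulrN opprB -[leLHS]mulr1; apply: ler_wpM2l => //.
  by rewrite -[1]add0r lezD1 subr_gt0 lt_neqAle ne.
have bound k : `|A k| <= - (\sum_i xi i * x i).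
  apply: le_trans TE; have [nk|kn] := leqP n k.
    by rewrite An // normr0 /T sumr_ge0.
  case: k kn => [|k] kn; first by rewrite A0 normr0 /T sumr_ge0.
  rewrite /T (bigD1_seq k) /= ?iota_uniq ?mem_index_iota //=; last by rewrite -ltnS prednK.
  by rewrite lerDl sumr_ge0.
rewrite (pairing_prefix_succ x j hs) mulr2n.
by apply: le_trans (ler_normB _ _) _; apply: lerD; apply: bound.
Qed.

Definition box (K : nat) : seq (lattice n) :=
  undup [seq [ffun i => (f i : nat)%:Z - K%:Z] | f : {ffun 'I_n -> 'I_(K + K).+1}].

Lemma mem_box K m : (forall j, `|m j| <= K%:Z) -> m \in box K.
Proof.
move=> h; rewrite mem_undup; apply/mapP.
exists [ffun j => inord (absz (m j + K%:Z)%R)]; first by rewrite mem_enum.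
have ge j : 0 <= m j + K%:Z by have := h j; rewrite ler_norml => /andP[+ _]; rewrite -subr_ge0 opprK addrC.
apply/ffunP => j; rewrite !ffunE inordK ?gez0_abs ?ge // ?addrK //.
rewrite ltnS -lez_nat gez0_abs ?ge // PoszD lerD2r.
by have := h j; rewrite ler_norml => /andP[].
Qed.

Variables (I : finType) (wt : chart n -> I -> lattice n).

(** Suppose both [x1] and its negative fail, at weights w1 and w2. Then [pairing_bound] bounds the
    coordinates of w1 + m by -2 times the pairing of x1 with w1 + m, and also shows that x1 pairs
    nonnegatively with w2 + m. Adding this pairing cancels m from the bound. *)
Lemma bad_descents_bounded : exists K, forall m, m \notin box K ->
  exists2 xi : 'I_n -> int, injective xi &
  forall F i, pairing (wt F i + m) setT = 0 -> bad wt m F i != descents xi F.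
Proof.
pose B : int := \sum_F \sum_i \sum_j `|wt F i j|.
have B0 : 0 <= B by do 3! (apply: sumr_ge0 => ? _).
have wtB F i j : `|wt F i j| <= B.
  rewrite /B (bigD1 F) //= (bigD1 i) //= (bigD1 j) //= -!addrA lerDl.
  by rewrite !addr_ge0 //; do ?(apply: sumr_ge0 => ? _).
pose x1 (i : 'I_n) : int := i%:Z.
(* The sum bounds the pairing of [x1] with a difference of two frame weights, the outer factor 2 is
   that of [pairing_bound], and the last B pays for the passage from wt + m to m. *)
pose D : int := (\sum_i x1 i * (B *+ 2)) *+ 2 + B.
have D0 : 0 <= D by rewrite /D addr_ge0 // mulrn_wge0 // sumr_ge0 // => i _; rewrite mulr_ge0 // mulrn_wge0.
exists (absz D) => m mbox.
have inj1 : injective x1 by move=> i j /eqP; rewrite eqz_nat => /eqP/val_inj.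
have inj2 : injective (fun i => - x1 i) by move=> i j /oppr_inj/inj1.
have [/'forall_'forall_implyP h|] := boolP [forall F, forall i, (pairing (wt F i + m) setT == 0) ==> (bad wt m F i != descents x1 F)].
  by exists x1 => // F i /eqP; apply: h.
case/forallPn => F1 /forallPn [i1]; rewrite negb_imply negbK => /andP[/eqP s1 /eqP b1].
exists (fun i => - x1 i) => // F2 i2 s2; apply: contra mbox => /eqP b2.
have h1 := pairing_bound inj1 s1 b1; have h2 := pairing_bound inj2 s2 b2.
apply: mem_box => j; rewrite gez0_abs //.
have -> : m j = (wt F1 i1 + m) j - wt F1 i1 j by rewrite !ffunE addrAC subrr add0r.
apply: le_trans (ler_normB _ _) _; apply: lerD (wtB _ _ _); apply: le_trans (h1 j) _.
apply: ler_wMn2r; rewrite -sumrN.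
have c2 : 0 <= \sum_i x1 i * (wt F2 i2 + m) i.
  have := le_trans (normr_ge0 _) (h2 j); rewrite pmulrn_lge0 //.
  by under eq_bigr do rewrite mulNr; rewrite sumrN opprK.
rewrite -[leLHS]addr0; apply: le_trans (lerD (lexx _) c2) _; rewrite -big_split /=.
apply: ler_sum => i _; rewrite -mulrN -mulrDr; apply: ler_wpM2l => //.
have -> : - (wt F1 i1 + m) i + (wt F2 i2 + m) i = wt F2 i2 i - wt F1 i1 i by rewrite !ffunE; ring.
apply: le_trans (ler_norm _) _; apply: le_trans (ler_normB _ _) _.
by rewrite mulr2n lerD.
Qed.

End Box.

(** * Cech cohomology *)

Section CechWeights.
Variables (k : fieldType) (n : nat) (E : ebundle k n).
Hypothesis hE : is_ebundle E.

Local Notation I := (idx E).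
Local Notation w := (@wt k n E).
Local Notation rc := (@rconst k n).
Local Notation rm := (@rmonom k n).
Local Notation family := ({set chart n} -> chart n -> I -> k).
Implicit Types (F G P : chart n) (i j : I) (W : {set chart n}) (c : cech E) (m : lattice n).
Implicit Types phi psi : family.

Definition gam F G i j : k := lcoef (@trans k n E F G i j) (w F i - w G j).

Lemma transE F G i j : trans F G i j = rc (gam F G i j) * rm (w F i - w G j).
Proof. by have [a Ea] := proj2 hE F G i j; rewrite /gam {2}Ea lcoef_monom eqxx. Qed.

Lemma gam_id F i j : gam F F i j = (i == j)%:R.
Proof.
have [[_ h _] _] := hE; rewrite /gam h.
case: eqP => [->|_]; last by rewrite lcoef0.
have -> : (true%:R : ratfun k n) = rc 1 * rm 0 by rewrite rconst1 rmonom0 mulr1.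
by rewrite lcoef_monom subrr eqxx.
Qed.

Lemma gam_comp F G P i j : \sum_l gam F G i l * gam G P l j = gam F P i j.
Proof.
have [[_ _ h] _] := hE; apply: (@rconst_inj k n); apply: (mulIf (rmonom_neq0 k (w F i - w P j))).
rewrite -transE -(h F G P i j) rconst_sum mulr_suml; apply: eq_bigr => l _.
rewrite !transE rconstM (_ : w F i - w P j = (w F i - w G l) + (w G l - w P j)).
  by rewrite rmonomD; ring.
by rewrite addrA subrK.
Qed.

Lemma gam_reg F G i j : gam F G i j != 0 -> dual_cone (val F :&: val G) (w F i - w G j).
Proof. by have [[h _ _] _] := hE; have /regularP [_] := h F G i j; apply. Qed.

Local Notation wfam := (weight_family gam w).

Definition hat m c : family := fun W F i => lcoef (c (W, F, i)) (w F i + m).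

Definition lift_cech m phi : cech E := [ffun x => rc (phi x.1.1 x.1.2 x.2) * rm (w x.1.2 x.2 + m)].

Definition of_degree p phi := forall W F i, #|W| != p.+1 -> phi W F i = 0.

Definition laurent_cochain c := forall x, is_laur (c x).

Lemma is_cochain_laur p c : is_cochain p c -> laurent_cochain c.
Proof.
move=> hc [[W F] i]; have := hc W; case: ifP => [/eqP cW [h1 h2]|_ ->]; last exact: is_laur0.
have /set0Pn [G GW] : W != set0 by rewrite -card_gt0 cW.
rewrite (h1 F G); apply: is_laur_sum => j _; rewrite transE; apply: is_laur_scale.
by have /regularP [] := h2 G j GW.
Qed.

Lemma cochain_out p c W F i : is_cochain p c -> #|W| != p.+1 -> c (W, F, i) = 0.
Proof. by move=> /(_ W) + /negbTE h; rewrite h; apply. Qed.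

Lemma hat_degree p c m : is_cochain p c -> of_degree p (hat m c).
Proof. by move=> hc W F i h; rewrite /hat (cochain_out _ _ hc) // lcoef0. Qed.

Lemma hat_family p c m : is_cochain p c -> wfam m (hat m c).
Proof.
move=> hc; have lc := is_cochain_laur hc; split.
- by move=> F i; rewrite (hat_degree _ hc) // cards0.
- move=> W F G i; rewrite /hat; have := hc W; case: ifP => [_ [h1 _]|_ h0]; last first.
    by rewrite h0 lcoef0 big1 // => j _; rewrite h0 lcoef0 mulr0.
  rewrite (h1 F G) lcoef_sum; last by move=> j _; rewrite transE; apply: is_laur_scale.
  apply: eq_bigr => j _; rewrite transE lcoef_scale //; congr (_ * lcoef _ _).
  by rewrite opprB addrC addrA subrK.
move=> W F i FW; rewrite /hat; have := hc W; case: ifP => [_ [_ h2]|_ ->].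
  by have /regularP [_] := h2 F i FW; apply.
by rewrite lcoef0 eqxx.
Qed.

Lemma sign_rconst (a : nat) : (-1) ^+ a = rc ((-1) ^+ a) * rm 0.
Proof. by rewrite rmonom0 mulr1 /rconst !rmorphXn !rmorphN1. Qed.

Lemma hat_diff m c W F i : laurent_cochain c -> hat m (cech_diff c) W F i = fam_diff (hat m c) W F i.
Proof.
move=> lc; rewrite /hat ffunE /= lcoef_sum; last first.
  by move=> P _; rewrite sign_rconst; apply: is_laur_scale.
by apply: eq_bigr => P _; rewrite sign_rconst lcoef_scale // subr0.
Qed.

Lemma lift_laur m phi : laurent_cochain (lift_cech m phi).
Proof. by move=> x; rewrite ffunE; apply: is_laur_monom. Qed.

Lemma hat_lift m m' phi W F i : hat m' (lift_cech m phi) W F i = if m == m' then phi W F i else 0.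
Proof. by rewrite /hat ffunE lcoef_monom /= (inj_eq (addrI _)). Qed.

Lemma lift_cochain m p phi : wfam m phi -> of_degree p phi -> is_cochain p (lift_cech m phi).
Proof.
move=> [_ hc hs] hp W; case: ifP => [cW|/negbT nW]; last first.
  by move=> F i; rewrite ffunE /= hp // rconst0 mul0r.
split=> [F G i|F i FW]; rewrite ffunE /=.
  rewrite (hc W F G) rconst_sum mulr_suml; apply: eq_bigr => j _; rewrite transE ffunE /= rconstM.
  rewrite (_ : w F i + m = (w F i - w G j) + (w G j + m)); first by rewrite rmonomD; ring.
  by rewrite addrA subrK.
have [->|nz] := eqVneq (phi W F i) 0; first by rewrite rconst0 mul0r; apply: regular0.
by apply: regular_monom; apply: hs nz.
Qed.

Lemma cochain0 p : is_cochain p (0 : cech E).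
Proof.
move=> W; case: ifP => _; last by move=> F i; rewrite ffunE.
split=> [F G i|F i _]; first by rewrite ffunE big1 // => j _; rewrite ffunE mulr0.
by rewrite ffunE; apply: regular0.
Qed.

Lemma cochainD p c c' : is_cochain p c -> is_cochain p c' -> is_cochain p (c + c').
Proof.
move=> h h' W; have := h W; have := h' W; case: ifP => _; last first.
  by move=> e e' F i; rewrite ffunE e e' addr0.
move=> [a b] [a' b']; split=> [F G i|F i FW]; last by rewrite ffunE; apply: regularD; [apply: b'|apply: b].
rewrite ffunE (a F G) (a' F G) -big_split; apply: eq_bigr => j _.
by rewrite ffunE mulrDr.
Qed.

Lemma cochain_scale p a c : is_cochain p c -> is_cochain p (cech_scale a c).
Proof.
move=> h W; have := h W; case: ifP => _; last first.
  by move=> e F i; rewrite ffunE e mulr0.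
move=> [h1 h2]; split=> [F G i|F i FW].
  by rewrite ffunE (h1 F G) mulr_sumr; apply: eq_bigr => j _; rewrite ffunE mulrCA.
by rewrite ffunE; apply: regularM; [apply: regular_const|apply: h2].
Qed.

Lemma cech_scaleN1 c : cech_scale (-1) c = - c.
Proof. by apply/ffunP => x; rewrite !ffunE rconstN rconst1 mulN1r. Qed.

Lemma cochainN p c : is_cochain p c -> is_cochain p (- c).
Proof. by rewrite -cech_scaleN1; apply: cochain_scale. Qed.

Lemma cochain_sum p (J : Type) (r : seq J) (f : J -> cech E) :
  (forall y, is_cochain p (f y)) -> is_cochain p (\sum_(y <- r) f y).
Proof.
by move=> h; apply: (big_ind (is_cochain p)) => //; [apply: cochain0|apply: cochainD].
Qed.

Lemma cech_diff_is_zmod_morphism : zmod_morphism (@cech_diff k n E).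
Proof.
move=> c c'; apply/ffunP => x; rewrite !ffunE -sumrB; apply: eq_bigr => P _.
by rewrite !ffunE mulrBr.
Qed.
HB.instance Definition _ := GRing.isZmodMorphism.Build (cech E) (cech E) (@cech_diff k n E) cech_diff_is_zmod_morphism.

Lemma cech_diff_scale a c : cech_diff (cech_scale a c) = cech_scale a (cech_diff c).
Proof.
apply/ffunP => x; rewrite !ffunE mulr_sumr; apply: eq_bigr => P _.
by rewrite ffunE mulrCA.
Qed.

Lemma lift_diff m phi : cech_diff (lift_cech m phi) = lift_cech m (fam_diff phi).
Proof.
apply/ffunP => -[[W F] i]; rewrite !ffunE /= /fam_diff /cobord rconst_sum mulr_suml.
apply: eq_bigr => P _; rewrite ffunE /= rconstM mulrA; congr (_ * _ * _).
by rewrite /cech_sign sign_rconst rmonom0 mulr1.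
Qed.

Lemma cech_ext c c' : laurent_cochain c -> laurent_cochain c' ->
  (forall m W F i, hat m c W F i = hat m c' W F i) -> c = c'.
Proof.
move=> lc lc' h; apply/ffunP => -[[W F] i]; apply: lcoef_inj => // d.
by have := h (d - w F i) W F i; rewrite /hat addrC subrK.
Qed.

Lemma laurentD c c' : laurent_cochain c -> laurent_cochain c' -> laurent_cochain (c + c').
Proof. by move=> h h' x; rewrite ffunE; apply: is_laurD. Qed.

Lemma laurent0 : laurent_cochain 0.
Proof. by move=> x; rewrite ffunE; apply: is_laur0. Qed.

Lemma laurent_scale a c : laurent_cochain c -> laurent_cochain (cech_scale a c).
Proof. by move=> h x; rewrite ffunE -[rc a]mulr1 -(rmonom0 k n); apply: is_laur_scale. Qed.

Lemma hat0 m W F i : hat m 0 W F i = 0.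
Proof. by rewrite /hat ffunE lcoef0. Qed.

Lemma hatD m c c' W F i : laurent_cochain c -> laurent_cochain c' ->
  hat m (c + c') W F i = hat m c W F i + hat m c' W F i.
Proof. by move=> h h'; rewrite /hat ffunE lcoefD. Qed.

Lemma hat_scale m a c W F i : laurent_cochain c ->
  hat m (cech_scale a c) W F i = a * hat m c W F i.
Proof. by move=> h; rewrite /hat ffunE -[rc a]mulr1 -(rmonom0 k n) lcoef_scale // subr0. Qed.

Lemma hatN m c W F i : laurent_cochain c -> hat m (- c) W F i = - hat m c W F i.
Proof. by move=> h; rewrite -cech_scaleN1 hat_scale // mulN1r. Qed.

Lemma laurent_sum (J : Type) (r : seq J) (f : J -> cech E) :
  (forall y, laurent_cochain (f y)) -> laurent_cochain (\sum_(y <- r) f y).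
Proof.
by move=> h; apply: (big_ind laurent_cochain) => //; [apply: laurent0|apply: laurentD].
Qed.

Lemma hat_sum m (J : Type) (r : seq J) (f : J -> cech E) W F i :
  (forall y, laurent_cochain (f y)) ->
  hat m (\sum_(y <- r) f y) W F i = \sum_(y <- r) hat m (f y) W F i.
Proof.
move=> h; elim: r => [|y r IH]; first by rewrite !big_nil hat0.
by rewrite !big_cons hatD ?IH //; apply: laurent_sum.
Qed.

Definition cut q phi : family := fun W F i => if #|W| == q then phi W F i else 0.

Lemma cut_family m q phi : wfam m phi -> wfam m (cut q phi).
Proof.
move=> [h0 hc hs]; split.
- by move=> F i; rewrite /cut h0 if_same.
- by move=> W F G i; rewrite /cut; case: ifP => _ //; rewrite big1 // => j _; rewrite mulr0.
by move=> W F i FW; rewrite /cut; case: ifP => _; [apply: hs|rewrite eqxx].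
Qed.

Lemma fam_diff_cut q phi W F i :
  fam_diff (cut q phi) W F i = if #|W| == q.+1 then fam_diff phi W F i else 0.
Proof.
have E2 P : P \in W -> (#|W :\ P| == q) = (#|W| == q.+1).
  by move=> PW; rewrite (cardsD1 P W) PW add1n eqSS.
case: ifP => cW; first by apply: eq_cobord => P PW; rewrite /cut E2 ?cW.
by apply: cobord0 => P PW; rewrite /cut E2 ?cW.
Qed.

Definition exact_weight m := forall phi, wfam m phi -> (forall W F i, fam_diff phi W F i = 0) ->
  exists2 psi, wfam m psi & forall W F i, fam_diff psi W F i = phi W F i.

(** Primitives of the finitely many weight parts are cut down to the right degree, turned into
    cochains and added. *)
Lemma coboundary_of_weights p c (L : seq (lattice n)) : is_cocycle p c -> uniq L ->
  (forall m, m \notin L -> forall W F i, hat m c W F i = 0) ->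
  (forall m, m \in L -> exists2 psi, wfam m psi & forall W F i, fam_diff psi W F i = hat m c W F i) ->
  is_coboundary p c.
Proof.
move=> [hc dc] uL out ex; have lc := is_cochain_laur hc.
have [g gP] : exists g : lattice n -> family, forall m, m \in L ->
    wfam m (g m) /\ forall W F i, fam_diff (g m) W F i = hat m c W F i.
  pose R m psi := m \in L -> wfam m psi /\ forall W F i, fam_diff psi W F i = hat m c W F i.
  have h m : exists psi, R m psi.
    have [mL|mL] := boolP (m \in L); first by have [psi h1 h2] := ex m mL; exists psi.
    by exists (fun _ _ _ => 0); rewrite /R (negbTE mL).
  exists (fun m => proj1_sig (constructive_indefinite_description _ (h m))) => m.
  exact: (proj2_sig (constructive_indefinite_description _ (h m))).
case: p hc dc => [|q] hc dc /=.
  (* In degree 0 a coboundary is 0: on a single chart a primitive is evaluated at the empty set,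
     where weight families vanish. *)
  apply: cech_ext lc laurent0 _ => m W F i; rewrite hat0.
  have [mL|/out -> //] := boolP (m \in L); have [[g0 _ _] dg] := gP m mL.
  have [/cards1P [P EW]|nW] := boolP (#|W| == 1%N); last exact: (hat_degree _ hc).
  by rewrite -dg /fam_diff; apply: cobord0 => Q; rewrite EW inE => /eqP ->; rewrite setDv g0.
pose b := \sum_(m <- L) (if m \in L then lift_cech m (cut q.+1 (g m)) else 0).
exists b.
  apply: cochain_sum => m; case: ifP => [mL|_]; last exact: cochain0.
  apply: lift_cochain; first by apply: cut_family; have [] := gP m mL.
  by move=> W F i h; rewrite /cut (negbTE h).
have lb m : laurent_cochain (if m \in L then lift_cech m (cut q.+1 (g m)) else 0).
  by case: ifP => _; [apply: lift_laur|apply: laurent0].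
have Eb : cech_diff b = \sum_(m <- L) (if m \in L then lift_cech m (fam_diff (cut q.+1 (g m))) else 0).
  by rewrite raddf_sum; apply: eq_bigr => m _; case: ifP => _; [exact: lift_diff | exact: raddf0].
have lb' m : laurent_cochain (if m \in L then lift_cech m (fam_diff (cut q.+1 (g m))) else 0).
  by case: ifP => _; [apply: lift_laur|apply: laurent0].
apply: cech_ext => // [|m W F i]; first by rewrite Eb; apply: laurent_sum.
rewrite Eb hat_sum //.
have [mL|mL] := boolP (m \in L).
  rewrite (bigD1_seq m) //= mL hat_lift eqxx big1 ?addr0; last first.
    by move=> m' /negbTE ne; case: ifP => _; rewrite ?hat0 // hat_lift ne.
  rewrite fam_diff_cut; have [_ ->] := gP m mL; case: ifP => // /negbT h.
  exact: (hat_degree _ hc).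
rewrite out // big_seq big1 // => m' m'L; rewrite m'L hat_lift.
by case: eqP => // E'; rewrite -E' m'L in mL.
Qed.

Lemma hat_supp c : laurent_cochain c -> exists L : seq (lattice n),
  uniq L /\ forall m, m \notin L -> forall W F i, hat m c W F i = 0.
Proof.
move=> lc; have [L hL] : exists L : {set chart n} * chart n * I -> seq (lattice n),
    forall x m, lcoef (c x) m != 0 -> m \in L x.
  apply: (fin_all_exists (P := fun x L => forall m, lcoef (c x) m != 0 -> m \in L)) => x.
  by have [L [_ hL]] := lcoef_supp (lc x); exists L.
exists (undup (flatten [seq [seq m - w x.1.2 x.2 | m <- L x] | x : {set chart n} * chart n * I])).
split; first exact: undup_uniq.
move=> m; rewrite mem_undup => mL W F i; apply/eqP; apply: contraNT mL => h.
apply/flatten_mapP; exists (W, F, i); first by rewrite mem_enum.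
apply/mapP; exists (w F i + m); first exact: hL.
by rewrite addrAC subrr add0r.
Qed.

End CechWeights.

(** Each basis is expressed in the other modulo B. Uniqueness of coordinates makes the product of
    the two matrices the identity, which forces d <= d'. *)
Lemma has_dim_leq (k : fieldType) (V : zmodType) (sc : k -> V -> V) (Z B : V -> Prop) d d' :
  (forall a x y, sc a (x - y) = sc a x - sc a y) -> (forall a b x, sc a (sc b x) = sc (a * b) x) ->
  (forall a b x, sc (a + b) x = sc a x + sc b x) -> (forall x, sc 1 x = x) ->
  B 0 -> (forall x y, B x -> B y -> B (x + y)) -> (forall a x, B x -> B (sc a x)) ->
  has_dim sc Z B d -> has_dim sc Z B d' -> (d <= d')%N.
Proof.
move=> scB scA scDl sc1 B0 BD Bsc [b [Zb hb]] [b' [Zb' hb']].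
have scD0 a : sc a 0 = 0 by have := scB a 0 0; rewrite !subrr.
have scN a x : sc a (- x) = - sc a x by rewrite -sub0r scB scD0 sub0r.
have scD a x y : sc a (x + y) = sc a x + sc a y by rewrite -{1}[y]opprK scB scN opprK.
have sc0 x : sc 0 x = 0 by apply: (addIr (sc 0 x)); rewrite -scDl addr0 add0r.
have sc_sum a m (f : 'I_m -> V) : sc a (\sum_i f i) = \sum_i sc a (f i).
  by apply: (big_morph (sc a)) => [x y|]; rewrite ?scD ?scD0.
have sc_suml m (f : 'I_m -> k) x : sc (\sum_i f i) x = \sum_i sc (f i) x.
  by apply: (big_morph (fun a => sc a x)) => [a c|]; rewrite ?scDl ?sc0.
have B_sum m (f : 'I_m -> V) : (forall i, B (f i)) -> B (\sum_i f i).
  by move=> h; apply: (big_ind B) => //.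
have [A hA] : exists A : 'I_d -> {ffun 'I_d' -> k}, forall i, B (b i - \sum_j sc (A i j) (b' j)).
  by apply: (@fin_all_exists 'I_d (fun=> {ffun 'I_d' -> k}) (fun i A => B (b i - \sum_j sc (A j) (b' j)))) => i; have [A [hA _]] := hb' (b i) (Zb i); exists A.
have [A' hA'] : exists A : 'I_d' -> {ffun 'I_d -> k}, forall i, B (b' i - \sum_j sc (A i j) (b j)).
  by apply: (@fin_all_exists 'I_d' (fun=> {ffun 'I_d -> k}) (fun i A => B (b' i - \sum_j sc (A j) (b j)))) => i; have [A' [hA' _]] := hb (b' i) (Zb' i); exists A'.
pose Am := \matrix_(i < d, j < d') A i j; pose Am' := \matrix_(i < d', j < d) A' i j.
apply: (@mulmx1_min k d d' Am Am'); apply/matrixP => i l; rewrite !mxE.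
have [c [hc uc]] := hb (b i) (Zb i).
have u1 : B (b i - \sum_j sc ([ffun j => (i == j)%:R : k] j) (b j)).
  rewrite (bigD1 i) //= ffunE eqxx sc1 big1 ?addr0 ?subrr // => j ji.
  by rewrite ffunE eq_sym (negbTE ji) sc0.
pose c2 := [ffun l => \sum_j A i j * A' j l].
have u2 : B (b i - \sum_l sc (c2 l) (b l)).
  have -> : b i - \sum_l sc (c2 l) (b l) = (b i - \sum_j sc (A i j) (b' j)) +
      \sum_j sc (A i j) (b' j - \sum_l sc (A' j l) (b l)).
    have -> : \sum_j sc (A i j) (b' j - \sum_l sc (A' j l) (b l)) =
        \sum_j sc (A i j) (b' j) - \sum_j sc (A i j) (\sum_l sc (A' j l) (b l)).
      by rewrite -sumrB; apply: eq_bigr => j _; rewrite scB.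
    rewrite addrA subrK; congr (_ - _).
    under eq_bigr do rewrite /c2 ffunE sc_suml.
    rewrite exchange_big; apply: eq_bigr => j _ /=; rewrite sc_sum.
    by apply: eq_bigr => l' _; rewrite scA.
  by apply: BD; [apply: hA|apply: B_sum => j; apply: Bsc; apply: hA'].
have /ffunP /(_ l) := etrans (esym (uc _ u2)) (uc _ u1); rewrite !ffunE => <-.
by apply: eq_bigr => j _; rewrite !mxE.
Qed.

(** * A finite-dimensional model of the Cech complex *)

Section EulerChar.
Variables (k : fieldType) (n : nat) (E : ebundle k n).
Hypothesis hE : is_ebundle E.

Local Notation I := (idx E).
Local Notation w := (@wt k n E).
Local Notation wfam := (weight_family (gam (E := E)) w).
Local Notation gm := (gam (E := E)).
Implicit Types (F G P : chart n) (i j : I) (W : {set chart n}) (c : cech E) (m : lattice n).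

Lemma enum_ordering : ordering (enum 'I_n).
Proof. by rewrite /ordering enum_uniq size_enum_ord eqxx. Qed.

(** The chart in whose frame sections over U_W are recorded; the default occurs only for the empty
    W. *)
Definition rep W : chart n := odflt (chart_of enum_ordering) [pick F in W].

Lemma rep_mem W : W != set0 -> rep W \in W.
Proof. by case/set0Pn => F FW; rewrite /rep; case: pickP => // /(_ F); rewrite FW. Qed.

Variable L : seq (lattice n).
Hypothesis uL : uniq L.
Hypothesis exL : forall m, m \notin L -> exact_weight E m.

Local Notation N := (size L).
Local Notation wgt a := (nth 0 L (nat_of_ord a)).

Definition cell := ('I_N * ({set chart n} * chart n * I))%type.
(** Arrays of coefficients for the weights in L, without conditions of compatibility or support;
    [Cp] cuts out the cochains. *)
Definition model := {ffun cell -> k^o}.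

Definition slice (v : model) (a : 'I_N) : {set chart n} -> chart n -> I -> k :=
  fun W F i => v (a, (W, F, i)).

Definition diff_model (v : model) : model :=
  [ffun x => fam_diff (slice v x.1) x.2.1.1 x.2.1.2 x.2.2].

Lemma diff_model_is_linear : linear diff_model.
Proof.
move=> a u v; apply/ffunP => x; rewrite !ffunE /fam_diff /cobord scaler_sumr -big_split.
by apply: eq_bigr => P _; rewrite /slice !ffunE [LHS]mulrDr; congr (_ + _); exact: mulrCA.
Qed.
HB.instance Definition _ := GRing.isLinear.Build k model model *:%R diff_model diff_model_is_linear.

Definition Dlin : 'End(model) := linfun diff_model.

(** The coefficients that determine a cochain freely: those in the frame of [rep W], at exponents
    regular on U_W. *)
Definition coords (p : nat) : {set 'I_N * ({set chart n} * I)} :=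
  [set x : 'I_N * ({set chart n} * I) | (#|x.2.1| == p.+1) && dual_cone (common x.2.1) (w (rep x.2.1) x.2.2 + wgt x.1)].

Definition ext p (g : {ffun 'I_#|coords p| -> k^o}) : model :=
  [ffun x => \sum_(y < #|coords p| | ((enum_val y).1 == x.1) && ((enum_val y).2.1 == x.2.1.1))
      gm x.2.1.2 (rep x.2.1.1) x.2.2 (enum_val y).2.2 * g y].

Lemma ext_is_linear p : linear (@ext p).
Proof.
move=> a u v; apply/ffunP => x; rewrite !ffunE scaler_sumr -big_split.
by apply: eq_bigr => y _; rewrite !ffunE [LHS]mulrDr; congr (_ + _); exact: mulrCA.
Qed.
HB.instance Definition _ p := GRing.isLinear.Build k {ffun 'I_#|coords p| -> k^o} model *:%R (@ext p) (@ext_is_linear p).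

Definition Cp p : {vspace model} := limg (linfun (@ext p)).

Definition model_cochain p (v : model) :=
  forall a, wfam (wgt a) (slice v a) /\ of_degree p (slice v a).

Lemma CpP p v : v \in Cp p <-> model_cochain p v.
Proof.
split=> [/memv_imgP [g _ ->] a|h].
  rewrite lfunE /=.
  have E0 W F i : slice (ext g) a W F i = \sum_(y < #|coords p| | ((enum_val y).1 == a) && ((enum_val y).2.1 == W))
      gm F (rep W) i (enum_val y).2.2 * g y by rewrite /slice ffunE.
  have deg : of_degree p (slice (ext g) a).
    move=> W F i cW; rewrite E0 big1 // => y /andP[_ /eqP Ey].
    by have := enum_valP y; rewrite inE Ey (negbTE cW).
  split=> //; split.
  - by move=> F i; rewrite deg // cards0.
  - move=> W F G i; rewrite E0; under [RHS]eq_bigr do rewrite E0 mulr_sumr.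
    rewrite exchange_big /=; apply: eq_bigr => y _.
    rewrite -(gam_comp hE F G) mulr_suml; apply: eq_bigr => j _; by rewrite mulrA.
  move=> W F i FW; apply: contraNT => nd; rewrite E0 big1 // => y /andP[/eqP Ea /eqP EW].
  apply/eqP; apply: contraNT nd; rewrite mulf_eq0 negb_or => /andP[g1 _].
  apply: (gam_dual (gam_reg hE) FW _ g1); first by apply: rep_mem; apply/set0Pn; exists F.
  by have := enum_valP y; rewrite inE Ea EW => /andP[].
apply/memv_imgP; exists [ffun y => v ((enum_val y).1, ((enum_val y).2.1, rep (enum_val y).2.1, (enum_val y).2.2))].
  exact: memvf.
rewrite lfunE /=; apply/ffunP => -[a [[W F] i]]; rewrite ffunE /= -[v _]/(slice v a W F i).
have [[_ hc hs] deg] := h a.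
have [cW|cW] := boolP (#|W| == p.+1); last first.
  rewrite (deg W F i cW) big1 // => y /andP[_ /eqP Ey].
  by have := enum_valP y; rewrite inE Ey (negbTE cW).
have W0 : W != set0 by rewrite -card_gt0 (eqP cW).
rewrite [LHS](hc W F (rep W)).
transitivity (\sum_(x in coords p | (x.1 == a) && (x.2.1 == W)) gm F (rep W) i x.2.2 * slice v a W (rep W) x.2.2).
  pose f j : 'I_N * ({set chart n} * I) := (a, (W, j)).
  rewrite (reindex_onto f (fun x => x.2.2)) /=; last first.
    by move=> [a' [W' j]] /andP[_ /andP[/= /eqP -> /eqP ->]].
  rewrite [RHS]big_mkcond; apply: eq_bigr => j _; rewrite !eqxx !andbT inE /= cW /=.
  case: ifP => // /negbT nd; have := hs W (rep W) j (rep_mem W0); rewrite (negbTE nd).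
  by case: eqP => [->|_ /(_ isT)] //; rewrite mulr0.
rewrite big_enum_val_cond; apply: eq_bigr => y /andP[/eqP Ea /eqP EW].
by rewrite ffunE /slice Ea EW.
Qed.

Lemma dim_Cp p : \dim (Cp p) = #|coords p|.
Proof.
rewrite limg_dim_eq ?dimvf.
  by rewrite /dim /= card_ord muln1.
apply/eqP; rewrite -subv0; apply/subvP => g; rewrite memv_cap memvf memv_ker lfunE /= memv0 => /eqP h.
apply/eqP/ffunP => y; have := enum_valP y; rewrite inE => /andP[cW _].
have := congr1 (fun v : model => v ((enum_val y).1, ((enum_val y).2.1, rep (enum_val y).2.1, (enum_val y).2.2))) h.
rewrite !ffunE /= (bigD1 y) ?eqxx //= (gam_id hE) eqxx mul1r big1 ?addr0 //.
move=> z /andP[/andP[/eqP Ea /eqP EW] zy]; rewrite (gam_id hE).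
case: eqP => [Ei|_]; last by rewrite mul0r.
case/eqP: zy; apply: enum_val_inj; move: Ea EW Ei.
by case: (enum_val z) => ? [? ?]; case: (enum_val y) => ? [? ?] /= -> -> ->.
Qed.

Definition Bp p : {vspace model} := if p is q.+1 then (Dlin @: Cp q)%VS else 0%VS.

Lemma slice_diff v a W F i : slice (Dlin v) a W F i = fam_diff (slice v a) W F i.
Proof. by rewrite lfunE /= /slice ffunE. Qed.

Lemma Dlin_Cp q v : v \in Cp q -> Dlin v \in Cp q.+1.
Proof.
move=> /CpP h; apply/CpP => a; have [hf hd] := h a; split.
  have := fam_diff_family (gam_reg hE) hf.
  case=> h0 hc hs; split=> [F i|W F G i|W F i FW]; rewrite ?slice_diff //; last exact: hs.
  by rewrite (hc W F G); apply: eq_bigr => j _; rewrite slice_diff.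
move=> W F i cW; rewrite slice_diff /fam_diff cobord0 // => P PW; apply: hd.
by apply: contra cW => /eqP e; rewrite (cardsD1 P W) PW e.
Qed.

Lemma Bp_sub p : (Bp p <= Cp p :&: lker Dlin)%VS.
Proof.
case: p => [|q]; first exact: sub0v.
apply/subvP => v /memv_imgP [u uC ->]; rewrite memv_cap Dlin_Cp //= memv_ker; apply/eqP/ffunP => -[a [[W F] i]].
have := slice_diff (Dlin u) a W F i; rewrite /slice => ->; rewrite ffunE -/(slice (Dlin u) a).
transitivity (fam_diff (fam_diff (slice u a)) W F i); last exact: fam_diff_sq.
by apply: eq_cobord => P _; exact: slice_diff.
Qed.

Definition hat_model c : model := [ffun x => hat (wgt x.1) c x.2.1.1 x.2.1.2 x.2.2].
Definition lift_model (v : model) : cech E := \sum_(a < N) lift_cech (wgt a) (slice v a).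

Lemma slice_hat c a W F i : slice (hat_model c) a W F i = hat (wgt a) c W F i.
Proof. by rewrite /slice ffunE. Qed.

Lemma hat_model_Cp p c : is_cochain p c -> hat_model c \in Cp p.
Proof.
move=> hc; apply/CpP => a; split; last by move=> W F i h; rewrite slice_hat (hat_degree _ hc).
have [h0 hc' hs] := hat_family hE (wgt a) hc.
split=> [F i|W F G i|W F i FW]; rewrite ?slice_hat //; last exact: hs.
by rewrite (hc' W F G); apply: eq_bigr => j _; rewrite slice_hat.
Qed.

Lemma Dlin_hat c : laurent_cochain c -> Dlin (hat_model c) = hat_model (cech_diff c).
Proof.
move=> lc; apply/ffunP => -[a [[W F] i]]; have := slice_diff (hat_model c) a W F i; rewrite /slice => ->.
rewrite ffunE /= hat_diff //; apply: eq_cobord => P _; exact: slice_hat.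
Qed.

Lemma lift_model_laur v : laurent_cochain (lift_model v).
Proof. by apply: laurent_sum => a; apply: lift_laur. Qed.

Lemma lift_model_cochain p v : v \in Cp p -> is_cochain p (lift_model v).
Proof. by move=> /CpP h; apply: cochain_sum => a; have [] := h a; apply: lift_cochain. Qed.

Lemma wgt_inj (a b : 'I_N) : (wgt a == wgt b) = (a == b).
Proof. by rewrite nth_uniq. Qed.

Lemma hat_lift_model v : hat_model (lift_model v) = v.
Proof.
apply/ffunP => -[a [[W F] i]]; rewrite ffunE /= hat_sum; last by move=> b; apply: lift_laur.
rewrite (bigD1 a) //= hat_lift eqxx big1 ?addr0 // => b ba.
by rewrite hat_lift wgt_inj (negbTE ba).
Qed.

Lemma hat_model_D c c' : laurent_cochain c -> laurent_cochain c' ->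
  hat_model (c + c') = hat_model c + hat_model c'.
Proof. by move=> h h'; apply/ffunP => x; rewrite !ffunE hatD. Qed.

Lemma hat_model_N c : laurent_cochain c -> hat_model (- c) = - hat_model c.
Proof. by move=> h; apply/ffunP => x; rewrite !ffunE hatN. Qed.

Lemma laurentN c : laurent_cochain c -> laurent_cochain (- c).
Proof. by rewrite -cech_scaleN1; apply: laurent_scale. Qed.

(** If the part of a cocycle with weights in L is a coboundary of the model, subtracting the
    corresponding coboundary leaves a cocycle without weights in L, and all other weights are
    exact. *)
Lemma coboundary_model p c : is_cocycle p c -> is_coboundary p c <-> hat_model c \in Bp p.
Proof.
move=> [hc dc]; have lc := is_cochain_laur hE hc; split.
  case: p hc => [|q] hc /=.
    by move=> ->; rewrite memv0; apply/eqP/ffunP => x; rewrite !ffunE hat0.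
  move=> [b hb ->]; rewrite -Dlin_hat; last exact: is_cochain_laur hb.
  by apply: memv_img; apply: hat_model_Cp.
move=> hB.
have [g hg [gc dg]] : exists2 b : cech E, hat_model b = hat_model c & is_cochain p b /\ is_coboundary p b.
  case: p hc hB => [|q] hc /=.
    rewrite memv0 => /eqP ->; exists 0; first by apply/ffunP => x; rewrite !ffunE hat0.
    by split=> //; apply: cochain0.
  move/memv_imgP => [u uC Eu]; exists (cech_diff (lift_model u)).
    by rewrite -Dlin_hat ?hat_lift_model //; apply: lift_model_laur.
  split; last by exists (lift_model u) => //; apply: lift_model_cochain.
  have -> : cech_diff (lift_model u) = lift_model (Dlin u).
    rewrite /lift_model raddf_sum; apply: eq_bigr => a _; rewrite [LHS]lift_diff.
    apply/ffunP => x; rewrite !ffunE; congr (rconst _ _ * _); apply/esym; exact: slice_diff.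
  by apply: lift_model_cochain; apply: Dlin_Cp.
have dg0 : cech_diff g = 0.
  case: p hc hB gc dg => [|q] hc hB gc /=; first by move=> ->; rewrite raddf0.
  move=> [b hb ->]; have lb := is_cochain_laur hE hb.
  apply: (cech_ext (E := E)).
  - move=> x; rewrite ffunE; apply: is_laur_sum => P _; rewrite sign_rconst; apply: is_laur_scale.
    rewrite ffunE; apply: is_laur_sum => Q _; rewrite sign_rconst; apply: is_laur_scale; exact: lb.
  - exact: laurent0.
  move=> m W F i; rewrite hat0 hat_diff.
    transitivity (fam_diff (fam_diff (hat m b)) W F i); last exact: fam_diff_sq.
    by apply: eq_cobord => P _; apply: hat_diff.
  move=> x; rewrite ffunE; apply: is_laur_sum => Q _; rewrite sign_rconst; apply: is_laur_scale; exact: lb.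
have lg := is_cochain_laur hE gc.
pose c' := c - g.
have hc' : is_cocycle p c'.
  by split; [apply: cochainD => //; apply: cochainN|rewrite /c' raddfB /= dc dg0 subrr].
have lc' := is_cochain_laur hE (proj1 hc').
have cb' : is_coboundary p c'.
  have [L' [uL' outL']] := hat_supp lc'.
  apply: (coboundary_of_weights hE hc' uL' outL') => m mL'.
  have [mL|mL] := boolP (m \in L).
    exists (fun _ _ _ => 0).
      split=> // [W F G i|W F i _]; last by rewrite eqxx.
      by rewrite big1 // => j _; rewrite mulr0.
    move=> W F i; rewrite /fam_diff cobord0 //.
    have mN : (index m L < N)%N by rewrite index_mem.
    have := congr1 (fun v : model => v (Ordinal mN, (W, F, i))) hg.
    rewrite !ffunE /= nth_index // => e.
    by rewrite hatD ?hatN // ?e ?subrr //; exact: laurentN.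
  apply: exL mL _ (hat_family hE m (proj1 hc')) _ => W F i.
  by rewrite -hat_diff // (proj2 hc') hat0.
have -> : c = c' + g by rewrite /c' subrK.
case: p cb' dg {hc hB gc hc'} => [|q] /=; first by move=> -> ->; rewrite addr0.
move=> [b hb ->] [b' hb' ->]; exists (b + b'); first exact: cochainD.
by rewrite raddfD.
Qed.

Definition hp p : nat := \dim (Cp p :&: lker Dlin :\: Bp p)%VS.

Lemma cohom_has_dim p :
  has_dim (@cech_scale k n E) (@is_cocycle k n E p) (@is_coboundary k n E p) (hp p).
Proof.
set U := (Cp p :&: lker Dlin :\: Bp p)%VS.
pose b (i : 'I_(hp p)) : cech E := lift_model (vbasis U)`_i.
have UZ (i : 'I_(hp p)) : (vbasis U)`_i \in (Cp p :&: lker Dlin)%VS.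
  apply: (subvP (diffvSl _ (Bp p))); apply: vbasis_mem; apply: mem_nth.
  by rewrite size_tuple.
have cocb (i : 'I_(hp p)) : is_cocycle p (b i).
  have := UZ i; rewrite memv_cap memv_ker => /andP[h1 /eqP h2].
  split; first exact: lift_model_cochain.
  rewrite /b /lift_model raddf_sum big1 //= => a _.
  transitivity (lift_cech (wgt a) (fam_diff (slice (vbasis U)`_i a))); first exact: lift_diff.
  apply/ffunP => x; rewrite !ffunE -slice_diff h2 /slice ffunE rconst0 mul0r //.
exists b; split=> // z hz; have [hzc dz] := hz; have lz := is_cochain_laur hE hzc.
pose comb (c : {ffun 'I_(hp p) -> k}) : model := \sum_(i < hp p) c i *: (vbasis U)`_i.
have key (c : {ffun 'I_(hp p) -> k}) : is_coboundary p (z - \sum_i cech_scale (c i) (b i)) <-> hat_model z - comb c \in Bp p.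
  have lb (i : 'I_(hp p)) : laurent_cochain (cech_scale (c i) (b i)) by apply: laurent_scale; apply: lift_model_laur.
  have lsum : laurent_cochain (\sum_i cech_scale (c i) (b i)) by apply: laurent_sum.
  rewrite coboundary_model; last first.
    split.
      apply: cochainD => //; apply: cochainN; apply: cochain_sum => i.
      by apply: cochain_scale; case: (cocb i).
    rewrite raddfB /= dz raddf_sum big1 ?subr0 //= => i _.
    rewrite [LHS]cech_diff_scale; case: (cocb i) => _ ->.
    by apply/ffunP => x; rewrite !ffunE mulr0.
  rewrite hat_model_D // ?hat_model_N //; last exact: laurentN.
  have -> : hat_model (\sum_i cech_scale (c i) (b i)) = comb c; last by [].
  apply/ffunP => -[a [[W F] i]]; rewrite ffunE /= hat_sum // sum_ffunE; apply: eq_bigr => y _.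
  rewrite hat_scale; last exact: lift_model_laur.
  have := hat_lift_model (vbasis U)`_y; move/(congr1 (fun v : model => v (a, (W, F, i)))).
  by rewrite !ffunE /= => ->.
have hzZ : hat_model z \in (Cp p :&: lker Dlin)%VS.
  rewrite memv_cap hat_model_Cp //= memv_ker Dlin_hat // dz.
  by apply/eqP/ffunP => x; rewrite !ffunE hat0.
have : hat_model z \in (U + Bp p)%VS.
  by rewrite addv_diff (addv_idPl (Bp_sub p)).
case/memv_addP => u uU [v vB Ez].
have combU (c : {ffun 'I_(hp p) -> k}) : comb c \in U.
  by apply: memv_suml => i _; apply: memvZ; apply: vbasis_mem; apply: mem_nth; rewrite size_tuple.
exists [ffun i : 'I_(hp p) => coord (vbasis U) i u]; split.
  apply/key; rewrite Ez /comb (eq_bigr (fun i : 'I_(hp p) => coord (vbasis U) i u *: (vbasis U)`_i)).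
    by rewrite -[\sum_(_ < _) _](coord_vbasis uU) addrAC subrr add0r.
  by move=> i _; rewrite ffunE.
move=> c /key; rewrite Ez => h.
have E0 : u = comb c.
  apply/eqP; rewrite -subr_eq0 -memv0 -(capv_diff (Cp p :&: lker Dlin)%VS (Bp p)) memv_cap.
  rewrite memvB //=.
  have -> : u - comb c = (u + v - comb c) - v by rewrite [u + v - _]addrAC addrK.
  by apply: memvB.
apply/ffunP => i; rewrite ffunE E0 /comb coord_sum_free //.
exact: (basis_free (vbasisP U)).
Qed.

End EulerChar.

(** * The Euler characteristic as a sum over weights *)

Section EulerFormula.
Variables (k : fieldType) (n : nat) (E : ebundle k n).
Hypothesis hE : is_ebundle E.

Local Notation I := (idx E).
Local Notation w := (@wt k n E).
Implicit Types (F G P : chart n) (i j : I) (W : {set chart n}) (c : cech E) (m : lattice n).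

Lemma coboundary0 p : is_coboundary p (0 : cech E).
Proof.
by case: p => [|q] //=; exists 0; [apply: cochain0|rewrite raddf0].
Qed.

Lemma coboundaryD p c c' : is_coboundary p c -> is_coboundary p c' -> is_coboundary p (c + c').
Proof.
case: p => [|q] /=; first by move=> -> ->; rewrite addr0.
by move=> [b hb ->] [b' hb' ->]; exists (b + b'); [apply: cochainD|rewrite raddfD].
Qed.

Lemma coboundary_scale p a c : is_coboundary p c -> is_coboundary p (cech_scale a c).
Proof.
case: p => [|q] /=; first by move=> ->; apply/ffunP => x; rewrite !ffunE mulr0.
by move=> [b hb ->]; exists (cech_scale a b); [apply: cochain_scale|rewrite cech_diff_scale].
Qed.

Lemma cohom_has_dim_leq p d d' :
  has_dim (@cech_scale k n E) (@is_cocycle k n E p) (@is_coboundary k n E p) d ->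
  has_dim (@cech_scale k n E) (@is_cocycle k n E p) (@is_coboundary k n E p) d' -> (d <= d')%N.
Proof.
apply: has_dim_leq.
- by move=> a x y; apply/ffunP => z; rewrite !ffunE mulrBr.
- by move=> a b x; apply/ffunP => z; rewrite !ffunE rconstM mulrA.
- by move=> a b x; apply/ffunP => z; rewrite !ffunE rconstD mulrDl.
- by move=> x; apply/ffunP => z; rewrite !ffunE rconst1 mul1r.
- exact: coboundary0.
- exact: coboundaryD.
- exact: coboundary_scale.
Qed.

Lemma cohom_dimE p d :
  has_dim (@cech_scale k n E) (@is_cocycle k n E p) (@is_coboundary k n E p) d ->
  cohom_dim E p = d.
Proof.
move=> h; have h' := epsilon_spec (inhabits 0%N) (has_dim (@cech_scale k n E) (@is_cocycle k n E p) (@is_coboundary k n E p)) (ex_intro _ d h).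
by apply/eqP; rewrite eqn_leq; apply/andP; split; [apply: cohom_has_dim_leq h' h|apply: cohom_has_dim_leq h h'].
Qed.

(* The graded Euler characteristic; a section over U_W of weight m is counted in
   the frame of the chart rep W. *)
Definition hcount m : int := \sum_(W : {set chart n} | W != set0)
  (-1) ^+ #|W|.-1 * (#|[set i | dual_cone (common W) (w (rep W) i + m)]|)%:Z.

Section WithWeights.
Variable L : seq (lattice n).
Hypothesis uL : uniq L.
Hypothesis exL : forall m, m \notin L -> exact_weight E m.
Local Notation M := #|{: chart n}|.

Lemma coords_sum p : (#|coords E L p|)%:Z =
  \sum_(m <- L) \sum_(W : {set chart n} | #|W| == p.+1)
     (#|[set i | dual_cone (common W) (w (rep W) i + m)]|)%:Z.
Proof.
rewrite (big_nth 0) big_mkord.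
have cardZ (T : finType) (A : {set T}) : (#|A|)%:Z = \sum_(x in A) 1.
  by rewrite -sum1_card -[LHS]natz natr_sum.
under eq_bigr do under eq_bigr do rewrite cardZ.
rewrite cardZ.
pose P (x : 'I_(size L) * ({set chart n} * I)) := x \in coords E L p.
transitivity (\sum_(a < size L) \sum_(W : {set chart n}) \sum_(i : I) (P (a, (W, i)))%:R : int).
  transitivity (\sum_(a < size L) \sum_(q : {set chart n} * I) (P (a, q))%:R : int).
    rewrite pair_bigA /= big_mkcond; apply: eq_bigr => -[a q] _ /=.
    by rewrite /P; case: ifP.
  apply: eq_bigr => a _; rewrite pair_bigA; by apply: eq_bigr => -[].
apply: eq_bigr => a _; rewrite [RHS]big_mkcond; apply: eq_bigr => W _.
rewrite /P; case: ifP => cW; last by rewrite big1 // => i _; rewrite inE /= cW.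
by rewrite [RHS]big_mkcond; apply: eq_bigr => i _; rewrite !inE /= cW /=; case: ifP.
Qed.

Lemma Cp_top : (Cp E L M <= 0)%VS.
Proof.
apply/subvP => v /(CpP hE) h; rewrite memv0; apply/eqP/ffunP => -[a [[W F] i]].
rewrite !ffunE; have [_ hd] := h a; apply: hd.
by apply: contraTneq (max_card (mem W)) => ->; rewrite ltnn.
Qed.

(** The dimension of cohomology is that of the cochains minus those of the coboundaries in two
    consecutive degrees. In the alternating sum the latter telescope; they vanish in degree 0 and in
    degree M, which would need M + 1 charts. *)
Theorem euler_char_sum : euler_char E = \sum_(m <- L) hcount m.
Proof.
have M0 : (0 < M)%N by apply/card_gt0P; exists (rep set0).
pose b p : int := (\dim (Bp E L p))%:Z.
have hpE p : (hp E L p)%:Z = (#|coords E L p|)%:Z - b p.+1 - b p.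
  have d1 := limg_ker_dim (Dlin E L) (Cp E L p).
  have d2 := dimv_cap_compl (Cp E L p :&: lker (Dlin E L))%VS (Bp E L p).
  rewrite (capv_idPr (Bp_sub hE L p)) in d2.
  by rewrite -(dim_Cp hE L) -d1 -d2 /b /hp /= !PoszD; ring.
have hcd p : cohom_dim E p = hp E L p.
  by apply: cohom_dimE; apply: cohom_has_dim.
have b0 : b 0%N = 0 by rewrite /b /= dimv0.
have bM : b M = 0.
  rewrite /b; congr Posz; apply/eqP; rewrite dimv_eq0 -subv0.
  by apply: subv_trans Cp_top; apply: subv_trans (Bp_sub hE L M) (capvSl _ _).
rewrite /euler_char.
transitivity (\sum_(p < M) (-1) ^+ p * (#|coords E L p|)%:Z).
  apply/eqP; rewrite -subr_eq0 -sumrB.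
  under eq_bigr do rewrite hcd hpE -mulrBr.
  have tele N : \sum_(p < N) (-1) ^+ p * ((#|coords E L p|)%:Z - b p.+1 - b p - (#|coords E L p|)%:Z) = (-1) ^+ N * b N - b 0%N.
    elim: N => [|N IH]; first by rewrite big_ord0 expr0 mul1r subrr.
    by rewrite big_ord_recr IH /= exprS; ring.
  by rewrite tele b0 bM mulr0 subrr.
under eq_bigr do rewrite coords_sum mulr_sumr.
rewrite exchange_big /=; apply: eq_bigr => m _.
pose g (p : nat) : int := (-1) ^+ p * \sum_(W : {set chart n} | #|W| == p.+1)
   (#|[set i | dual_cone (common W) (w (rep W) i + m)]|)%:Z.
transitivity (\sum_(p < M.-1.+1) g p).
  by rewrite -[RHS](big_mkord predT g) prednK // big_mkord.
rewrite /hcount (partition_big (fun W : {set chart n} => inord #|W|.-1 : 'I_(M.-1.+1)) predT) //=.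
apply: eq_bigr => p _; rewrite /g mulr_sumr.
have cM (W : {set chart n}) : (#|W| <= M)%N by apply: max_card.
apply: eq_big => [W|W /eqP ->] //.
rewrite -card_gt0.
have [W0|W0] := posnP #|W|; first by rewrite W0 andFb.
have lt : (#|W|.-1 < M.-1.+1)%N.
  by rewrite (prednK M0); apply: leq_trans (cM W); rewrite (prednK W0).
by rewrite /= -val_eqE /= (inordK lt) -[in LHS](prednK W0) eqSS.
Qed.

End WithWeights.

Theorem euler_char_weights : exists L : seq (lattice n),
  [/\ uniq L, forall m, m \notin L -> hcount m = 0 & euler_char E = \sum_(m <- L) hcount m].
Proof.
have [K hK] := bad_descents_bounded w.
have exK m : m \notin box n K -> exact_weight E m.
  move=> /hK [xi xi_inj hb] phi fphi dphi.
  exact: (weight_exact (gam_id hE) (gam_comp hE) (gam_reg hE) xi_inj hb fphi dphi).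
have uK : uniq (box n K) by apply: undup_uniq.
exists (box n K); split=> //; last exact: euler_char_sum.
(* The Euler characteristic does not depend on the list of weights, so adding an exact weight m to
   the box must add 0. *)
move=> m mK; have := @euler_char_sum (m :: box n K) _ _; rewrite /= mK uK => /(_ isT).
rewrite big_cons (euler_char_sum uK exK) => h.
apply: (addIr (\sum_(m <- box n K) hcount m)); rewrite add0r -h // => m'.
by rewrite inE negb_or => /andP[_ /exK].
Qed.

End EulerFormula.

(** * Localization *)

Section GeneratingFunction.
Variables (K : fieldType) (n : nat) (t : 'I_n -> K).
Hypothesis t_neq0 : forall i, t i != 0.
Hypothesis t_inj : injective t.
Implicit Types (m d : lattice n) (f g : lattice n -> int) (L : seq (lattice n)).

Definition mono m : K := \prod_i t i ^ m i.

Lemma monoD m d : mono (m + d) = mono m * mono d.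
Proof. by rewrite /mono -big_split; apply: eq_bigr => i _; rewrite ffunE expfzDr. Qed.

Lemma mono0 : mono 0 = 1.
Proof. by rewrite /mono big1 // => i _; rewrite ffunE expr0z. Qed.

Lemma mono_neq0 m : mono m != 0.
Proof. by apply/prodf_neq0 => i _; rewrite expfz_neq0. Qed.

Lemma monoN m : mono (- m) = (mono m)^-1.
Proof. by apply: (mulIf (mono_neq0 m)); rewrite -monoD addNr mono0 mulVf // mono_neq0. Qed.

Lemma mono_tchar i : mono (tchar i) = t i.
Proof.
rewrite /mono (bigD1 i) //= ffunE eqxx expr1z big1 ?mulr1 // => j /negbTE ji.
by rewrite ffunE ji expr0z.
Qed.

(* x is the generating function of f, with finite support: the sum of the
   f(m) t^(-m). *)
Definition gen f (x : K) := exists L, [/\ uniq L, forall m, m \notin L -> f m = 0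
  & x = \sum_(m <- L) (f m)%:~R * mono (- m)].

Lemma gen_uniq f x y : gen f x -> gen f y -> x = y.
Proof.
move=> [L [uL hL ->]] [L' [uL' hL' ->]].
pose M := undup (L ++ L').
have z (m : lattice n) (A : seq (lattice n)) : (forall m, m \notin A -> f m = 0) -> m \notin A -> (f m)%:~R * mono (- m) = 0 :> K.
  by move=> h /h ->; rewrite mul0r.
rewrite -(@big_uniq_supp _ _ L M) //; first rewrite -(@big_uniq_supp _ _ L' M) //.
- exact: undup_uniq.
- by move=> m mL; rewrite mem_undup mem_cat mL orbT.
- by move=> m; apply: z.
- exact: undup_uniq.
- by move=> m mL; rewrite mem_undup mem_cat mL.
- by move=> m; apply: z.
Qed.

Lemma gen_widen f L L' x : uniq L' -> {subset L <= L'} ->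
  (forall m, m \notin L -> f m = 0) -> uniq L -> x = \sum_(m <- L) (f m)%:~R * mono (- m) ->
  x = \sum_(m <- L') (f m)%:~R * mono (- m).
Proof.
move=> uL' s h uL ->; symmetry; apply: big_uniq_supp => // m /h ->; exact: mul0r.
Qed.

Lemma eq_gen f g x : f =1 g -> gen f x -> gen g x.
Proof.
move=> E [L [uL hL ->]]; exists L; split=> // [m /hL|]; rewrite -?E //.
by apply: eq_bigr => m _; rewrite E.
Qed.

Lemma gen0 : gen (fun _ => 0) 0.
Proof. by exists [::]; rewrite big_nil. Qed.

Lemma genD f g x y : gen f x -> gen g y -> gen (fun m => f m + g m) (x + y).
Proof.
move=> [L [uL hL Ex]] [L' [uL' hL' Ey]]; pose M := undup (L ++ L').
have uM : uniq M by apply: undup_uniq.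
exists M; split=> // [m|].
  by rewrite mem_undup mem_cat negb_or => /andP[/hL -> /hL' ->]; rewrite addr0.
rewrite (gen_widen uM _ hL uL Ex) ?(gen_widen uM _ hL' uL' Ey) -?big_split /=.
- by apply: eq_bigr => m _; rewrite rmorphD /= mulrDl.
- by move=> m h; rewrite mem_undup mem_cat h orbT.
- by move=> m h; rewrite mem_undup mem_cat h.
Qed.

Lemma genZ (a : int) f x : gen f x -> gen (fun m => a * f m) (a%:~R * x).
Proof.
move=> [L [uL hL ->]]; exists L; split=> // [m /hL ->|]; first by rewrite mulr0.
by rewrite mulr_sumr; apply: eq_bigr => m _; rewrite rmorphM mulrA.
Qed.

Lemma gen_sum (J : Type) (r : seq J) (P : pred J) (f : J -> lattice n -> int) (x : J -> K) :
  (forall j, P j -> gen (f j) (x j)) ->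
  gen (fun m => \sum_(j <- r | P j) f j m) (\sum_(j <- r | P j) x j).
Proof.
move=> h; elim: r => [|j r IH].
  by rewrite big_nil; apply: eq_gen gen0 => m; rewrite big_nil.
rewrite big_cons; case: ifP => Pj.
  apply: (eq_gen (f := fun m => f j m + \sum_(j <- r | P j) f j m)); last by apply: genD => //; apply: h.
  by move=> m; rewrite big_cons Pj.
by apply: eq_gen IH => m; rewrite big_cons Pj.
Qed.

Lemma gen_shift f x d : gen f x -> gen (fun m => f (m - d)) (mono (- d) * x).
Proof.
move=> [L [uL hL ->]]; exists [seq m + d | m <- L]; split.
- by rewrite map_inj_uniq //; apply: addIr.
- by move=> m hm; apply: hL; apply: contra hm => h; apply/mapP; exists (m - d); rewrite ?subrK.
rewrite big_map mulr_sumr; apply: eq_bigr => m _.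
by rewrite addrK opprD monoD; ring.
Qed.

Lemma gen_delta d : gen (fun m => (m == d)%:R) (mono (- d)).
Proof.
exists [:: d]; split=> // [m|]; first by rewrite inE => /negbTE ->.
by rewrite big_seq1 eqxx mul1r.
Qed.

(** Multiplication of the generating function by 1 - t^(-d), in a form that also makes sense for
    functions of infinite support such as the indicators of cones. *)
Definition delta d f : lattice n -> int := fun m => f m - f (m - d).

Definition deltas (ds : seq (lattice n)) f := foldr delta f ds.

Lemma eq_delta d f g : f =1 g -> delta d f =1 delta d g.
Proof. by move=> E m; rewrite /delta !E. Qed.

Lemma eq_deltas ds f g : f =1 g -> deltas ds f =1 deltas ds g.
Proof. by move=> E; elim: ds => //= d ds IH; apply: eq_delta. Qed.

Lemma delta_comm d d' f : delta d (delta d' f) =1 delta d' (delta d f).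
Proof. by move=> m; rewrite /delta [m - d - d']addrAC; ring. Qed.

Lemma deltas_delta ds d f : deltas ds (delta d f) =1 delta d (deltas ds f).
Proof.
elim: ds => //= d' ds IH m; rewrite delta_comm; apply: eq_delta => {}m; exact: IH.
Qed.

Lemma deltas_cat ds ds' f : deltas (ds ++ ds') f = deltas ds (deltas ds' f).
Proof. by rewrite /deltas foldr_cat. Qed.

Lemma deltas_mem ds d f : d \in ds -> deltas ds f =1 deltas (rem d ds) (delta d f).
Proof.
elim: ds => //= d' ds IH; rewrite inE eq_sym; case: eqP => [-> _|_ /= h] m.
  by rewrite deltas_delta.
by apply: eq_delta => {}m; apply: IH.
Qed.

Lemma deltas_perm ds ds' f : perm_eq ds ds' -> deltas ds f =1 deltas ds' f.
Proof.
elim: ds ds' => [|d ds IH] ds' p m; first by rewrite perm_sym in p; move/perm_nilP: p => ->.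
have d' : d \in ds' by rewrite -(perm_mem p) mem_head.
rewrite (deltas_mem _ d') deltas_delta /=; apply: eq_delta => {}m; apply: IH.
by move: p; rewrite (perm_sym _ ds') (permPl (perm_to_rem d')) perm_cons perm_sym.
Qed.

Lemma deltas0 ds : deltas ds (fun _ => 0) =1 fun _ => 0.
Proof. by elim: ds => //= d ds IH m; rewrite /delta !IH subrr. Qed.

Lemma deltasZ ds a f : deltas ds (fun m => a * f m) =1 fun m => a * deltas ds f m.
Proof. by elim: ds => //= d ds IH m; rewrite /delta !IH; ring. Qed.

Lemma deltas_sum ds (J : Type) (r : seq J) (P : pred J) (f : J -> lattice n -> int) :
  deltas ds (fun m => \sum_(j <- r | P j) f j m) =1 fun m => \sum_(j <- r | P j) deltas ds (f j) m.
Proof.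
elim: ds => //= d ds IH m; rewrite /delta !IH -sumrB; exact: eq_bigr.
Qed.

Definition dprod (ds : seq (lattice n)) : K := \prod_(d <- ds) (1 - mono (- d)).

Lemma gen_deltas ds f x : gen f x -> gen (deltas ds f) (dprod ds * x).
Proof.
rewrite /dprod => h; elim: ds => [|d ds IH] /=; first by rewrite big_nil mul1r.
rewrite big_cons -mulrA mulrBl mul1r -mulN1r.
have := genD IH (genZ (-1) (gen_shift d IH)).
by rewrite rmorphN1; apply: eq_gen => m; rewrite mulN1r.
Qed.

Definition roots : seq (lattice n) :=
  undup [seq tchar p.1 - tchar p.2 | p <- enum [pred p : 'I_n * 'I_n | p.1 != p.2]].

Lemma mem_roots (i j : 'I_n) : i != j -> tchar i - tchar j \in roots.
Proof.
move=> ij; rewrite mem_undup; apply/mapP; exists (i, j) => //.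
by rewrite mem_enum.
Qed.

Lemma mono_root i j : mono (- (tchar i - tchar j)) = t j / t i.
Proof. by rewrite opprB monoD monoN !mono_tchar. Qed.

Lemma dprod_roots_neq0 : dprod roots != 0.
Proof.
rewrite /dprod prodf_seq_neq0; apply/allP => d; rewrite mem_undup => /mapP [[i j]].
rewrite mem_enum => /= ij -> ; rewrite mono_root subr_eq0.
apply/eqP => E; move/eqP: ij; apply; apply: t_inj.
by rewrite -[LHS]mul1r E divfK.
Qed.

Lemma pairing_root (i j : 'I_n) (S : {set 'I_n}) :
  pairing (tchar i - tchar j) S = (i \in S)%:R - (j \in S)%:R.
Proof.
have h (i' : 'I_n) : pairing (tchar i') S = (i' \in S)%:R.
  rewrite /pairing; under eq_bigr do rewrite ffunE.
  have [iS|iS] := boolP (i' \in S).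
    by rewrite (big_setD1 i') //= eqxx big1 ?addr0 // => y; rewrite !inE => /andP[/negbTE ->].
  by rewrite big1 // => y yS; case: eqP => // E; rewrite -E yS in iS.
by rewrite pairingD pairingN !h.
Qed.

(* The points of weight m contributed by a frame element of weight m0. *)
Definition cone_ind (T : {set {set 'I_n}}) m0 : lattice n -> int := fun m => (dual_cone T (m0 + m))%:R.

(** The cone contains the line spanned by the root of i and j, so its indicator is invariant under
    translation by that root. *)
Lemma cone_ind_killed (T : {set {set 'I_n}}) m0 (i j : 'I_n) : i != j -> (forall S, S \in T -> (i \in S) = (j \in S)) ->
  deltas roots (cone_ind T m0) =1 fun _ => 0.
Proof.
move=> ij h m; rewrite (deltas_mem _ (mem_roots ij)).
rewrite -[RHS](deltas0 (rem (tchar i - tchar j) roots) m); apply: eq_deltas => {}m.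
rewrite /delta /cone_ind; apply/eqP; rewrite subr_eq0; apply/eqP; congr (_%:R).
have E (S : {set 'I_n}) : (i \in S) = (j \in S) ->
    pairing (m0 + (m - (tchar i - tchar j))) S = pairing (m0 + m) S.
  move=> e; rewrite (_ : m0 + (m - _) = (m0 + m) + - (tchar i - tchar j)) ?addrA // pairingD pairingN pairing_root e subrr subr0 //.
rewrite /dual_cone E ?inE //; congr (nat_of_bool (_ && _)); apply: eq_forallb => S.
by case ST: (S \in T) => //=; rewrite E // h.
Qed.

Section Chart.
Variable F : chart n.
Let s := chart_seq F.

(** The generators of the dual cone of F, dual to its members by [pairing_wall]; the factor 1 -
    t^(-wall) is the inverse of a link. *)
Definition wall (x0 : 'I_n) a : lattice n := tchar (nth x0 s a.-1) - tchar (nth x0 s a).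

Lemma pairing_wall x0 a b : (0 < a < n)%N -> (b <= n)%N ->
  pairing (wall x0 a) (prefix_set s b) = (a == b)%:R.
Proof.
move=> /andP[a0 an] bn; have hs := chart_seqP F; have us := chart_seq_uniq F; have sz := size_chart_seq F.
have an' : (a.-1 < n)%N by apply: leq_ltn_trans an; apply: leq_pred.
rewrite pairing_root !mem_prefix // !index_uniq ?sz //.
rewrite prednK //; have [E|ne] := eqVneq a b.
  by rewrite E leqnn ltnn subr0.
by rewrite (leq_eqVlt a b) (negbTE ne) subrr.
Qed.

Definition face_ind (A : seq nat) m0 : lattice n -> int := fun m =>
  ((pairing (m0 + m) setT == 0) && [forall b : 'I_n, (0 < b)%N ==>
     (if (b : nat) \in A then pairing (m0 + m) (prefix_set s b) == 0
      else 0 <= pairing (m0 + m) (prefix_set s b))])%:R.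

Lemma face_ind_nil m0 : cone_ind (val F) m0 =1 face_ind [::] m0.
Proof.
move=> m; rewrite /cone_ind /face_ind /dual_cone; congr ((nat_of_bool (_ && _))%:R).
rewrite -flag_of_chart_seq; apply/forall_inP/'forall_implyP => h.
  by move=> b b0; apply: h; apply/flag_ofP; exists b; rewrite ?b0 /=.
by move=> S /flag_ofP [b /andP[b0 bn] ->]; have := h (Ordinal bn) b0.
Qed.

(** A cone minus its translate by the generator dual to the a-th member is the facet where that
    member pairs to 0. *)
Lemma face_ind_delta x0 A a m0 : (0 < a < n)%N -> a \notin A ->
  delta (wall x0 a) (face_ind A m0) =1 face_ind (a :: A) m0.
Proof.
move=> han aA m; have /andP[a0 an] := han; rewrite /delta /face_ind.
have E b : (b <= n)%N -> pairing (m0 + (m - wall x0 a)) (prefix_set s b) =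
    pairing (m0 + m) (prefix_set s b) - (a == b)%:R.
  move=> bn; rewrite (_ : m0 + (m - _) = (m0 + m) + - wall x0 a) ?addrA // pairingD pairingN pairing_wall //.
have ET : pairing (m0 + (m - wall x0 a)) setT = pairing (m0 + m) setT.
  have := E n (leqnn _); rewrite prefix_setT ?chart_seqP // => ->.
  by rewrite (ltn_eqF an) subr0.
rewrite ET; case: eqP => _ //=.
pose Q (b : 'I_n) := (0 < b)%N ==> (if (b : nat) \in A then pairing (m0 + m) (prefix_set s b) == 0
      else 0 <= pairing (m0 + m) (prefix_set s b)).
pose R := [forall b : 'I_n, (b != a :> nat) ==> Q b].
have H (Q' : pred 'I_n) : (forall b : 'I_n, b != a :> nat -> Q' b = Q b) ->
    [forall b, Q' b] = R && Q' (Ordinal an).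
  move=> h; apply/forallP/andP => [hQ|[/'forall_implyP hR hQ] b].
    by split=> //; apply/forallP => b; apply/implyP => ba; rewrite -h.
  have [ba|ba] := eqVneq (b : nat) a; last by rewrite h // hR.
  by have -> : b = Ordinal an by apply: val_inj.
rewrite !H /=; first last.
- by [].
- by move=> b ba; rewrite /Q E ?(ltnW (ltn_ord b)) // (_ : (a == b) = false) ?subr0 // eq_sym; apply: negbTE.
- by move=> b ba; rewrite /Q inE (negbTE ba).
rewrite a0 (negbTE aA) inE eqxx /= E ?eqxx; last exact: ltnW.
clear H; case: R => //=; move: (pairing _ _) => [[|y]|y] //=.
Qed.

Lemma face_ind_deltas x0 A m0 : uniq A -> (forall a, a \in A -> (0 < a < n)%N) ->
  deltas [seq wall x0 a | a <- A] (cone_ind (val F) m0) =1 face_ind A m0.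
Proof.
elim: A => [|a A IH] /=; first by move=> _ _ m; apply: face_ind_nil.
case/andP=> aA uA h m; rewrite -(face_ind_delta x0) ?h ?mem_head //.
by apply: eq_delta => {}m; apply: IH => // b bA; apply: h; rewrite inE bA orbT.
Qed.

Lemma face_ind_full m0 m : face_ind (iota 1 n.-1) m0 m = (m == - m0)%:R.
Proof.
congr (nat_of_bool _)%:R; have -> : (m == - m0) = (m0 + m == 0) by rewrite addrC addr_eq0.
apply/andP/eqP => [[/eqP hT /'forall_implyP h]|->]; last first.
  have z S : pairing (0 : lattice n) S = 0 by rewrite /pairing big1 // => i _; rewrite ffunE.
  by split; [rewrite z | apply/'forall_implyP => b b0; rewrite z eqxx; case: ifP].
have hs := chart_seqP F.
have z b : (b <= n)%N -> pairing (m0 + m) (prefix_set s b) = 0.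
  rewrite leq_eqVlt => /predU1P[->|bn]; first by rewrite prefix_setT.
  have [->|b0] := posnP b.
    rewrite /pairing big1 // => i; rewrite mem_prefix //.
  apply/eqP; have := h (Ordinal bn) b0; rewrite mem_iota /= b0 add1n prednK ?bn //.
  exact: leq_ltn_trans bn.
have jn j : (index j s < n)%N.
  by have := index_mem j s; rewrite (ordering_mem hs) {2}/s (size_chart_seq F) => ->.
by apply/ffunP => j; rewrite (pairing_prefix_succ _ j hs) !z ?ffunE ?subrr // ltnW.
Qed.

Definition walls x0 := [seq wall x0 a | a <- iota 1 n.-1].

Lemma iota_range a : a \in iota 1 n.-1 -> (0 < a < n)%N.
Proof. by rewrite mem_iota; case: (n) => [|n'] //=; case: a. Qed.

Lemma walls_uniq x0 : uniq (walls x0).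
Proof.
rewrite map_inj_in_uniq ?iota_uniq // => a b /iota_range ha /iota_range hb E.
have bn : (b <= n)%N by case/andP: hb => _ /ltnW.
have := pairing_wall x0 ha bn; rewrite E pairing_wall // eqxx; by case: eqP.
Qed.

Lemma walls_sub x0 : {subset walls x0 <= roots}.
Proof.
move=> d /mapP[a /iota_range /andP[a0 an] ->]; apply: mem_roots.
have sz := size_chart_seq F.
by rewrite nth_uniq ?chart_seq_uniq ?sz //; [case: (a) a0 => // ? _; rewrite neq_ltn leqnn | apply: leq_ltn_trans an; apply: leq_pred].
Qed.

Definition others x0 := [seq d <- roots | d \notin walls x0].

Lemma roots_walls x0 : perm_eq roots (others x0 ++ walls x0).
Proof.
rewrite perm_sym perm_catC.
apply: perm_trans (permEl (perm_filterC (mem (walls x0)) roots)); rewrite perm_cat2r.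
apply: uniq_perm; rewrite ?filter_uniq ?undup_uniq ?walls_uniq // => d.
by rewrite mem_filter; apply/idP/andP => [h|[]//]; split=> //; apply: walls_sub h.
Qed.

(** The roots that are walls cut the simplicial cone down to its apex; the remaining ones are left
    as operators. *)
Lemma deltas_chart x0 m0 :
  deltas roots (cone_ind (val F) m0) =1 deltas (others x0) (fun m => (m == - m0)%:R).
Proof.
move=> m; rewrite (deltas_perm _ (roots_walls x0)) deltas_cat; apply: eq_deltas => {}m.
rewrite face_ind_deltas ?iota_uniq ?face_ind_full //; exact: iota_range.
Qed.

Lemma link_prod_ratios x0 x s' : uniq (x :: s') -> link_prod t (Some x) s' *
  \prod_(a <- iota 0 (size s')) (1 - t (nth x0 (x :: s') a.+1) / t (nth x0 (x :: s') a)) = 1.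
Proof.
elim: s' x => [|y s' IH] x; first by rewrite big_nil mulr1.
rewrite cons_uniq inE negb_or => /andP[/andP[xy _] us]; rewrite [iota _ _]/= big_cons /=.
rewrite -[X in _ * (_ * X)](_ : \prod_(a <- iota 0 (size s')) (1 - t (nth x0 (y :: s') a.+1) / t (nth x0 (y :: s') a)) = _).
  by rewrite mulrACA link_ratio // mul1r IH.
by rewrite (iotaDl 1 0) big_map.
Qed.

Lemma dprod_walls x0 : link_prod t None s * dprod (walls x0) = 1.
Proof.
have sz : n.-1 = (size s).-1 by rewrite size_chart_seq.
rewrite /dprod /walls sz big_map /wall; under eq_bigr do rewrite mono_root.
have : uniq s by apply: chart_seq_uniq.
case: (s) => [|x s'] us; first by rewrite /= big_nil mulr1.
have := link_prod_ratios x0 us; rewrite /= /link mul1r (iotaDl 1 0) big_map; exact.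
Qed.

Lemma dprod_others x0 : dprod (others x0) = dprod roots * link_prod t None s.
Proof.
have -> : dprod roots = dprod (others x0) * dprod (walls x0).
  by rewrite /dprod -big_cat /=; apply: perm_big; apply: roots_walls.
by rewrite -mulrA (mulrC (dprod _) (link_prod _ _ _)) dprod_walls mulr1.
Qed.

End Chart.

Lemma common1 (F : chart n) : common [set F] = val F.
Proof. by rewrite /common big_set1. Qed.

(** If common members separated every pair, each T in F would be comparable with all members of G,
    hence lie in G by maximality, and F would be G. This is what puts a line into the cone of any
    intersection of two charts. *)
Lemma not_separated (F G : chart n) : F != G ->
  exists i j : 'I_n, i != j /\ forall S, S \in val F :&: val G -> (i \in S) = (j \in S).
Proof.
move=> FG; suff /existsP[i /existsP[j /andP[ij /forall_inP h]]] :
    [exists i : 'I_n, exists j : 'I_n, (i != j) && [forall S in val F :&: val G, (i \in S) == (j \in S)]].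
  by exists i, j; split=> // S hS; apply/eqP; apply: h.
apply: contraNT FG => /existsPn h.
have sep (i j : 'I_n) : i != j -> exists2 S, S \in val F :&: val G & (i \in S) != (j \in S).
  by move=> ij; have /existsPn/(_ j) := h i; rewrite ij => /forall_inPn.
have fF := maxsetp (valP F); have fG := maxsetp (valP G).
suff sFG : val F \subset val G.
  have /maxsetP[_ m] := valP F; by apply/eqP/val_inj; rewrite -(m _ fG sFG).
apply/subsetP => T TF.
have cmp S : S \in val G -> (S \subset T) || (T \subset S).
  move=> SG; apply: contraT; rewrite negb_or => /andP[/subsetPn[i iS iT] /subsetPn[j jT jS]].
  have ij : i != j by apply: contraNneq iT => ->.
  have [R] := sep i j ij; rewrite inE => /andP[RF RG].
  have := flag_subset fF RF TF; have := flag_subset fG RG SG.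
  case: (boolP (i \in R)) => iR; case: (boolP (j \in R)) => jR // a b _; [case/orP: b => c|case/orP: a => c].
  - by rewrite (subsetP c _ iR) in iT.
  - by have := subsetP c _ jT; rewrite (negbTE jR).
  - by have := subsetP c _ jR; rewrite (negbTE jS).
  - by have := subsetP c _ iS; rewrite (negbTE iR).
have fT : is_flag (T |: val G).
  rewrite /is_flag; apply/andP; split.
    apply/forall_inP => S; rewrite !inE => /predU1P[->|]; [exact: flag_proper fF TF|exact: flag_proper fG].
  apply/forall_inP => S; rewrite !inE => hS; apply/forall_inP => R; rewrite !inE.
  move: hS => /predU1P[->|SG] /predU1P[->|RG]; rewrite ?subxx //.
  - by rewrite orbC cmp.
  - exact: cmp.
  - exact: flag_subset fG SG RG.
have /maxsetP[_ m] := valP G; rewrite -(m _ fT (subsetUr _ _)); exact: setU11.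
Qed.

Variables (k : fieldType) (E : ebundle k n).
Hypothesis hn : (0 < n)%N.

Lemma deltas_hcount : deltas roots (hcount E) =1 fun m => \sum_F \sum_i
  deltas (others F (Ordinal hn)) (fun m => (m == - wt (e := E) F i)%:R) m.
Proof.
move=> m; rewrite (@eq_deltas roots _ (fun m => \sum_(W : {set chart n} | W != set0) (-1) ^+ #|W|.-1 *
    \sum_i cone_ind (common W) (wt (e := E) (rep W) i) m)); last first.
  move=> {}m; apply: eq_bigr => W _; congr (_ * _); rewrite -sum1dep_card (big_morph Posz PoszD (erefl _)).
  by rewrite big_mkcond; apply: eq_bigr => i _; rewrite /cone_ind; case: ifP.
rewrite deltas_sum (eq_bigr (fun W : {set chart n} => (-1) ^+ #|W|.-1 *
    \sum_i deltas roots (cone_ind (common W) (wt (e := E) (rep W) i)) m)); last first.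
  by move=> W _; rewrite deltasZ deltas_sum.
rewrite (bigID (fun W : {set chart n} => #|W| == 1%N)) /= [X in _ + X]big1 ?addr0; last first.
  move=> W /andP[W0 W1]; rewrite big1 ?mulr0 // => i _.
  have [F FW] := set0Pn _ W0.
  have : (0 < #|W :\ F|)%N by move: W1; rewrite (cardsD1 F W) FW; case: #|_|.
  case/card_gt0P => G; rewrite !inE => /andP[GF GW].
  have [a [b [ab h]]] := not_separated GF.
  by apply: (cone_ind_killed _ ab) => S SW; apply: h; rewrite inE !(subsetP (common_sub _) _ SW).
rewrite (eq_bigl (mem [set [set F] | F : chart n])); last first.
  move=> W; apply/andP/imsetP => [[_ /cards1P[F ->]]|[F _ ->]]; first by exists F.
  by rewrite cards1 -card_gt0 cards1.
rewrite big_imset /=; last by move=> F G _ _; apply: set1_inj.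
apply: eq_bigr => F _; rewrite cards1 expr0 mul1r; apply: eq_bigr => i _.
have R : rep [set F] = F by apply/set1P/rep_mem/set0Pn; exists F; apply: set11.
move: i; rewrite R common1 => i; exact: deltas_chart.
Qed.

(** Compared after multiplication by the nonzero product over all roots, since the contribution of a
    single chart has finite support only then. *)
Lemma gen_hcount x : gen (hcount E) x ->
  x = \sum_(F : chart n) link_prod t None (chart_seq F) * \sum_i mono (wt (e := E) F i).
Proof.
move=> h; apply: (mulfI dprod_roots_neq0).
apply: gen_uniq (gen_deltas roots h) _.
apply: (eq_gen (fun m => esym (deltas_hcount m))); rewrite mulr_sumr.
apply: gen_sum => F _; rewrite mulrA mulr_sumr; apply: gen_sum => i _.
rewrite -(dprod_others F (Ordinal hn)); apply: gen_deltas.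
by rewrite -{2}(opprK (wt F i)); apply: gen_delta.
Qed.

Lemma euler_char_gen : is_ebundle E -> exists L (c : lattice n -> int),
  \sum_(F : chart n) link_prod t None (chart_seq F) * \sum_i mono (wt (e := E) F i) =
    \sum_(m <- L) (c m)%:~R * mono m /\ euler_char E = \sum_(m <- L) c m.
Proof.
move=> hE; have [L [uL hL ->]] := euler_char_weights hE.
exists [seq - m | m <- L], (fun m => hcount E (- m)); split; last first.
  by rewrite big_map; apply: eq_bigr => m _; rewrite opprK.
rewrite -(gen_hcount (x := \sum_(m <- L) (hcount E m)%:~R * mono (- m))); last by exists L.
by rewrite big_map; apply: eq_bigr => m _; rewrite opprK.
Qed.

End GeneratingFunction.

(** * Specialization to powers of s and evaluation at s = 1 *)

Definition ratl := {fraction {poly {poly int}}}.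
Definition var_s : ratl := FracField.tofrac 'X.
Definition var_u : ratl := FracField.tofrac ('X%:P).
(** Distinct powers of one variable keep all links defined and reduce evaluation at t = 1 to that of
    a polynomial in one variable. *)
Definition tpow n (i : 'I_n) : ratl := var_s ^+ i.

(* x lies in Z[u][s, 1/s] and its value at s = 1 is y. *)
Definition at1 (x : ratl) (y : {poly int}) : Prop :=
  exists N (g : {poly {poly int}}), var_s ^+ N * x = FracField.tofrac g /\ g.[1] = y.

Lemma var_s_neq0 : var_s != 0.
Proof. by rewrite /var_s tofrac_eq0 polyX_eq0. Qed.

Lemma at1_1 : at1 1 1.
Proof. by exists 0%N, 1; rewrite expr0 mulr1 rmorph1 hornerC. Qed.

Lemma at1D x y a b : at1 x a -> at1 y b -> at1 (x + y) (a + b).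
Proof.
move=> [N [g [Eg <-]]] [M [h [Eh <-]]]; exists (N + M)%N, ('X^M * g + 'X^N * h); split.
  by rewrite rmorphD !rmorphM !rmorphXn /= -Eg -Eh -/var_s exprD; ring.
by rewrite hornerD !hornerM !hornerXn !expr1n !mul1r.
Qed.

Lemma at1N x a : at1 x a -> at1 (- x) (- a).
Proof.
move=> [N [g [Eg <-]]]; exists N, (- g); split; last exact: hornerN.
by rewrite rmorphN /= -Eg mulrN.
Qed.

Lemma at1M x y a b : at1 x a -> at1 y b -> at1 (x * y) (a * b).
Proof.
move=> [N [g [Eg <-]]] [M [h [Eh <-]]]; exists (N + M)%N, (g * h); split.
  by rewrite rmorphM /= -Eg -Eh exprD; ring.
by rewrite hornerM.
Qed.

Lemma at1_u : at1 var_u 'X.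
Proof. by exists 0%N, 'X%:P; rewrite expr0 mul1r hornerC. Qed.

Lemma at1_tpow n (i : 'I_n) (c : int) : at1 (tpow i ^ c) 1.
Proof.
case: c => c; rewrite ?NegzE /tpow.
  exists 0%N, 'X^(i * c); rewrite expr0 mul1r hornerXn expr1n rmorphXn; split=> //.
  by rewrite -exprnP exprM.
exists (i * c.+1)%N, 1; rewrite hornerC rmorph1; split=> //.
by rewrite -exprnN -exprM divff // expf_neq0 // var_s_neq0.
Qed.

Lemma at1_uniq x a b : at1 x a -> at1 x b -> a = b.
Proof.
move=> [N [g [Eg <-]]] [M [h [Eh <-]]].
have E : 'X^M * g = 'X^N * h.
  apply/eqP; rewrite -tofrac_eq; apply/eqP.
  by rewrite !rmorphM !rmorphXn /= -Eg -Eh -/var_s; ring.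
by have := congr1 (fun p => p.[1]) E; rewrite !hornerM !hornerXn !expr1n !mul1r.
Qed.

Lemma tpow_neq0 n (i : 'I_n) : tpow i != 0.
Proof. by rewrite expf_neq0 // var_s_neq0. Qed.

Lemma tpow_inj n : injective (@tpow n).
Proof.
move=> i j E; apply: val_inj; apply/eqP.
have : FracField.tofrac ('X^i - 'X^j : {poly {poly int}}) == 0.
  by rewrite rmorphB !rmorphXn /= subr_eq0; apply/eqP.
rewrite tofrac_eq0 subr_eq0 => /eqP /(congr1 (fun p : {poly {poly int}} => size p)).
by rewrite !size_polyXn => /eqP; rewrite eqSS.
Qed.

Lemma at1_int (c : int) : at1 c%:~R c%:P.
Proof.
exists 0%N, c%:P%:P; rewrite expr0 mul1r hornerC; split=> //.
by rewrite -[in RHS](intz c) !rmorph_int.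
Qed.

Lemma at1_sum (J : Type) (r : seq J) (P : pred J) (f : J -> ratl) (g : J -> {poly int}) :
  (forall j, P j -> at1 (f j) (g j)) ->
  at1 (\sum_(j <- r | P j) f j) (\sum_(j <- r | P j) g j).
Proof.
move=> h; apply: big_ind2 => //; last by move=> *; apply: at1D.
by exists 0%N, 0; rewrite expr0 mulr0 rmorph0 horner0.
Qed.

Lemma at1_prod1 (J : Type) (r : seq J) (P : pred J) (f : J -> ratl) :
  (forall j, P j -> at1 (f j) 1) -> at1 (\prod_(j <- r | P j) f j) 1.
Proof.
move=> h; apply: (big_ind (fun x => at1 x 1)) => //; first exact: at1_1.
by move=> x y hx hy; rewrite -[X in at1 _ X]mulr1; apply: at1M.
Qed.

Lemma at1_mono n (m : lattice n) : at1 (mono (@tpow n) m) 1.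
Proof. by apply: at1_prod1 => i _; apply: at1_tpow. Qed.

Lemma at1_laurent n (L : seq (lattice n)) (c : lattice n -> int) :
  at1 (\sum_(m <- L) (c m)%:~R * mono (@tpow n) m) (\sum_(m <- L) c m)%:P.
Proof.
rewrite rmorph_sum; apply: at1_sum => m _; rewrite -[X in at1 _ X]mulr1.
by apply: at1M; [apply: at1_int | apply: at1_mono].
Qed.

(** * Line bundles *)

Section Units.
Variables (k : fieldType) (n : nat).
Implicit Types (m d : lattice n) (a b : ratfun k n).
Local Notation rc := (@rconst k n).
Local Notation rm := (@rmonom k n).

(** A vector is read as the coefficients of a polynomial and evaluated at a natural number that is
    no root of the product of the polynomials of the nonzero vectors in D. *)
Lemma separating_weight (D : seq (lattice n)) :
  exists w : lattice n -> int, {morph w : m d / m + d} /\ {in D, forall d, w d = 0 -> d = 0}.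
Proof.
pose pd (d : lattice n) : {poly int} := \sum_(i < n) d i *: 'X^i.
have pd_coef d (i : 'I_n) : (pd d)`_i = d i.
  rewrite coef_sum (bigD1 i) //= coefZ coefXn eqxx mulr1 big1 ?addr0 // => j ji.
  by rewrite coefZ coefXn eq_sym (inj_eq val_inj) (negbTE ji) mulr0.
have pd0 d : pd d = 0 -> d = 0 by move=> h; apply/ffunP => i; rewrite ffunE -pd_coef h coef0.
pose P := \prod_(d <- D | d != 0) pd d.
have P0 : P != 0 by rewrite prodf_seq_neq0; apply/allP => d _; apply/implyP; apply: contra_neq => /pd0.
pose rs := [seq i%:Z | i <- iota 0 (size P)].
have : ~~ all (root P) rs.
  apply/negP => h; have := max_poly_roots P0 h; rewrite map_inj_uniq ?iota_uniq => [|i j [] //].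
  by rewrite size_map size_iota ltnn => /(_ isT).
case/allPn => x _ xr; exists (fun d => (pd d).[x]); split=> [m d|d dD h].
  rewrite /pd -hornerD -big_split; congr (_.[x]); apply: eq_bigr => i _.
  by rewrite ffunE scalerDl.
apply: contraNeq xr => d0; rewrite /P /root horner_prod.
elim: D dD {P P0 rs} => // d' D IH; rewrite inE big_cons => /predU1P[<-|dD].
  by rewrite d0 h mul0r.
by case: ifP => _; [rewrite mulf_eq0 IH ?orbT | apply: IH].
Qed.

Lemma lcoefM a b A m : is_laur a -> is_laur b -> uniq A -> (forall d, lcoef a d != 0 -> d \in A) ->
  lcoef (a * b) m = \sum_(d <- A) lcoef a d * lcoef b (m - d).
Proof.
move=> ha hb uA hA; rewrite {1}(lcoefE ha uA hA) mulr_suml lcoef_sum; last first.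
  by move=> d _; apply: is_laur_scale.
by apply: eq_bigr => d _; rewrite lcoef_scale.
Qed.

Lemma laur_top a b (w : lattice n -> int) (A B : seq (lattice n)) m d : is_laur a -> is_laur b -> {morph w : m d / m + d} ->
  uniq A -> (forall e, (e \in A) = (lcoef a e != 0)) -> (forall e, (e \in B) = (lcoef b e != 0)) ->
  m \in A -> d \in B -> {in A, forall e, e != m -> w e < w m} -> {in B, forall e, w e <= w d} ->
  lcoef (a * b) (m + d) != 0.
Proof.
move=> ha hb hw uA hA hB mA dB mm dd.
rewrite (lcoefM _ ha hb uA); last by move=> e; rewrite -hA.
rewrite (big_rem m) //= big_seq big1 ?addr0.
  by rewrite addrAC subrr add0r mulf_neq0 -?hA -?hB.
move=> e; rewrite mem_rem_uniq // inE => /andP[em eA].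
suff /negbTE : (m + d - e) \notin B by rewrite hB => /negbFE /eqP ->; rewrite mulr0.
apply/negP => /dd; apply/negP; rewrite -ltNge.
have := hw (m + d - e) e; rewrite subrK hw => E; have := mm e eA em.
by move: (w m) (w d) (w e) (w _) E; clear; lia.
Qed.

Lemma seq_argmax (T : eqType) (A : seq T) (w : T -> int) : A != [::] ->
  exists2 m, m \in A & {in A, forall e, w e <= w m}.
Proof.
elim: A => // x A IH _; have [->|A0] := eqVneq A [::].
  by exists x; rewrite ?mem_head // => e; rewrite inE => /eqP ->.
have [m mA hm] := IH A0; case: (lerP (w x) (w m)) => h.
  exists m; rewrite ?inE ?mA ?orbT // => e; rewrite inE => /predU1P[->|/hm] //.
exists x; rewrite ?mem_head // => e; rewrite inE => /predU1P[->|/hm] // h'.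
exact: le_trans h' (ltW h).
Qed.

Lemma exact_supp a : is_laur a -> exists2 A : seq (lattice n), uniq A & forall e, (e \in A) = (lcoef a e != 0).
Proof.
move=> /lcoef_supp [A [uA hA]]; exists [seq e <- A | lcoef a e != 0]; first exact: filter_uniq.
by move=> e; rewrite mem_filter; case: eqP => //= /eqP /hA.
Qed.

(** For a weight injective on the support of a, the top exponents of a and b add up to 0, since
    their product term cannot cancel; the same holds for the bottom exponents. So top and bottom of
    a have equal weight, and its support is one point. *)
Lemma laur_unit a b : is_laur a -> is_laur b -> a * b = 1 -> exists c m, a = rc c * rm m.
Proof.
move=> ha hb ab; have [A uA hA] := exact_supp ha; have [B uB hB] := exact_supp hb.
have [w [wD w0]] := separating_weight ([seq e - e' | e <- A, e' <- A] ).
have wN e : w (- e) = - w e.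
  have w00 : w 0 = 0 by have := wD 0 0; rewrite addr0 => /eqP; rewrite -subr_eq0 opprD addNKr oppr_eq0 => /eqP.
  by apply/eqP; rewrite -addr_eq0 -wD addNr w00.
have winj : {in A &, injective w}.
  move=> e e' eA e'A E; apply/eqP; rewrite -subr_eq0; apply/eqP/w0; last by rewrite wD wN E subrr.
  by apply/allpairsP; exists (e, e').
have top (v : lattice n -> int) : {morph v : m d / m + d} -> {in A &, injective v} ->
    exists m d, [/\ m \in A, d \in B, m + d = 0, {in A, forall e, v e <= v m} & {in B, forall e, v e <= v d}].
  move=> vD vi.
  have supp0 (c : ratfun k n) : c != 0 -> is_laur c -> forall C : seq (lattice n), (forall e : lattice n, (e \in C) = (lcoef c e != 0)) -> C != [::].
    move=> c0 hc C hC; apply: contra_neq c0 => C0; apply: (lcoef_inj hc) => [|e]; first exact: is_laur0.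
    by apply/eqP; rewrite lcoef0; have := hC e; rewrite C0 in_nil => /esym /negbFE.
  have a0 : a != 0 by apply: contra_eq_neq ab => ->; rewrite mul0r eq_sym oner_eq0.
  have b0 : b != 0 by apply: contra_eq_neq ab => ->; rewrite mulr0 eq_sym oner_eq0.
  have [m mA hm] := seq_argmax v (supp0 _ a0 ha _ hA); have [d dB hd] := seq_argmax v (supp0 _ b0 hb _ hB).
  exists m, d; split=> //.
  have : lcoef (a * b) (m + d) != 0.
    apply: (laur_top ha hb vD uA hA hB mA dB) => // e eA em.
    by rewrite lt_neqAle hm // andbT; apply: contra_neq em; apply: vi.
  rewrite ab -[1]mul1r -{1}(rconst1 k n) -(rmonom0 k n) lcoef_monom.
  by case: (0 =P m + d) => [<- //|_]; rewrite eqxx.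
have [m [d [mA dB md hm hd]]] := top w wD winj.
have [|e e' eA e'A|m' [d' [m'A d'B md' hm' hd']]] := top (fun e => - w e).
- by move=> e e'; rewrite wD opprD.
- by move=> /oppr_inj; apply: winj.
have E : m' = m.
  apply: winj => //; have := hm _ m'A; have := hd _ d'B; have := wD m d; have := wD m' d'.
  rewrite md md'; have := wD 0 0; rewrite addr0.
  by move: (w m) (w d) (w m') (w d') (w 0); clear; lia.
have A1 e : e \in A -> e = m.
  move=> eA; apply: winj => //; have := hm _ eA; have := hm' _ eA; rewrite E.
  by move: (w e) (w m); clear; lia.
exists (lcoef a m), m; apply: lcoef_inj => // [|e]; first exact: is_laur_monom.
rewrite lcoef_monom; case: (eqVneq m e) => [->//|me].
by apply/eqP; move: me; apply: contraNT; rewrite -hA => /A1 ->; rewrite eqxx.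
Qed.

End Units.

(** * Linearization and heights of a line bundle *)

Section LineBundle.
Variables (k : fieldType) (n : nat) (L : line k n).
Hypothesis hL : is_bundle (line_bundle L).
Local Notation rc := (@rconst k n).
Local Notation rm := (@rmonom k n).

Lemma line_regular (F G : chart n) : regular (val F :&: val G) (L F G).
Proof. by case: hL => h _ _; apply: (h F G tt tt). Qed.

Lemma line_diag (F : chart n) : L F F = 1.
Proof. by case: hL => _ h _; rewrite -[RHS](h F tt tt). Qed.

Lemma line_trans (F G P : chart n) : L F G * L G P = L F P.
Proof.
case: hL => _ _ h; by rewrite -[RHS](h F G P tt tt) [RHS](bigD1 tt) //= big1 ?addr0 // => -[].
Qed.

Definition line_deg (F G : chart n) : lattice n :=
  epsilon (inhabits 0) (fun m => exists c, L F G = rc c * rm m).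

(** The transition functions in the two directions are Laurent polynomials with product 1, so
    [laur_unit] applies. *)
Lemma line_degP F G : exists2 c, c != 0 & L F G = rc c * rm (line_deg F G).
Proof.
have E : L F G * L G F = 1 by rewrite line_trans line_diag.
have [c' [m' h']] : exists c m, L F G = rc c * rm m.
  apply: laur_unit E; first by have /regularP[] := line_regular F G.
  by have /regularP[] := line_regular G F.
have [c hc] := epsilon_spec (inhabits 0) (fun m => exists c, L F G = rc c * rm m)
  (ex_intro _ m' (ex_intro _ c' h')).
exists c => //; apply: contra_eq_neq E => c0.
by rewrite hc c0 rconst0 !mul0r eq_sym oner_eq0.
Qed.

Lemma monom_inj c c' (m m' : lattice n) : c != 0 -> rc c * rm m = rc c' * rm m' -> m = m'.
Proof.
move=> c0 E; have := lcoef_monom c m m; rewrite E lcoef_monom eqxx.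
by case: eqP => // _ h; rewrite -h eqxx in c0.
Qed.

Lemma line_degD F G P : line_deg F G + line_deg G P = line_deg F P.
Proof.
have [c c0 E] := line_degP F G; have [c' c'0 E'] := line_degP G P; have [c'' _ E''] := line_degP F P.
apply: (@monom_inj (c * c') c''); first exact: mulf_neq0.
by rewrite -E'' -(line_trans F G P) E E' rconstM rmonomD; ring.
Qed.

Lemma line_deg_diag F : line_deg F F = 0.
Proof. by have /eqP := line_degD F F F; rewrite -subr_eq0 addrK => /eqP. Qed.

Lemma line_degN F G : line_deg G F = - line_deg F G.
Proof. by apply/eqP; rewrite -addr_eq0 line_degD line_deg_diag. Qed.

Lemma line_deg_cone F G : dual_cone (val F :&: val G) (line_deg F G).
Proof.
have [_] := (regularP _ _).1 (line_regular F G); apply.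
by have [c c0 ->] := line_degP F G; rewrite lcoef_monom eqxx.
Qed.

Lemma line_deg_setT F G : pairing (line_deg F G) setT = 0.
Proof. by apply/eqP; case/andP: (line_deg_cone F G). Qed.

(** The transition function and its inverse are both regular on the intersection of the two charts,
    which gives both inequalities. *)
Lemma line_deg_face (F G : chart n) (S : {set 'I_n}) : S \in val F -> S \in val G -> pairing (line_deg F G) S = 0.
Proof.
move=> SF SG; have SFG : S \in val F :&: val G by rewrite inE SF.
have /andP[_ /forall_inP/(_ _ SFG) h1] := line_deg_cone F G.
have /andP[_ /forall_inP] := line_deg_cone G F; rewrite setIC => /(_ _ SFG).
by rewrite line_degN pairingN oppr_ge0 => h2; apply/eqP; rewrite eq_le h1 h2.
Qed.

(** The reference chart is arbitrary; its choice fixes one linearization. *)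
Definition line_wt (F : chart n) : lattice n := line_deg F (chart_of (enum_ordering n)).

Lemma line_wtB F G : line_wt F - line_wt G = line_deg F G.
Proof. by apply/eqP; rewrite subr_eq line_degD. Qed.

Definition line_ebundle : ebundle k n := @EBundle k n (line_bundle L) (fun F _ => line_wt F).

Lemma line_is_ebundle : is_ebundle line_ebundle.
Proof.
split=> // F G i j; have [c _ E] := line_degP F G.
by exists c; rewrite /= line_wtB E.
Qed.

(* The sets set0 and setT lie in no chart and get height 0. *)
Definition line_height (S : {set 'I_n}) : int :=
  if [pick F : chart n | S \in val F] is Some F then pairing (line_wt F) S else 0.

Lemma line_height_prefix (F : chart n) j : (j <= n)%N ->
  line_height (prefix_set (chart_seq F) j) = pairing (line_wt F) (prefix_set (chart_seq F) j).
Proof.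
have hs := chart_seqP F; rewrite /line_height; case: pickP => [G SG|h] jn.
  have fG := maxsetp (valP G); have := flag_proper fG SG; have [j0|j0] := posnP j.
    by rewrite (_ : prefix_set _ _ = set0) ?eqxx //; apply/setP => y; rewrite mem_prefix // inE j0.
  move: jn; rewrite leq_eqVlt => /predU1P[E|jn].
    by rewrite (prefix_setT hs) ?E ?leqnn // eqxx andbF.
  move=> _; apply/eqP; rewrite -subr_eq0 -pairingN -pairingD line_wtB line_deg_face //.
  by rewrite -flag_of_chart_seq; apply/flag_ofP; exists j; rewrite ?j0.
have [j0|j0] := posnP j.
  by rewrite /pairing big1 // => y; rewrite mem_prefix // j0.
move: jn; rewrite leq_eqVlt => /predU1P[E|jn].
  by rewrite (prefix_setT hs) ?E ?leqnn // line_deg_setT.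
have := h F; rewrite -flag_of_chart_seq => /negP[].
by apply/flag_ofP; exists j; rewrite ?j0.
Qed.

Lemma line_wt_step (F : chart n) s1 x s2 : chart_seq F = s1 ++ x :: s2 ->
  line_wt F x = line_height (x |: [set y in s1]) - line_height [set y in s1].
Proof.
move=> E; have hs := chart_seqP F; have us := chart_seq_uniq F; have sz := size_chart_seq F.
have ix : index x (chart_seq F) = size s1.
  rewrite E index_cat /= eqxx addn0; case: ifP => // xs1.
  by move: us; rewrite E cat_uniq /= xs1 andbF.
have p1 : [set y in s1] = prefix_set (chart_seq F) (size s1).
  by rewrite /prefix_set E take_size_cat.
have p2 : x |: [set y in s1] = prefix_set (chart_seq F) (size s1).+1.
  rewrite /prefix_set E -cat_rcons take_size_cat ?size_rcons //.
  by apply/setP => y; rewrite !inE mem_rcons inE.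
have ss : ((size s1).+1 <= n)%N by rewrite -[X in (_ <= X)%N]sz E size_cat /= addnS ltnS leq_addr.
by rewrite p2 p1 !line_height_prefix ?(ltnW ss) // (pairing_prefix_succ _ x hs) ix.
Qed.

End LineBundle.

Lemma frac_numden (R : idomainType) (x : {fraction R}) :
  exists p q : R, q != 0 /\ x = FracField.tofrac p / FracField.tofrac q.
Proof.
elim/generic_quotient.quotW: x => x; exists (frac x).1, (frac x).2; split; first exact: denom_ratioP.
have d0 : FracField.tofrac (frac x).2 != 0 by rewrite tofrac_eq0 denom_ratioP.
apply: (mulIf d0); rewrite divfK //; unlock FracField.tofrac; rewrite -[LHS]FracField.pi_mul.
apply/generic_quotient.eqmodP; rewrite /= FracField.equivfE /FracField.mulf !numden_Ratio ?oner_eq0 ?mulr1 ?denom_ratioP //.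
by rewrite mulrC.
Qed.

(** * Places of the rational function field *)

Section Line.
Variable k : fieldType.
Implicit Types (p q r : {poly k}).
Let K := {fraction {poly k}}.
Local Notation tf := (@FracField.tofrac {poly k}).

Definition scalar_frac : {rmorphism k -> K} := tf \o polyC.
Let f := scalar_frac.

(* The order of vanishing at infinity. *)
Definition vinf (x : K) : int :=
  let pq := epsilon (inhabits (0, 0)) (fun pq : {poly k} * {poly k} => pq.2 != 0 /\ x = tf pq.1 / tf pq.2) in
  if x == 0 then 0 else (size pq.2)%:Z - (size pq.1)%:Z.

Lemma vinfE p q : p != 0 -> q != 0 -> vinf (tf p / tf q) = (size q)%:Z - (size p)%:Z.
Proof.
move=> p0 q0; rewrite /vinf; set P := fun pq => _.
have := epsilon_spec (inhabits (0, 0)) P (ex_intro P (p, q) (conj q0 erefl)).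
move: (epsilon _ _) => [p' q'] [/= q'0].
rewrite mulf_eq0 invr_eq0 !tofrac_eq0 (negbTE p0) (negbTE q0) /=.
move/eqP; rewrite eqr_div ?tofrac_eq0 // -!tofracM tofrac_eq => /eqP E.
have p'0 : p' != 0.
  by apply: contra_eq_neq E => ->; rewrite mul0r mulf_neq0.
have := congr1 (fun r : {poly k} => size r) E; rewrite !size_mul //.
move: p0 q0 p'0 q'0; rewrite -!size_poly_gt0.
move: (size p) (size q) (size p') (size q') => a b c d; clear; lia.
Qed.

Lemma vinf0 : vinf 0 = 0. Proof. by rewrite /vinf eqxx. Qed.

Lemma vinf_poly p : p != 0 -> vinf (tf p) = 1 - (size p)%:Z.
Proof. by move=> p0; rewrite -[tf p]divr1 -tofrac1 vinfE ?oner_eq0 // size_poly1. Qed.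

Lemma scalar_fracE c : f c = tf c%:P. Proof. by []. Qed.

Lemma frac_common (x y : K) : exists p q r, [/\ r != 0, x = tf p / tf r & y = tf q / tf r].
Proof.
have [p [q [q0 ->]]] := frac_numden x; have [p' [q' [q'0 ->]]] := frac_numden y.
exists (p * q'), (p' * q), (q * q'); split; rewrite ?mulf_neq0 // !tofracM.
  by rewrite -mulf_div divff ?mulr1 // tofrac_eq0.
by rewrite (mulrC (tf q)) -mulf_div divff ?mulr1 // tofrac_eq0.
Qed.

Lemma frac_neq0 p r : r != 0 -> (tf p / tf r != 0) = (p != 0).
Proof. by move=> r0; rewrite mulf_eq0 invr_eq0 !tofrac_eq0 (negbTE r0) orbF. Qed.

Lemma frac_num_neq0 x p r : r != 0 -> x = tf p / tf r -> x != 0 -> p != 0.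
Proof. by move=> r0 -> ; rewrite frac_neq0. Qed.

Lemma vinf_frac x p r : p != 0 -> r != 0 -> x = tf p / tf r -> vinf x = (size r)%:Z - (size p)%:Z.
Proof. by move=> p0 r0 ->; apply: vinfE. Qed.

Lemma vinf_place : is_place f vinf.
Proof.
split.
- exact: vinf0.
- move=> c; have [->|c0] := eqVneq c 0; first by rewrite rmorph0 vinf0.
  by rewrite scalar_fracE vinf_poly ?polyC_eq0 // size_polyC c0.
- move=> a b; have [p [q [r [r0 Ea Eb]]]] := frac_common a b => a0 b0.
  have p0 := frac_num_neq0 r0 Ea a0; have q0 := frac_num_neq0 r0 Eb b0.
  have Eab : a * b = tf (p * q) / tf (r * r) by rewrite Ea Eb mulf_div !tofracM.
  have va := vinf_frac p0 r0 Ea; have vb := vinf_frac q0 r0 Eb.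
  have vab := vinf_frac (mulf_neq0 p0 q0) (mulf_neq0 r0 r0) Eab.
  rewrite va vb vab (size_mul p0 q0) (size_mul r0 r0).
  move: p0 q0 r0; rewrite -!size_poly_gt0; move: (size p) (size q) (size r) => x y z; clear; lia.
- move=> a b; have [p [q [r [r0 Ea Eb]]]] := frac_common a b => a0 b0 ab0.
  have Eab : a + b = tf (p + q) / tf r by rewrite Ea Eb tofracD mulrDl.
  have va := vinf_frac (frac_num_neq0 r0 Ea a0) r0 Ea.
  have vb := vinf_frac (frac_num_neq0 r0 Eb b0) r0 Eb.
  have vab := vinf_frac (frac_num_neq0 r0 Eab ab0) r0 Eab.
  rewrite va vb vab; have := size_polyD p q.
  move: (size p) (size q) (size r) (size (p + q)) => x y z w; clear; lia.
- exists (tf 1 / tf 'X); rewrite vinfE ?oner_eq0 ?polyX_eq0 // size_polyX size_poly1; lia.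
Qed.

(** The residue of p / q at infinity is the coefficient of p in the degree of q, divided by the
    leading coefficient of q. *)
Lemma vinf_degree : place_degree f vinf 1.
Proof.
exists (fun _ => 1); split=> [_|x hx].
  by right; rewrite -tofrac1 vinf_poly ?oner_eq0 // size_poly1.
have sub1 (c : {ffun 'I_1 -> k}) : \sum_i f (c i) * 1 = f (c ord0) by rewrite big_ord1 mulr1.
have [p [q [q0 Ex]]] := frac_numden x.
have subE c : x - f c = tf (p - c *: q) / tf q.
  rewrite Ex scalar_fracE -mul_polyC tofracB tofracM mulrBl mulfK //.
  by rewrite tofrac_eq0.
have spq : (size p <= size q)%N.
  have [->|p0] := eqVneq p 0; first by rewrite size_poly0.
  case: hx => [/eqP|]; first by rewrite Ex -[_ == 0]negbK frac_neq0 // p0.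
  by rewrite Ex vinfE // subr_ge0.
exists [ffun _ => p`_(size q).-1 / lead_coef q]; split.
  rewrite sub1 ffunE subE /val_ideal.
  have [->|n0] := eqVneq (p - (p`_(size q).-1 / lead_coef q) *: q) 0.
    by left; rewrite tofrac0 mul0r.
  right; rewrite vinfE // subr_gt0 ltz_nat ltn_neqAle.
  have le : (size (p - (p`_(size q).-1 / lead_coef q) *: q)%R <= size q)%N.
    apply: leq_trans (size_polyD _ _) _; rewrite geq_max spq size_polyN.
    by apply: leq_trans (size_scale_leq _ _) _.
  rewrite le andbT; apply: contra n0 => /eqP E.
  rewrite -lead_coef_eq0 lead_coefE E coefB coefZ -lead_coefE divfK ?subrr //.
  by rewrite lead_coef_eq0.
move=> c'; rewrite sub1 subE => h; apply/ffunP => i; rewrite ffunE (ord1 i).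
apply: (mulIf (x := lead_coef q)); first by rewrite lead_coef_eq0.
rewrite divfK ?lead_coef_eq0 //.
have : (p - c' ord0 *: q)`_(size q).-1 = 0.
  have [->|n0] := eqVneq (p - c' ord0 *: q) 0; first by rewrite coef0.
  case: h => [/eqP|]; first by rewrite -[_ == 0]negbK frac_neq0 // n0.
  rewrite vinfE // subr_gt0 ltz_nat => h; apply: nth_default.
  by case: (size q) h.
by rewrite coefB coefZ -lead_coefE => /subr0_eq.
Qed.

Lemma horner_scalar_frac p : (map_poly f p).[tf 'X] = tf p.
Proof.
rewrite -[p in RHS]coefK poly_def rmorph_sum horner_coef size_map_poly.
apply: eq_bigr => i _; rewrite coef_map -mul_polyC /= tofracM tofracXn.
by [].
Qed.

Lemma rational_curve : is_curve_field f.
Proof.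
exists (tf 'X), [:: 1]; split=> [p|y].
  by rewrite horner_scalar_frac => /eqP; rewrite tofrac_eq0 => /eqP.
have [p [q [q0 ->]]] := frac_numden y; exists q, (fun _ => p).
by rewrite !horner_scalar_frac tofrac_eq0 big_ord1 /= mulr1 mulrC divfK ?tofrac_eq0.
Qed.

Section Place.
Variable v : K -> int.
Hypothesis hv : is_place f v.

Lemma place1 : v 1 = 0.
Proof. by case: hv => _ h _ _ _; rewrite -(rmorph1 f) h. Qed.

Lemma placeN a : v (- a) = v a.
Proof.
have [->|a0] := eqVneq a 0; first by rewrite oppr0.
case: hv => _ h hM _ _; rewrite -mulN1r hM ?oppr_eq0 ?oner_eq0 //.
by rewrite -(rmorph1 f) -rmorphN h add0r.
Qed.

Lemma place_ltD a b : a != 0 -> b != 0 -> v a < v b -> a + b != 0 /\ v (a + b) = v a.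
Proof.
move=> a0 b0 ab; case: (hv) => _ _ _ hD _.
have ab0 : a + b != 0.
  by apply: contraTneq ab => /eqP; rewrite addr_eq0 => /eqP ->; rewrite placeN ltxx.
have := hD _ _ a0 b0 ab0; have := hD (a + b) (- b) ab0; rewrite oppr_eq0 addrK placeN.
move=> /(_ b0 a0) h1 h2; split=> //.
by move: (v a) (v b) (v (a + b)) ab h1 h2; clear; lia.
Qed.

(** If X has a pole, different powers of X have different values, so the leading term decides. *)
Lemma place_poly_lt0 p : v (tf 'X) < 0 -> p != 0 -> v (tf p) = ((size p).-1)%:Z * v (tf 'X).
Proof.
move=> hX; case: (hv) => _ hc hM hD _; elim/poly_ind: p => [|p c IH]; first by rewrite eqxx.
move=> n0; rewrite size_MXaddC; have [p0|p0] := eqVneq p 0.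
  rewrite p0 mul0r add0r -scalar_fracE hc size_poly0.
  by case: ifP => _; rewrite mul0r.
rewrite /=.
have X0 : tf 'X != 0 by rewrite tofrac_eq0 polyX_eq0.
have tp0 : tf p != 0 by rewrite tofrac_eq0.
have E : v (tf (p * 'X)) = (size p)%:Z * v (tf 'X).
  rewrite tofracM (hM _ _ tp0 X0) (IH p0); move: p0; rewrite -size_poly_gt0; case: (size p) => // s _ /=.
  by rewrite -addn1 PoszD; ring.
have [->|c0] := eqVneq c 0; first by rewrite addr0.
have p1 : tf (p * 'X) != 0 by rewrite tofracM (mulf_neq0 tp0 X0).
have tc0 : tf c%:P != 0 by rewrite tofrac_eq0 polyC_eq0.
have [|_] := place_ltD p1 tc0; last by rewrite -tofracD E.
by rewrite E -scalar_fracE hc pmulr_rlt0 // ltz_nat size_poly_gt0.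
Qed.

(** On quotients of polynomials v is - v(X) times [vinf]; as v takes the value 1, v(X) is -1. Thus
    infinity is the only place where the coordinate has a pole. *)
Lemma place_vinf : v (tf 'X) < 0 -> v =1 vinf.
Proof.
move=> hX; case: (hv) => v0 hc hM hD [a va].
have F p q : p != 0 -> q != 0 -> v (tf p / tf q) = - v (tf 'X) * vinf (tf p / tf q).
  move=> p0 q0; rewrite vinfE //.
  have tq0 : tf q != 0 by rewrite tofrac_eq0.
  have pq0 : tf p / tf q != 0 by rewrite frac_neq0.
  have : v (tf p) = v (tf p / tf q) + v (tf q) by rewrite -(hM _ _ pq0 tq0) (divfK tq0).
  rewrite (place_poly_lt0 hX p0) (place_poly_lt0 hX q0); move: p0 q0; rewrite -!size_poly_gt0.
  move: (size p) (size q) (v (tf p / tf q)) (v (tf 'X)) => [|sp] [|sq] // y z _ _ /=.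
  move/(canLR (addrK _)) => <-; clear; rewrite -(addn1 sp) -(addn1 sq) !PoszD; ring.
have X1 : v (tf 'X) = -1.
  have [p [q [q0 Ea]]] := frac_numden a.
  have p0 : p != 0.
    by apply: contra_eqN va => /eqP p0; rewrite Ea p0 tofrac0 mul0r v0.
  move: va; rewrite Ea F //; move: (vinf _) (v _) hX => z y; clear.
  by case: (ltrP 0 z) => ? ? ?; nia.
move=> x; have [->|x0] := eqVneq x 0; first by rewrite v0 vinf0.
have [p [q [q0 Ex]]] := frac_numden x.
by move: x0; rewrite Ex frac_neq0 // => p0; rewrite F // X1 opprK mul1r.
Qed.

End Place.
End Line.

Lemma placeXz (k K : fieldType) (f : {rmorphism k -> K}) (v : K -> int) a (j : int) :
  is_place f v -> a != 0 -> v (a ^ j) = j * v a.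
Proof.
case=> _ hc hM _ _ a0; have v1 : v 1 = 0 by rewrite -(rmorph1 f) hc.
have hX i : v (a ^+ i) = i%:Z * v a.
  elim: i => [|i IH]; first by rewrite expr0 v1 mul0r.
  by rewrite exprS hM ?expf_neq0 // IH -addn1 PoszD; ring.
case: j => j; first exact: hX.
have aj : a ^+ j.+1 != 0 by apply: expf_neq0.
have : v ((a ^+ j.+1)^-1 * a ^+ j.+1) = 0 by rewrite mulVf.
rewrite hM ?invr_eq0 // hX NegzE -exprnN mulNr => /eqP.
by rewrite addr_eq0 => /eqP.
Qed.

(** * Nef line bundles have submodular height functions *)

Section OrbitCurve.
Variables (k : fieldType) (n : nat) (tau : {set {set 'I_n}}) (p : 'I_n).
Implicit Types (m : lattice n) (a b : ratfun k n) (s : seq (lattice n * k)).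
Local Notation rc := (@rconst k n).
Local Notation rm := (@rmonom k n).
Let K := {fraction {poly k}}.
Let f := scalar_frac k.
Local Notation z := (FracField.tofrac 'X : {fraction {poly k}}).

Definition orth m := (pairing m setT == 0) && [forall S in tau, pairing m S == 0].

Definition orbit_term (q : lattice n * k) : K :=
  if orth q.1 then f q.2 * z ^ (q.1 p) else 0.

(* The torus-invariant curve of the flag tau, which misses one step from D to
   D + p + q: the monomials trivial on tau are powers of x_p / x_q, which is the
   coordinate z.  On Laurent polynomials the choice of s does not matter. *)
Definition orbit_curve a : K :=
  \sum_(q <- epsilon (inhabits [::]) (fun s => a = laur s)) orbit_term q.

Lemma orbit_termE s (A : seq (lattice n)) : uniq A -> (forall q, q \in s -> q.1 \in A) ->
  \sum_(q <- s) orbit_term q = \sum_(m <- A) orbit_term (m, cf s m).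
Proof.
move=> uA hA; have E m : orbit_term (m, cf s m) = \sum_(q <- s | q.1 == m) orbit_term q.
  rewrite /orbit_term /=; case om: (orth m); last first.
    by rewrite big1 // => q /eqP ->; rewrite om.
  rewrite /cf !rmorph_sum mulr_suml; apply: eq_bigr => q /eqP ->; by rewrite om.
under [RHS]eq_bigr do rewrite E.
rewrite (exchange_big_dep predT) //= big_seq [RHS]big_seq; apply: eq_bigr => q qs.
rewrite big_mkcond (bigD1_seq q.1) ?hA //= eqxx big1 ?addr0 //.
by move=> m; rewrite eq_sym => /negbTE ->.
Qed.

Lemma orbit_curve_laur s : orbit_curve (laur s) = \sum_(q <- s) orbit_term q.
Proof.
rewrite /orbit_curve; set P := fun s' => _.
have := epsilon_spec (inhabits [::]) P (ex_intro P s erefl).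
move: (epsilon _ _) => s' E; pose A := undup (map fst s ++ map fst s').
rewrite !(@orbit_termE _ A) ?undup_uniq //.
- by apply: eq_bigr => m _; rewrite (laur_ext E).
all: by move=> q qs; rewrite mem_undup mem_cat (map_f fst qs) ?orbT.
Qed.

Lemma orbit_curve_monom c m : orbit_curve (rc c * rm m) = orbit_term (m, c).
Proof.
have -> : rc c * rm m = laur [:: (m, c)] by rewrite /laur big_seq1.
by rewrite orbit_curve_laur big_seq1.
Qed.

Lemma orbit_curveD a b : is_laur a -> is_laur b ->
  orbit_curve (a + b) = orbit_curve a + orbit_curve b.
Proof. by move=> [s ->] [s' ->]; rewrite -laur_cat !orbit_curve_laur big_cat. Qed.

Lemma orbit_termM m m' c c' : dual_cone tau m -> dual_cone tau m' ->
  orbit_term (m + m', c * c') = orbit_term (m, c) * orbit_term (m', c').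
Proof.
move=> /andP[/eqP mT /forall_inP hm] /andP[/eqP mT' /forall_inP hm'].
have E : orth (m + m') = orth m && orth m'.
  rewrite /orth pairingD mT mT' addr0 eqxx /=.
  apply/forall_inP/andP => [h|[/forall_inP h /forall_inP h'] S St].
    split; apply/forall_inP => S St; have := h S St; have := hm S St; have := hm' S St;
    rewrite pairingD; move: (pairing m S) (pairing m' S) => x y; clear; lia.
  by rewrite pairingD (eqP (h S St)) (eqP (h' S St)).
rewrite /orbit_term /= E; case: (orth m) => /=; last by rewrite mul0r.
case: (orth m'); last by rewrite mulr0.
have z0 : z != 0 by rewrite tofrac_eq0 polyX_eq0.
by rewrite !rmorphM ffunE (expfzDr _ _ z0) mulrACA.
Qed.

Lemma orbit_curveM a b : regular tau a -> regular tau b ->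
  orbit_curve (a * b) = orbit_curve a * orbit_curve b.
Proof.
move=> [s [/allP hs ->]] [s' [/allP hs' ->]].
have -> : (\sum_(q <- s) rc q.2 * rm q.1) * (\sum_(q <- s') rc q.2 * rm q.1) =
    laur [seq (q.1 + r.1, q.2 * r.2) | q <- s, r <- s'].
  rewrite /laur big_allpairs_dep mulr_suml; apply: eq_bigr => q _.
  by rewrite mulr_sumr; apply: eq_bigr => r _ /=; rewrite rconstM rmonomD; ring.
rewrite -/(laur s) -/(laur s') !orbit_curve_laur big_allpairs_dep mulr_suml.
rewrite big_seq [RHS]big_seq; apply: eq_bigr => q qs.
rewrite mulr_sumr big_seq [RHS]big_seq; apply: eq_bigr => r rs.
have hq := hs _ qs; have hr := hs' _ rs.
by rewrite [LHS](orbit_termM _ _ hq hr) -!surjective_pairing.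
Qed.

Lemma orbit_curve_point : is_flag tau -> is_orbit_point f tau orbit_curve.
Proof.
have orth0 : orth 0.
  have E (S : {set 'I_n}) : pairing (0 : lattice n) S = 0 by rewrite /pairing big1 // => i _; rewrite ffunE.
  by rewrite /orth E; apply/forall_inP => S _; rewrite E.
move=> ht; split=> //.
- by move=> c; rewrite -[rc c]mulr1 -(rmonom0 k n) orbit_curve_monom /orbit_term /= orth0 ffunE expr0z mulr1.
- by move=> a b [s [_ ->]] [s' [_ ->]]; apply: orbit_curveD; [exists s | exists s'].
- exact: orbit_curveM.
- move=> m /andP[mT _]; rewrite -[rm m]mul1r -(rconst1 k n) orbit_curve_monom /orbit_term /=.
  rewrite /orth mT /= rmorph1 mul1r; case: ifP => _; last by rewrite eqxx.
  by rewrite expfz_neq0 // tofrac_eq0 polyX_eq0.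
Qed.

Lemma orbit_curve_val (F : {set {set 'I_n}}) (v : K -> int) a : is_place f v -> regular F a ->
  (forall m, dual_cone F m -> orth m -> 0 <= v z * m p) -> val_ring v (orbit_curve a).
Proof.
move=> hv [s [/allP hs ->]] hF; rewrite -/(laur s) orbit_curve_laur big_seq.
have z0 : z != 0 by rewrite tofrac_eq0 polyX_eq0.
apply: (big_ind (val_ring v)) => [|x y|q /hs hq]; first by left.
  case=> [->|hx]; first by rewrite add0r.
  case=> [->|hy]; first by rewrite addr0; right.
  have [->|x0] := eqVneq x 0; first by rewrite add0r; right.
  have [->|y0] := eqVneq y 0; first by rewrite addr0; right.
  have [->|xy0] := eqVneq (x + y) 0; [by left | right].
  by case: (hv) => _ _ _ hD _; apply: le_trans (hD _ _ x0 y0 xy0); rewrite le_min hx.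
rewrite /orbit_term; case: ifP => // oq; last by left.
have [->|c0] := eqVneq q.2 0; first by left; rewrite rmorph0 mul0r.
have fc0 : f q.2 != 0 by rewrite fmorph_eq0.
case: (hv) => _ hc hM _ _; right; rewrite (hM _ _ fc0 (expfz_neq0 _ z0)) hc add0r.
by rewrite (placeXz _ hv z0) mulrC hF.
Qed.

End OrbitCurve.

Section Nef.
Variables (k : fieldType) (n : nat) (L : line k n).
Hypothesis hL : is_bundle (line_bundle L).
Hypothesis hnef : nef L.
Local Notation z := (FracField.tofrac 'X : {fraction {poly k}}).

Section Swap.
Variables (s1 s2 : seq 'I_n) (p q : 'I_n).
Hypothesis hP : ordering (s1 ++ p :: q :: s2).
Hypothesis hG : ordering (s1 ++ q :: p :: s2).
Let P := chart_of hP.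
Let G := chart_of hG.
Let tau := val P :&: val G.
Let D : {set 'I_n} := [set y in s1].

(** The weights of p in P and in G are height increments over D and over D + q. Their difference is
    the degree of L on the curve of tau. *)
Lemma swap_line_deg : line_deg L P G p =
  line_height L (p |: D) + line_height L (q |: D) - line_height L D - line_height L (p |: (q |: D)).
Proof.
rewrite -(line_wtB hL) !ffunE (line_wt_step hL (chart_seq_chart_of hP)).
have E : chart_seq G = rcons s1 q ++ p :: s2 by rewrite chart_seq_chart_of cat_rcons.
rewrite (line_wt_step hL E) (_ : [set y in rcons s1 q] = q |: D); first by rewrite -/D; ring.
by apply/setP => y; rewrite !inE mem_rcons inE.
Qed.

Lemma swap_mem : [/\ D = set0 \/ D \in tau, p |: (q |: D) = setT \/ p |: (q |: D) \in tau,
  p |: D \in val P & q |: D \in val G].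
Proof.
have sz : size (s1 ++ p :: q :: s2) = n by case/andP: hP => _ /eqP.
have nz : ((size s1).+2 <= n)%N by rewrite -[X in (_ <= X)%N]sz size_cat /= !addnS !ltnS leq_addr.
have E1 (s : seq 'I_n) (hs : ordering s) j : (0 < j < n)%N -> prefix_set s j \in val (chart_of hs).
  move=> hj; rewrite -flag_of_chart_seq chart_seq_chart_of; apply/flag_ofP. by exists j.
have pD x s : prefix_set (s1 ++ x :: s) (size s1).+1 = x |: D.
  rewrite /prefix_set -cat_rcons take_size_cat ?size_rcons //.
  by apply/setP => y; rewrite !inE mem_rcons inE.
have pT x y s : prefix_set (s1 ++ x :: y :: s) (size s1).+2 = y |: (x |: D).
  rewrite /prefix_set -2!cat_rcons take_size_cat ?size_rcons //.
  by apply/setP => w; rewrite !(inE, mem_rcons).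
have p0 s : prefix_set (s1 ++ s) (size s1) = D by rewrite /prefix_set take_size_cat.
split.
- have [s0|s0] := posnP (size s1).
    by left; apply/setP => y; rewrite /D (size0nil s0) !inE.
  have hs : (0 < size s1 < n)%N by rewrite s0 ltnW.
  right; apply/setIP; split; first by rewrite -(p0 (p :: q :: s2)); apply: E1.
  by rewrite -(p0 (q :: p :: s2)); apply: E1.
- have [s0|s0] := eqVneq (size s1).+2 n.
    by left; rewrite -(pT q p s2) s0 (prefix_setT hG).
  have hs : (0 < (size s1).+2 < n)%N by rewrite /= ltn_neqAle s0.
  right; apply/setIP; split; first by rewrite setUCA -(pT p q s2); apply: E1.
  by rewrite -(pT q p s2); apply: E1.
- by rewrite -(pD p (q :: s2)); apply: E1.
- by rewrite -(pD q (p :: s2)); apply: E1.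
Qed.

Hypothesis pD : p \notin D.
Hypothesis qD : q \notin D.
Hypothesis pq : p != q.

Lemma orth_pairing m : orth tau m -> pairing m D = 0 /\ pairing m (p |: (q |: D)) = 0.
Proof.
case/andP=> /eqP mT /forall_inP h; have [hD hE _ _] := swap_mem; split.
  by case: hD => [->|/h /eqP //]; rewrite /pairing big_set0.
by case: hE => [->|/h /eqP].
Qed.

Lemma orth_swap m : orth tau m -> m q = - m p.
Proof.
case/orth_pairing => h; rewrite /pairing big_setU1 ?in_setU1 ?(negbTE pq) //= big_setU1 //=.
by rewrite -/(pairing m D) h addr0 addrC => /eqP; rewrite addr_eq0 => /eqP.
Qed.

Lemma dual_cone_coord (C : chart n) x m : x \notin D -> x |: D \in val C -> dual_cone (val C) m ->
  pairing m D = 0 -> 0 <= m x.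
Proof.
move=> xD xC /andP[_ /forall_inP /(_ _ xC)]; rewrite /pairing big_setU1 //= -/(pairing m D).
by move=> h E; rewrite E addr0 in h.
Qed.

(** Places where z has nonnegative value have their centre in U_P, and there the frame of P has
    order 0. The only other place is infinity, which has degree 1 and its centre in U_G; there the
    order is that of a scalar times z to the power [line_deg L G P p], i.e. [line_deg L P G p]. *)
Lemma swap_line_deg_ge0 : 0 <= line_deg L P G p.
Proof.
have [_ _ memP memG] := swap_mem.
have ftau : is_flag tau.
  have /andP[h1 h2] := maxsetp (valP P); apply/andP; split.
    by apply/forall_inP => S /setIP[SP _]; apply: (forall_inP h1).
  apply/forall_inP => S /setIP[SP _]; apply/forall_inP => T /setIP[TP _].
  exact: (forall_inP (forall_inP h2 _ SP)).
have od F F' : F = P -> F' = G -> orth tau (line_deg L F F').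
  move=> -> ->; rewrite /orth (line_deg_setT hL) eqxx; apply/forall_inP => S /setIP[SP SG].
  by rewrite (line_deg_face hL).
have z0 : z != 0 by rewrite tofrac_eq0 polyX_eq0.
have vz : vinf z = -1 by rewrite vinf_poly ?polyX_eq0 // size_polyX.
have zero : orth tau 0.
  have E (S : {set 'I_n}) : pairing (0 : lattice n) S = 0 by rewrite /pairing big1 // => i _; rewrite ffunE.
  by rewrite /orth E; apply/forall_inP => S _; rewrite E.
apply: (hnef (rational_curve k) (@orbit_curve_point k n tau p ftau)).
exists P; split; first exact: subsetIl.
exists 1%N, (fun _ => @vinf k), (fun _ => 1%N), (fun _ => line_deg L P G p); split.
- by move=> i j; rewrite (ord1 i) (ord1 j) eqxx.
- move=> _; split; [exact: vinf_place | exact: vinf_degree |].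
  exists G; split; first exact: subsetIr.
    move=> a ha; apply: (orbit_curve_val (vinf_place k) ha) => m hm om.
    rewrite vz mulN1r -(orth_swap om).
    by apply: (dual_cone_coord qD memG hm); case: (orth_pairing om).
  have [c c0 E] := line_degP hL G P.
  rewrite E orbit_curve_monom /orbit_term /= (line_degN hL P G).
  have -> : orth tau (- line_deg L P G).
    have /andP[oT /forall_inP oS] := od P G erefl erefl; rewrite /orth pairingN oppr_eq0 oT /=.
    by apply/forall_inP => S /oS; rewrite pairingN oppr_eq0.
  have fc0 : scalar_frac k c != 0 by rewrite fmorph_eq0.
  case: (vinf_place k) => _ hc hM _ _; rewrite (hM _ _ fc0 (expfz_neq0 _ z0)) hc add0r.
  by rewrite (placeXz _ (vinf_place k) z0) vz ffunE mulrN1 opprK.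
- move=> v hv vne; have vz0 : 0 <= v z.
    by rewrite leNgt; apply/negP => h; case: (vne ord0); apply: place_vinf hv h.
  exists P; split; first exact: subsetIl.
    move=> a ha; apply: (orbit_curve_val hv ha) => m hm om; apply: mulr_ge0 => //.
    by apply: (dual_cone_coord pD memP hm); case: (orth_pairing om).
  rewrite (line_diag hL) -[X in orbit_curve _ _ X]mulr1 -{1}(rconst1 k n) -(rmonom0 k n).
  by rewrite orbit_curve_monom /orbit_term /= zero ffunE expr0z rmorph1 mulr1 place1.
- by rewrite big_ord1 mul1r.
Qed.

End Swap.

Lemma nef_submod : submod (line_height L) set0 setT.
Proof.
move=> D p q _ _ pD qD pq.
pose s1 := enum D; pose s2 := enum (~: (p |: (q |: D))).
have E1 : [set y in s1] = D by apply/setP => y; rewrite inE mem_enum.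
have hP : ordering (s1 ++ p :: q :: s2).
  rewrite /ordering; have us : uniq (s1 ++ p :: q :: s2).
    rewrite cat_uniq /= !enum_uniq !inE !mem_enum !inE !eqxx (negbTE pq) (negbTE pD) (negbTE qD) /=.
    rewrite orbT /= andbT; apply/hasPn => y; rewrite !mem_enum !inE !negb_or.
    by case/and3P.
  rewrite us /= -[X in _ == X]card_ord -(card_uniqP us); apply/eqP/eq_card => y.
  by rewrite mem_cat !inE !mem_enum !inE; case: (y \in D); case: (y == p); case: (y == q).
have hG := swap_ordering hP.
have := @swap_line_deg_ge0 s1 s2 p q hP hG; rewrite swap_line_deg E1 => /(_ pD qD pq).
move: (line_height L _) (line_height L _) (line_height L D) (line_height L _).
by clear => x y w v; lia.
Qed.

End Nef.

Lemma kelt_inj (I : finType) p (S : ksubset I p) : injective (kelt S).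
Proof. by move=> a b /enum_val_inj /cast_ord_inj. Qed.

Lemma kelt_in (I : finType) p (S : ksubset I p) a : kelt S a \in val S.
Proof. exact: enum_valP. Qed.

Lemma kelt_surj (I : finType) p (S : ksubset I p) i : i \in val S -> exists a, kelt S a = i.
Proof.
move=> iS; exists (cast_ord (eqP (valP S)) (enum_rank_in iS i)).
by rewrite /kelt cast_ordK enum_rankK_in.
Qed.

(** * Equivariant exterior powers *)

Section CauchyBinet.
Variables (R : comNzRingType) (I : finType) (p : nat).

(** Every injective map from ['I_p] to I arises exactly once: a permutation followed by the
    enumeration of the image. *)
Definition sub_perm (x : ksubset I p * 'S_p) : {ffun 'I_p -> I} := [ffun a => kelt x.1 (x.2 a)].

Lemma sub_perm_inj : injective sub_perm.
Proof.
move=> [S s] [T t] /ffunP h; have E a : kelt S (s a) = kelt T (t a) by have := h a; rewrite !ffunE.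
have ST : S = T.
  apply/val_inj/setP => i; apply/idP/idP => /kelt_surj [a <-].
    by rewrite -(permKV s a) E kelt_in.
  by rewrite -(permKV t a) -E kelt_in.
by rewrite -ST in E *; congr (_, _); apply/permP => a; apply: kelt_inj (E a).
Qed.

Lemma sub_perm_image : [set sub_perm x | x in setT] = [set f : {ffun 'I_p -> I} | injectiveb f].
Proof.
apply/eqP; rewrite eqEcard; apply/andP; split.
  apply/subsetP => f /imsetP[x _ ->]; rewrite inE; apply/injectiveP => a b.
  by rewrite !ffunE => /kelt_inj /perm_inj.
rewrite card_imset; last exact: sub_perm_inj.
rewrite card_inj_ffuns card_ord cardsT card_prod card_Sn -bin_ffact leq_mul //.
by rewrite card_sig -card_draws cardsE; apply/eq_leq/eq_card => S; rewrite !inE.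
Qed.

(** Expanded over all maps f from ['I_p] to I: a map that is not injective gives a matrix with two
    equal rows, the others are grouped by their image. For exterior powers of bundles this is the
    cocycle condition. *)
Lemma cauchy_binet (A : 'I_p -> I -> R) (B : I -> 'I_p -> R) :
  \det (\matrix_(a, b) \sum_j A a j * B j b) =
  \sum_(S : ksubset I p) \det (\matrix_(a, b) A a (kelt S b)) * \det (\matrix_(a, b) B (kelt S a) b).
Proof.
pose G (f : {ffun 'I_p -> I}) := (\prod_a A a (f a)) * \det (\matrix_(a, b) B (f a) b).
transitivity (\sum_(f : {ffun 'I_p -> I}) G f).
  rewrite /determinant (eq_bigr (fun s : 'S_p => \sum_(f : {ffun 'I_p -> I})
    (-1) ^+ s * \prod_a (A a (f a) * B (f a) (s a)))); last first.
    move=> s _; rewrite -mulr_sumr -(bigA_distr_bigA (fun a j => A a j * B j (s a))) /=.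
    by congr (_ * _); apply: eq_bigr => a _; rewrite mxE.
  rewrite exchange_big; apply: eq_bigr => f _; rewrite /G /determinant mulr_sumr.
  apply: eq_bigr => s _; rewrite big_split /= mulrCA; congr (_ * (_ * _)).
  by apply: eq_bigr => a _; rewrite mxE.
rewrite (bigID (fun f : {ffun 'I_p -> I} => injectiveb f)) /= [X in _ + X]big1 ?addr0; last first.
  move=> f /injectivePn [a [b ab E]]; rewrite /G (determinant_alternate ab) ?mulr0 // => c.
  by rewrite !mxE E.
rewrite (eq_bigl (mem [set sub_perm x | x in setT])); last by move=> f; rewrite sub_perm_image !inE.
rewrite big_imset /=; last by move=> x y _ _; apply: sub_perm_inj.
rewrite (eq_bigl predT) => [|x]; last by rewrite inE.
rewrite -(pair_bigA _ (fun S s => G (sub_perm (S, s)))) /=; apply: eq_bigr => S _.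
rewrite {2}/determinant mulr_suml; apply: eq_bigr => s _; rewrite /G.
have -> : \matrix_(a, b) B (sub_perm (S, s) a) b = row_perm s (\matrix_(a, b) B (kelt S a) b).
  by apply/matrixP => a b; rewrite !mxE ffunE.
rewrite row_permE det_mulmx det_perm mulrA [_ * (-1) ^+ s]mulrC; congr (_ * _ * _).
by apply: eq_bigr => a _; rewrite mxE ffunE.
Qed.

Lemma det_kelt_diag (S T : ksubset I p) :
  \det (\matrix_(a, b) (kelt S a == kelt T b)%:R) = (S == T)%:R :> R.
Proof.
have [->|ST] := eqVneq S T.
  rewrite -[RHS](det1 R p); congr (\det _); apply/matrixP => a b.
  by rewrite !mxE (inj_eq (@kelt_inj _ _ T)).
have /subsetPn[i iS iT] : ~~ (val S \subset val T).
  apply: contra_neqN ST => h; apply/val_inj/eqP.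
  by rewrite eqEcard h (eqP (valP S)) (eqP (valP T)) /=.
have [a Ea] := kelt_surj iS.
rewrite (expand_det_row _ a) big1 // => b _; rewrite mxE Ea.
by case: eqP => [E|]; [rewrite E kelt_in in iT | rewrite mul0r].
Qed.

End CauchyBinet.

Section Constructions.
Variables (k : fieldType) (n : nat).
Implicit Types (E D : ebundle k n) (F G P : chart n).
Local Notation rc := (@rconst k n).
Local Notation rm := (@rmonom k n).

Definition etrivial : ebundle k n := @EBundle k n (trivial_line k n) (fun _ _ => 0).

Definition etensor D E : ebundle k n :=
  @EBundle k n (tensor D E) (fun F i => wt (e := D) F i.1 + wt (e := E) F i.2).

Definition eexterior E p : ebundle k n :=
  @EBundle k n (exterior E p) (fun F S => \sum_a wt (e := E) F (kelt S a)).

Lemma regular1 (F : {set {set 'I_n}}) : regular F (1 : ratfun k n).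
Proof. by rewrite -(rconst1 k n); apply: regular_const. Qed.

Lemma regularN (F : {set {set 'I_n}}) (a : ratfun k n) : regular F a -> regular F (- a).
Proof.
move=> h; rewrite -mulN1r -(rconst1 k n) -rconstN; apply: regularM h; exact: regular_const.
Qed.

Lemma regular_det (F : {set {set 'I_n}}) p (A : 'M[ratfun k n]_p) :
  (forall a b, regular F (A a b)) -> regular F (\det A).
Proof.
move=> h; apply: (big_ind (regular F)); [exact: regular0 | exact: regularD |].
move=> s _; have : regular F (\prod_a A a (s a)).
  by apply: (big_ind (regular F)) => //; [exact: regular1 | exact: regularM].
by case: (odd_perm s) => hp; rewrite ?expr1 ?expr0 ?mulN1r ?mul1r //; apply: regularN.
Qed.

Lemma rmonom_prod (J : finType) (m : J -> lattice n) : \prod_j rm (m j) = rm (\sum_j m j).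
Proof.
by apply: (big_ind2 (fun x y => x = rm y)) => [|_ m1 _ m2 -> ->|//]; rewrite ?rmonom0 ?rmonomD.
Qed.

Lemma rconst_prod (J : finType) (c : J -> k) : \prod_j rc (c j) = rc (\prod_j c j).
Proof.
by apply: (big_ind2 (fun x y => x = rc y)) => [|_ m1 _ m2 -> ->|//]; rewrite ?rconst1 ?rconstM.
Qed.

Lemma trivial_is_ebundle : is_ebundle etrivial.
Proof.
split; last by move=> F G i j; exists 1; rewrite /= subrr rmonom0 rconst1 mulr1.
split=> [F G i j|F [] []|F G P i l] /=; first exact: regular1.
- by [].
- by rewrite (bigD1 tt) //= big1 ?addr0 ?mulr1 // => -[].
Qed.

Lemma dual_is_ebundle E : is_ebundle E -> is_ebundle (edual E).
Proof.
move=> [[hr h1 hc] hw]; split; last first.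
  by move=> F G i j; have [c Ec] := hw G F j i; exists c; rewrite /= Ec opprK addrC.
split=> [F G i j|F i j|F G P i l] /=; first by rewrite setIC; apply: hr.
- by rewrite h1 eq_sym.
- by rewrite -(hc P G F l i); apply: eq_bigr => j _; rewrite mulrC.
Qed.

Lemma tensor_is_ebundle D E : is_ebundle D -> is_ebundle E -> is_ebundle (etensor D E).
Proof.
move=> [[hr h1 hc] hw] [[hr' h1' hc'] hw']; split; last first.
  move=> F G i j; have [c Ec] := hw F G i.1 j.1; have [c' Ec'] := hw' F G i.2 j.2.
  exists (c * c'); rewrite /= Ec Ec' mulrACA -rconstM -rmonomD; congr (_ * rm _).
  by rewrite opprD addrACA.
split=> [F G i j|F i j|F G P i l] /=; first by apply: regularM; [apply: hr | apply: hr'].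
- by rewrite h1 h1' -natrM mulnb; case: i j => i1 i2 [j1 j2].
- rewrite -(hc F G P) -(hc' F G P) mulr_suml.
  rewrite -(pair_bigA _ (fun x y => trans F G i.1 x * trans F G i.2 y * (trans G P x l.1 * trans G P y l.2))) /=.
  by apply: eq_bigr => x _; rewrite mulr_sumr; apply: eq_bigr => y _; rewrite mulrACA.
Qed.

Lemma exterior_is_ebundle E p : is_ebundle E -> is_ebundle (eexterior E p).
Proof.
move=> [[hr h1 hc] hw]; split; last first.
  move=> F G S T; pose c a b := lcoef (trans (b := E) F G (kelt S a) (kelt T b))
    (wt (e := E) F (kelt S a) - wt (e := E) G (kelt T b)).
  exists (\det (\matrix_(a, b) c a b)); rewrite /= /determinant rconst_sum mulr_suml.
  apply: eq_bigr => s _; rewrite rconstM.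
  have -> : rc ((-1) ^+ s) = (-1) ^+ s.
    by case: (odd_perm s); rewrite ?expr1 ?expr0 ?rconstN ?rconst1.
  rewrite -mulrA; congr (_ * _); rewrite -rconst_prod.
  (* Permuting the columns does not change the sum of the weights, so all terms of the determinant
     have the same exponent. *)
  rewrite (reindex_inj (@perm_inj _ s) (F := fun b => wt (e := E) G (kelt T b))) /= -sumrB.
  rewrite -rmonom_prod -big_split; apply: eq_bigr => a _; rewrite !mxE.
  by have [x Ex] := hw F G (kelt S a) (kelt T (s a)); rewrite /c Ex lcoef_monom eqxx.
split=> [F G S T|F S T|F G P S T] /=.
- by apply: regular_det => a b; rewrite mxE; apply: hr.
- rewrite -det_kelt_diag; congr (\det _); apply/matrixP => a b; rewrite !mxE.
  exact: h1.
- rewrite -[LHS](cauchy_binet (fun a j => trans (b := E) F G (kelt S a) j)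
    (fun j b => trans (b := E) G P j (kelt T b))); congr (\det _); apply/matrixP => a b; rewrite !mxE.
  exact: hc.
Qed.

End Constructions.

(** * Characters of K-classes *)

Section Characters.
Variables (K : fieldType) (k : fieldType) (n : nat) (t : 'I_n -> K).
Hypothesis t_neq0 : forall i, t i != 0.
Implicit Types (E D : ebundle k n) (y : kclass k n) (c d : chart n -> K) (F : chart n).

Definition echar E F : K := \sum_i mono t (wt (e := E) F i).

(** A [kclass] consists of bundles without action; the relation records that each of them underlies
    an equivariant bundle, and collects the characters at the fixed points. *)
Inductive has_char : kclass k n -> (chart n -> K) -> Prop :=
| has_char_nil c : (forall F, c F = 0) -> has_char [::] c
| has_char_cons a E x c d : is_ebundle E -> has_char x c ->
    (forall F, d F = a%:~R * echar E F + c F) -> has_char ((a, forget E) :: x) d.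

Lemma has_char_ext x c d : has_char x c -> (forall F, d F = c F) -> has_char x d.
Proof.
case=> [c' h|a E x' c' d' hE hx h] e; first by apply: has_char_nil => F; rewrite e.
by apply: has_char_cons hE hx _ => F; rewrite e h.
Qed.

Lemma has_char1 E : is_ebundle E -> has_char [:: (1, forget E)] (echar E).
Proof.
move=> hE; apply: has_char_cons hE (@has_char_nil (fun _ => 0) _) _ => // F.
by rewrite mul1r addr0.
Qed.

Lemma has_char_cat x y c d : has_char x c -> has_char y d ->
  has_char (x ++ y) (fun F => c F + d F).
Proof.
move=> hx hy; elim: hx => [c' h|a E x' c' d' hE _ IH h] /=.
  by apply: has_char_ext hy _ => F; rewrite h add0r.
by apply: has_char_cons hE IH _ => F; rewrite h addrA.
Qed.

Lemma has_char_scale a x c : has_char x c -> has_char (kscale a x) (fun F => a%:~R * c F).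
Proof.
elim=> [c' h|b E x' c' d' hE _ IH h] /=; first by apply: has_char_nil => F; rewrite h mulr0.
by apply: has_char_cons hE IH _ => F; rewrite h rmorphM mulrDr mulrA.
Qed.

Lemma echar_tensor D E F : echar (etensor D E) F = echar D F * echar E F.
Proof.
rewrite /echar mulr_suml -(pair_bigA _ (fun i j => mono t (wt F i + wt F j))) /=.
by apply: eq_bigr => i _; rewrite mulr_sumr; apply: eq_bigr => j _; rewrite monoD.
Qed.

Lemma has_char_mul x y c d : has_char x c -> has_char y d ->
  has_char (kmul x y) (fun F => c F * d F).
Proof.
move=> hx hy; elim: hx => [c' h|a D x' c' d' hD _ IH h] /=.
  by apply: has_char_nil => F; rewrite h mul0r.
rewrite /kmul /=.
have h1 : has_char [seq (a * q.1, tensor (forget D) q.2) | q <- y] (fun F => a%:~R * echar D F * d F).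
  elim: hy => [c0 h0|b E y' c0 d0 hE _ IH0 h0] /=; first by apply: has_char_nil => F; rewrite h0 mulr0.
  apply: (@has_char_cons _ (etensor D E)) (tensor_is_ebundle hD hE) IH0 _ => F.
  by rewrite h0 echar_tensor rmorphM /=; ring.
by apply: has_char_ext (has_char_cat h1 IH) _ => F; rewrite h mulrDl.
Qed.

Lemma has_char_sum N (f : nat -> kclass k n) (c : nat -> chart n -> K) :
  (forall i, (i < N)%N -> has_char (f i) (c i)) ->
  has_char (ksum N f) (fun F => \sum_(i < N) c i F).
Proof.
move=> h; rewrite /ksum; have E F : \sum_(i < N) c i F = \sum_(i <- iota 0 N) c i F.
  by rewrite -(big_mkord predT (fun i => c i F)) /index_iota subn0.
apply: (has_char_ext (c := fun F => \sum_(i <- iota 0 N) c i F)) => [|F]; last exact: E.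
have : forall i, i \in iota 0 N -> has_char (f i) (c i) by move=> i; rewrite mem_iota => /andP[_]; apply: h.
elim: (iota 0 N) => [|i s IH] hs /=; first by apply: has_char_nil => F; rewrite big_nil.
apply: has_char_ext (has_char_cat (hs i (mem_head _ _)) (IH _)) _ => [j js|F].
  by apply: hs; rewrite inE js orbT.
by rewrite big_cons.
Qed.

Definition series_char (f : kseries k n) (P : chart n -> {poly K}) :=
  forall i, has_char (f i) (fun F => (P F)`_i).

Lemma series_char_mul f g P Q : series_char f P -> series_char g Q ->
  series_char (series_mul f g) (fun F => P F * Q F).
Proof.
move=> hf hg i; apply: (has_char_ext (c := fun F => \sum_(j < i.+1) (P F)`_j * (Q F)`_(i - j))) => [|F].
  by apply: (has_char_sum (c := fun j F => (P F)`_j * (Q F)`_(i - j))) => j _; apply: has_char_mul.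
by rewrite coefM.
Qed.

Lemma echar_trivial F : echar (etrivial k n) F = 1.
Proof. by rewrite /echar (bigD1 tt) //= big1 ?addr0 ?mono0 // => -[]. Qed.

Lemma series_char_one : series_char (@series_one k n) (fun _ => 1).
Proof.
move=> [|i]; rewrite /series_one /=; last by apply: has_char_nil => F; rewrite coef1.
apply: has_char_ext (has_char1 (trivial_is_ebundle k n)) _ => F.
by rewrite coef1 echar_trivial.
Qed.

Lemma series_char_pow f P j : series_char f P ->
  series_char (iter j (series_mul f) (@series_one k n)) (fun F => P F ^+ j).
Proof.
move=> h; elim: j => [|j IH] /=; first exact: series_char_one.
by move=> i; apply: has_char_ext (series_char_mul h IH i) _ => F; rewrite exprS.
Qed.

Lemma coef_sign a (q : {poly K}) j : ((-1) ^+ a * q)`_j = (-1) ^+ a * q`_j.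
Proof.
elim: a => [|a IH]; first by rewrite !expr0 !mul1r.
by rewrite !exprS -!mulrA !mulN1r coefN IH.
Qed.

(* Modulo 'X^i.+1, [series_inv] is the truncated geometric series of 1 / Q. *)
Lemma series_char_quot f g P Q A : series_char f P -> series_char g Q ->
  (forall F, (Q F)`_0 = 1) -> (forall F, P F = A F * Q F) ->
  series_char (series_mul f (series_inv g)) A.
Proof.
move=> hf hg Q0 PA i.
have h1 : series_char (fun i => if i == 0%N then [::] else g i) (fun F => Q F - 1).
  case=> [|j] /=; first by apply: has_char_nil => F; rewrite coefB Q0 coef1 subrr.
  by apply: has_char_ext (hg j.+1) _ => F; rewrite coefB coef1 subr0.
have h2 j : has_char (series_inv g j) (fun F => \sum_(l < j.+1) ((1 - Q F) ^+ l)`_j).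
  apply: (has_char_sum (c := fun l F => ((1 - Q F) ^+ l)`_j)) => l _.
  apply: has_char_ext (has_char_scale _ (series_char_pow l h1 j)) _ => F.
  have -> : 1 - Q F = - (Q F - 1) by rewrite opprB.
  by rewrite (exprNn (Q F - 1)) coef_sign rmorph_sign.
pose c j F := (P F)`_j * \sum_(l < (i - j).+1) ((1 - Q F) ^+ l)`_(i - j).
apply: (has_char_ext (c := fun F => \sum_(j < i.+1) c j F)) => [|F].
  by apply: has_char_sum => j _; apply: has_char_mul.
have [R ER] : exists R, 1 - Q F = 'X * R.
  have : ('X %| 1 - Q F)%R by rewrite -['X]subr0 -polyC0 dvdp_XsubCl /root horner_coef0 coefB coef1 Q0 subrr.
  by case/dvdpP => R ->; exists R; rewrite mulrC.
have low l j : (j < l)%N -> ((1 - Q F) ^+ l)`_j = 0.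
  by move=> jl; rewrite ER exprMn coefXnM jl.
have S : \sum_(j < i.+1) c j F = (P F * \sum_(l < i.+1) (1 - Q F) ^+ l)`_i.
  rewrite coefM; apply: eq_bigr => j _; rewrite coef_sum /c; congr (_ * _).
  have Z : \sum_((i - j).+1 <= l < i.+1) ((1 - Q F) ^+ l)`_(i - j) = 0.
    by rewrite big_nat_cond big1 // => l /andP[/andP[hl _] _]; apply: low.
  rewrite -!(big_mkord predT (fun l => ((1 - Q F) ^+ l)`_(i - j))).
  by rewrite [RHS](@big_cat_nat _ _ _ (i - j).+1) //= ?ltnS ?leq_subr // Z addr0.
rewrite S PA -mulrA (_ : Q F * _ = 1 - (1 - Q F) ^+ i.+1).
  by rewrite mulrBr mulr1 coefB ER exprMn mulrCA coefXnM ltnSn subr0.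
by rewrite -[RHS]opprB subrX1 -mulNr; congr (_ * _); ring.
Qed.

Definition exterior_poly E F : {poly K} := \prod_i (1 + mono t (wt (e := E) F i) *: 'X).

Lemma exterior_poly0 E F : (exterior_poly E F)`_0 = 1.
Proof.
rewrite -horner_coef0 horner_prod big1 // => i _.
by rewrite hornerD hornerZ hornerX mulr0 addr0 hornerC.
Qed.

Lemma mono_sum (J : finType) (m : J -> lattice n) : mono t (\sum_j m j) = \prod_j mono t (m j).
Proof. by apply: (big_morph _ (monoD t_neq0)); apply: mono0. Qed.

Lemma echar_exterior E p F : echar (eexterior E p) F = (exterior_poly E F)`_p.
Proof.
pose w i := mono t (wt (e := E) F i).
have -> : exterior_poly E F = \sum_(S : {set idx E}) (\prod_(i in S) w i) *: 'X^#|S|.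
  rewrite /exterior_poly; under eq_bigr do rewrite addrC.
  rewrite bigA_distr; apply: eq_bigr => S _.
  rewrite -[LHS](big_mkcond (mem S)) /= -/w.
  by rewrite scaler_prod prodr_const.
rewrite coef_sum /echar; transitivity (\sum_(S : {set idx E} | #|S| == p) \prod_(i in S) w i).
  rewrite (reindex_omap (fun S : ksubset (idx E) p => val S) insub) /=; last first.
    by move=> S hS; rewrite insubT.
  apply: eq_big => [S|S _]; first by rewrite (valP S) valK eqxx.
  have -> : val S = [set kelt S a | a in setT].
    apply/setP => i; apply/idP/imsetP => [/kelt_surj[a <-]|[a _ ->]]; [by exists a | exact: kelt_in].
  rewrite big_imset /=; last by move=> a b _ _; apply: kelt_inj.
  by rewrite mono_sum; apply: eq_bigl => a; rewrite inE.
rewrite [LHS]big_mkcond; apply: eq_bigr => S _; rewrite coefZ coefXn eq_sym.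
by case: eqP => _; rewrite ?mulr1 ?mulr0.
Qed.

Lemma lambda_bundle_char E : is_ebundle E -> series_char (lambda_bundle E) (exterior_poly E).
Proof.
move=> hE i; apply: has_char_ext (has_char1 (exterior_is_ebundle i hE)) _ => F.
by rewrite echar_exterior.
Qed.

Lemma lambda_char D E (A : chart n -> {poly K}) : is_ebundle D -> is_ebundle E ->
  (forall F, exterior_poly D F = A F * exterior_poly E F) ->
  series_char (lambda (D, E)) A.
Proof.
move=> hD hE h; apply: series_char_quot h; try exact: lambda_bundle_char.
exact: exterior_poly0.
Qed.

Lemma lambda_minus1_char r (x : eclass k n) (A : chart n -> {poly K}) :
  series_char (lambda x) A -> (forall F, (size (A F) <= r.+1)%N) ->
  has_char (lambda_minus1 r x) (fun F => (A F).[-1]).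
Proof.
move=> h sA; apply: (has_char_ext (c := fun F => \sum_(i < r.+1) ((-1) ^+ i)%:~R * (A F)`_i)) => [|F].
  by apply: (has_char_sum (c := fun i F => ((-1) ^+ i)%:~R * (A F)`_i)) => i _; apply: has_char_scale.
rewrite (horner_coef_wide _ (sA F)); apply: eq_bigr => i _.
by rewrite rmorphXn /= rmorphN1 mulrC.
Qed.

End Characters.

(** * Tautological classes *)

Lemma count_image (I : finType) (T : eqType) (w : I -> T) m :
  count_mem m [seq w i | i <- enum I] = #|[set i | w i == m]|.
Proof.
rewrite count_map -size_filter cardsE cardE; congr size; rewrite [in RHS]/enum_mem.
by rewrite /enum_mem -filter_predI; apply: eq_filter => i /=; rewrite andbT.
Qed.

Section Taut.
Variables (K k : fieldType) (n : nat) (t : 'I_n -> K).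
Hypothesis t_neq0 : forall i, t i != 0.

Definition class_poly (B : {set 'I_n}) : {poly K} := \prod_(i in B) (1 + t i *: 'X).

(** With the subtracted bundle moved to the other side, equal multiplicities of all characters mean
    that two lists of weights are permutations of each other. *)
Lemma taut_poly (x : eclass k n) (F : chart n) B :
  (forall m, localize x F m = char_sum B m) ->
  exterior_poly t x.1 F = class_poly B * exterior_poly t x.2 F.
Proof.
move=> h; pose g m : {poly K} := 1 + mono t m *: 'X.
have -> : class_poly B = \prod_(m <- [seq tchar i | i <- enum B]) g m.
  by rewrite big_map big_enum /=; apply: eq_bigr => i _; rewrite /g mono_tchar.
have E (y : ebundle k n) : exterior_poly t y F = \prod_(m <- [seq wt (e := y) F i | i <- enum (idx y)]) g m.
  by rewrite big_map big_enum.
rewrite !E -big_cat; apply: perm_big; apply/allP => m _ /=; apply/eqP.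
have := h m; rewrite /localize count_cat !count_image /char_sum => /eqP.
rewrite subr_eq => /eqP H; apply/eqP; rewrite -eqz_nat H PoszD; apply/eqP; congr (_ + _).
rewrite -big_enum /=; elim: (enum B) => [|i s IH] /=; first by rewrite big_nil.
by rewrite big_cons PoszD IH eq_sym; case: eqP.
Qed.

Lemma size_class_poly B : (size (class_poly B) <= #|B|.+1)%N.
Proof.
rewrite /class_poly -sum1_card; apply: (big_ind2 (fun (q : {poly K}) m => (size q <= m.+1)%N)).
- by rewrite size_poly1.
- move=> q m r l hq hr; apply: leq_trans (size_polyMleq _ _) _.
  by move: (size q) (size r) hq hr; clear => x y; lia.
move=> i _; apply: leq_trans (size_polyD _ _) _; rewrite geq_max size_poly1 /=.
by apply: leq_trans (size_scale_leq _ _) _; rewrite size_polyX.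
Qed.

Lemma horner_class_poly B x : (class_poly B).[x] = \prod_(i in B) (1 + x * t i).
Proof.
rewrite horner_prod; apply: eq_bigr => i _.
by rewrite hornerD hornerZ hornerX hornerC mulrC.
Qed.

End Taut.

(** * The Euler characteristic as a flag sum at t = 1 *)

(** For an equivariant bundle the sum over the fixed points is the character of its cohomology, a
    Laurent polynomial in s, and setting s = 1 turns characters into dimensions. *)
Lemma chi_at1 (k : fieldType) n (hn : (0 < n)%N) (x : kclass k n) c : has_char (@tpow n) x c ->
  at1 (\sum_F link_prod (@tpow n) None (chart_seq F) * c F) (chi x)%:P.
Proof.
elim=> [{}c h|a E {}x {}c d hE _ IH h].
  by rewrite /chi big_nil big1; [exact: at1_int 0 | move=> F _; rewrite h mulr0].
rewrite /chi big_cons -/(chi x) /=.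
have [L [e [E1 E2]]] := euler_char_gen (@tpow_neq0 n) (@tpow_inj n) hn hE.
have := at1_laurent L e; rewrite -E2 -E1 => H.
have := at1D (at1M (at1_int a) H) IH; rewrite -polyCM -polyCD; congr at1.
rewrite mulr_sumr -big_split; apply: eq_bigr => F _; rewrite h /echar /=; ring.
Qed.

Theorem theoremA (k : fieldType) (n : nat) (hn : (0 < n)%N) (M : matroid n)
    (hM : loopless M) (S Q : eclass k n)
    (hS : is_taut_sub M S) (hQ : is_taut_quot M Q)
    (L : line k n) (hL : is_bundle (line_bundle L)) (hnef : nef L) :
  exists q : {poly int},
    chi_poly M S Q L = (1 + 'X) * q /\ forall i : nat, 0 <= q`_i.
Proof.
pose t := @tpow n.
(* An initial basis at F; by [hB] the default is never taken. *)
pose B (F : chart n) : {set 'I_n} := odflt set0 [pick B in flag_initial_bases M (val F)].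
have hB F : B F \in flag_initial_bases M (val F).
  rewrite /B; case: pickP => //= h; have [C hC] := flag_initial_exists M (val F).
  by rewrite h in hC.
have rB F : mrank M = #|B F| by apply: mrankE; have := hB F; rewrite inE => /andP[].
have [[hS1 hS2] hSF] := hS; have [[hQ1 hQ2] hQF] := hQ.
have cS : series_char t (lambda (eclass_dual S)) (fun F => class_poly t (B F)).
  apply: (lambda_char (@tpow_neq0 n) (dual_is_ebundle hS1) (dual_is_ebundle hS2)) => F.
  exact: (taut_poly _ (hSF F _ (hB F))).
have cQ : series_char t (lambda (eclass_dual Q)) (fun F => class_poly t (~: B F)).
  apply: (lambda_char (@tpow_neq0 n) (dual_is_ebundle hQ1) (dual_is_ebundle hQ2)) => F.
  exact: (taut_poly _ (hQF F _ (hB F))).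
have cQ1 : has_char t (lambda_minus1 (n - mrank M) (eclass_dual Q))
    (fun F => (class_poly t (~: B F)).[-1]).
  apply: (lambda_minus1_char cQ) => F; apply: leq_trans (size_class_poly _ _) _.
  by rewrite ltnS (rB F) cardsCs setCK card_ord.
have cL : has_char t [:: (1, line_bundle L)] (fun F => mono t (line_wt L F)).
  apply: has_char_ext (has_char1 t (line_is_ebundle hL)) _ => F.
  by rewrite /echar (bigD1 tt) //= big1 ?addr0 // => -[].
pose u : ratl := var_u.
pose a := line_height L.
(* The coefficients of [chi_poly] reassemble to the evaluation of [class_poly] at u, since its
   degree is at most the rank. The product over E of the factors 1 + u t, 1 - t and the weights of L
   is the product of the steps, as x lies in the initial basis exactly when it is outside the
   closure of its predecessors. *)
have main : at1 (flag_sum t u (cl M) a None set0 setT) (chi_poly M S Q L).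
  rewrite flag_sum_charts; set J := \sum_F _.
  have -> : J = \sum_(i < (mrank M).+1) u ^+ i * \sum_F link_prod t None (chart_seq F) *
      ((class_poly t (B F))`_i * (class_poly t (~: B F)).[-1] * mono t (line_wt L F)).
    under [RHS]eq_bigr do rewrite mulr_sumr.
    rewrite exchange_big; apply: eq_bigr => F _ /=.
    transitivity (link_prod t None (chart_seq F) *
        ((\sum_(i < (mrank M).+1) (class_poly t (B F))`_i * u ^+ i) *
         ((class_poly t (~: B F)).[-1] * mono t (line_wt L F)))); last first.
      by rewrite mulr_suml mulr_sumr; apply: eq_bigr => i _; ring.
    congr (_ * _); rewrite (rB F).
    rewrite -(horner_coef_wide u (size_class_poly t (B F))) !horner_class_poly.
    pose f x := (if x \in B F then 1 + u * t x else 1 - t x) * t x ^ line_wt L F x.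
    rewrite (step_prodE (f := f)) => [|s1 x s2 E]; last first.
      by rewrite /step set0U /f (initial_mem (hB F) E) (line_wt_step hL E); case: cl.
    have -> : \prod_(x <- chart_seq F) f x = \prod_x f x.
      by rewrite (perm_big _ (ordering_perm (chart_seqP F))) big_enum.
    rewrite big_split mulrA; congr (_ * _).
    rewrite (bigID (mem (B F))) /=; congr (_ * _).
      by apply: eq_bigr => x ->.
    apply: eq_big => [x|x /negbTE ->]; first by rewrite inE.
    by rewrite mulN1r.
  rewrite /chi_poly poly_def; apply: at1_sum => i _.
  rewrite -mul_polyC [X in at1 _ X]mulrC; apply: at1M.
    elim: (nat_of_ord i) => [|j IH]; first by rewrite !expr0; apply: at1_1.
    by rewrite !exprS; apply: at1M IH; apply: at1_u.
  exact: (chi_at1 hn (has_char_mul (@tpow_neq0 n) (has_char_mul (@tpow_neq0 n) (cS i) cQ1) cL)).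
have [||q E q0] := @good_flag_sum _ _ t u (@tpow_neq0 n) (@tpow_inj n) (cl M) (@cl_sub _ M) (@cl_exch _ M)
  at1 at1_1 at1D at1N at1M (@at1_tpow n) at1_u false a set0 setT.
- by rewrite properE sub0set /=; apply/subsetPn; exists (Ordinal hn); rewrite !inE.
- exact: nef_submod.
by exists q; split=> //; apply: at1_uniq main E.
Qed.
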